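(* Let $Q$ be a regular multiplier Hopf algebra with bijective antipode $S$, and let $A\in{}^Q_Q\mathcal{LA}^Q_Q$. Then $A$ is a left-left $Q\otimes Q^{op}$-Long module algebra with the action and coaction $$(x\otimes y)\rhd a=x\rhd a\lhd y,\qquad a\mapsto\sum \bigl(a_{(-1)}\otimes S^{-1}(a_{(1)})\bigr)\otimes a_0 .$$ Moreover, the algebra $(A,\bullet)$, where $\bullet$ is the corresponding left twisted product $$a\bullet b=\sum a_0\,(a_{(-1)}\rhd b\lhd S^{-1}(a_{(1)})),$$ and the algebra $(A,\circledast)$, where $$a\circledast b=\sum(a_0\lhd b_{(1)})(a_{(-1)}\rhd b_0),$$ are isomorphic, an isomorphism and its inverse being $$\alpha:(A,\bullet)\to(A,\circledast),\ a\mapsto\sum a_0\lhd a_{(1)},\qquad \alpha^{-1}:(A,\circledast)\to(A,\bullet),\ a\mapsto\sum a_0\lhd S^{-1}(a_{(1)}).$$ In particular, $A\diamond^Q_rA\cong A\star^Q_rA$ and $A\diamond^Q_lA\cong A\star^Q_lA$ as algebras.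
   Context: Algebras are associative over a field $k$, not necessarily unital, with non-degenerate product and with local units; $M(A)$ is the multiplier algebra of $A$. A multiplier Hopf algebra is an algebra $Q$ with a homomorphism $\Delta:Q\to M(Q\otimes Q)$ such that $T_1(x\otimes y)=\Delta(x)(1\otimes y)$ and $T_2(x\otimes y)=(x\otimes 1)\Delta(y)$ lie in $Q\otimes Q$, $(T_2\otimes \mathrm{id})(\mathrm{id}\otimes T_1)=(\mathrm{id}\otimes T_1)(T_2\otimes \mathrm{id})$, and $T_1,T_2$ are bijective on $Q\otimes Q$; it is regular if $(Q,\tau\Delta)$, $\tau$ the flip, is also a multiplier Hopf algebra. Sweedler notation $\Delta(x)=\sum x_1\otimes x_2$ is used with the usual covering conventions. $Q^{op}$ is $Q$ with opposite product and the same comultiplication. Modules are unital ($Q\rhd A=A$, $A\lhd Q=A$). $A$ is a left $Q$-module algebra if $x\rhd(ab)=\sum(x_1\rhd a)(x_2\rhd b)$, a right $Q$-module algebra if $(ab)\lhd x=\sum(a\lhd x_1)(b\lhd x_2)$, and a $Q$-bimodule algebra if it is both and $(x\rhd a)\lhd y=x\rhd(a\lhd y)$. A left $Q$-comodule algebra is an algebra $A$ with an injective homomorphism $\Gamma:A\to M(Q\otimes A)$, $\Gamma(a)=\sum a_{(-1)}\otimes a_0$, such that $\Gamma(a)(x\otimes 1),(x\otimes1)\Gamma(a)\in Q\otimes A$ and $(\mathrm{id}\otimes\Gamma)\Gamma=(\Delta\otimes\mathrm{id})\Gamma$; right $Q$-comodule algebras $\Upsilon:A\to M(A\otimes Q)$,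 $\Upsilon(a)=\sum a_0\otimes a_{(1)}$, are defined symmetrically; a $Q$-bicomodule algebra is both, with $(\mathrm{id}\otimes\Upsilon)\Gamma=(\Gamma\otimes\mathrm{id})\Upsilon$ (suitably covered), and then $\sum a_{(-1)}\otimes a_0\otimes a_{(1)}$ denotes the common value. For a multiplier Hopf algebra $H$, a left-left $H$-Long module algebra is a left $H$-module algebra and left $H$-comodule algebra $A$ with $\Gamma(x\rhd a)(y\otimes1)=\sum a_{(-1)}y\otimes x\rhd a_0$ for all $x,y\in H$, $a\in A$. For such $A$, the left twisted product is $a\bullet b=\sum a_0(a_{(-1)}\rhd b)$. $A\in{}^Q_Q\mathcal{LA}^Q_Q$ (the four sides Long module category) means that $A$ is a $Q$-bimodule algebra and a $Q$-bicomodule algebra such that for all $x,y\in Q$, $a\in A$: $\Gamma(x\rhd a)(y\otimes1)=\sum a_{(-1)}y\otimes x\rhd a_0$; $\Upsilon(x\rhd a)(1\otimes y)=\sum x\rhd a_0\otimes a_{(1)}y$; $\Upsilon(a\lhd x)(1\otimes y)=\sum a_0\lhd x\otimes a_{(1)}y$; $\Gamma(a\lhd x)(y\otimes1)=\sum a_{(-1)}y\otimes a_0\lhd x$. For a $Q$-bimodule algebra $A$ and a $Q$-bicomodule algebra $B$ (here applied with $B=A$) one defines the algebras: $B\star^Q_rA=B\otimes A$: $(b'\star a')(b\star a)=\sum b'b_0\star(S^{-1}(b_{(-1)})\rhd a'\lhd b_{(1)})a$; $A\star^Q_lB=A\otimes B$: $(a\star b)(a'\star b')=\sum a(b_{(-1)}\rhd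 a'\lhd S^{-1}(b_{(1)}))\star b_0b'$; $B\diamond^Q_rA=B\otimes A$: $(b'\diamond a')(b\diamond a)=\sum b'_0b_0\diamond(a'\lhd b_{(1)})(b'_{(-1)}\rhd a)$; $A\diamond^Q_lB=A\otimes B$: $(a\diamond b)(a'\diamond b')=\sum(a\lhd b'_{(1)})(b_{(-1)}\rhd a')\diamond b_0b'_0$. *)

(* Defs.v *)
From HB Require Import structures.
From mathcomp Require Import all_boot ssralg.
From mathcomp Require Import boolp classical_sets.

Set Implicit Arguments.
Unset Strict Implicit.
Unset Printing Implicit Defensive.

Import GRing.Theory.
Local Open Scope ring_scope.
Local Open Scope quotient_scope.

Definition bilin (k : fieldType) (U V W : lmodType k) (f : U -> V -> W) : Prop :=
  (forall u, linear (f u)) /\ (forall v, linear (f^~ v)).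

(* The tensor product of two (possibly infinite dimensional) vector spaces:
   formal finite sums of pairs, two of them being identified when no bilinear
   map separates them.  [tlift_tpure] and [tlift_unique] below are the
   universal property. *)
Section TensorProduct.
Variables (k : fieldType) (U V : lmodType k).
Local Notation sums := (seq (U * V)).

Definition sum_of (W : lmodType k) (f : U -> V -> W) (s : sums) : W :=
  \sum_(p <- s) f p.1 p.2.

Definition teq (s s' : sums) : bool :=
  `[< forall (W : lmodType k) (f : U -> V -> W),
        bilin f -> sum_of f s = sum_of f s' >].

Lemma teq_refl : reflexive teq.
Proof. by move=> s; apply/asboolP. Qed.

Lemma teq_sym : symmetric teq.
Proof.
move=> s s'; apply/asboolP/asboolP => h W f fb; exact/esym/h.
Qed.

Lemma teq_trans : transitive teq.
Proof.
move=> s' s s'' /asboolP h /asboolP h'; apply/asboolP => W f fb.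
by rewrite h // h'.
Qed.

Canonical teq_equiv := EquivRel teq teq_refl teq_sym teq_trans.

Definition tensor : Type := {eq_quot teq_equiv}.
HB.instance Definition _ := Choice.on tensor.
HB.instance Definition _ := EqQuotient.on tensor.

Definition tpure (u : U) (v : V) : tensor := \pi_tensor [:: (u, v)].

(* Meaningful for a bilinear f, otherwise a junk value. *)
Definition tlift (W : lmodType k) (f : U -> V -> W) (t : tensor) : W :=
  sum_of f (repr t).

Lemma tlift_pi (W : lmodType k) (f : U -> V -> W) s :
  bilin f -> tlift f (\pi_tensor s) = sum_of f s.
Proof.
move=> fb; have /eqmodP/asboolP h := reprK (\pi_tensor s).
exact: h.
Qed.

Lemma tensor_ext (s t : tensor) :
  (forall (W : lmodType k) (f : U -> V -> W),
     bilin f -> tlift f s = tlift f t) -> s = t.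
Proof.
move=> h; rewrite -[s]reprK -[t]reprK; apply/eqmodP/asboolP => W f fb.
exact: h.
Qed.

Definition tzero : tensor := \pi_tensor [::].
Definition tadd (s t : tensor) : tensor := \pi_tensor (repr s ++ repr t).
Definition tscale (c : k) (t : tensor) : tensor :=
  \pi_tensor [seq (c *: p.1, p.2) | p <- repr t].
Definition topp (t : tensor) : tensor := tscale (-1) t.

Section Lift.
Variables (W : lmodType k) (f : U -> V -> W).
Hypothesis fb : bilin f.

Lemma bilinDl u u' v : f (u + u') v = f u v + f u' v.
Proof. by have := fb.2 v 1 u u'; rewrite !scale1r. Qed.
Lemma bilin0l v : f 0 v = 0.
Proof. by apply: (addrI (f 0 v)); rewrite -bilinDl !addr0. Qed.
Lemma bilinZl c u v : f (c *: u) v = c *: f u v.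
Proof. by have := fb.2 v c u 0; rewrite bilin0l !addr0. Qed.

Lemma tlift0_subproof : tlift f tzero = 0.
Proof. by rewrite tlift_pi // /sum_of big_nil. Qed.
Lemma tliftD_subproof s t : tlift f (tadd s t) = tlift f s + tlift f t.
Proof. by rewrite tlift_pi // /sum_of big_cat. Qed.
Lemma tliftZ_subproof c t : tlift f (tscale c t) = c *: tlift f t.
Proof.
rewrite tlift_pi // /sum_of big_map /= scaler_sumr.
by apply: eq_bigr => p _; rewrite bilinZl.
Qed.
End Lift.

Lemma taddA : associative tadd.
Proof.
by move=> x y z; apply: tensor_ext => W f fb; rewrite !tliftD_subproof // addrA.
Qed.
Lemma taddC : commutative tadd.
Proof.
by move=> x y; apply: tensor_ext => W f fb; rewrite !tliftD_subproof // addrC.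
Qed.
Lemma tadd0 : left_id tzero tadd.
Proof.
move=> x; apply: tensor_ext => W f fb.
by rewrite tliftD_subproof // tlift0_subproof // add0r.
Qed.
Lemma taddN : left_inverse tzero topp tadd.
Proof.
move=> x; apply: tensor_ext => W f fb; rewrite tliftD_subproof //.
by rewrite tliftZ_subproof // tlift0_subproof // scaleN1r addNr.
Qed.
HB.instance Definition _ := GRing.isZmodule.Build tensor taddA taddC tadd0 taddN.

Lemma tscaleA a b t : tscale a (tscale b t) = tscale (a * b) t.
Proof.
by apply: tensor_ext => W f fb; rewrite !tliftZ_subproof // scalerA.
Qed.
Lemma tscale1 : left_id 1 tscale.
Proof.
by move=> x; apply: tensor_ext => W f fb; rewrite tliftZ_subproof // scale1r.
Qed.
Lemma tscaleDr : right_distributive tscale +%R.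
Proof.
move=> a s t; apply: tensor_ext => W f fb.
by rewrite tliftZ_subproof // !tliftD_subproof // !tliftZ_subproof // scalerDr.
Qed.
Lemma tscaleDl t : {morph tscale^~ t : a b / a + b}.
Proof.
move=> a b; apply: tensor_ext => W f fb.
by rewrite tliftD_subproof // !tliftZ_subproof // scalerDl.
Qed.
HB.instance Definition _ :=
  GRing.Zmodule_isLmodule.Build k tensor tscaleA tscale1 tscaleDr tscaleDl.

End TensorProduct.

Arguments tpure {k U V} u v.
Arguments tlift {k U V W} f t.
Notation "u \ox v" := (tpure u v) (at level 40, left associativity).

Lemma tlift_linear (k : fieldType) (U V W : lmodType k) (f : U -> V -> W) :
  bilin f -> linear (tlift f).
Proof.
by move=> fb c s t; rewrite -tliftZ_subproof // -tliftD_subproof.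
Qed.

Lemma tlift_tpure (k : fieldType) (U V W : lmodType k) (f : U -> V -> W) u v :
  bilin f -> tlift f (u \ox v) = f u v.
Proof. by move=> fb; rewrite tlift_pi // /sum_of big_seq1. Qed.

Lemma tpure_bilin (k : fieldType) (U V : lmodType k) : bilin (@tpure k U V).
Proof.
split=> [u c v v'|v c u u']; apply: tensor_ext => X f fb;
  by rewrite (tlift_linear fb) !tlift_tpure // ?fb.1 ?(fb.2 v).
Qed.

Section LinearProp.
Variables (k : fieldType) (U W : lmodType k) (F : U -> W).
Hypothesis Fl : linear F.
Lemma linP0 : F 0 = 0.
Proof.
by apply: (addrI (F 0)); have := Fl 1 0 0; rewrite !scale1r !addr0.
Qed.
Lemma linPD u v : F (u + v) = F u + F v.
Proof. by have := Fl 1 u v; rewrite !scale1r. Qed.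
Lemma linPZ c u : F (c *: u) = c *: F u.
Proof. by have := Fl c u 0; rewrite linP0 !addr0. Qed.
Lemma linP_sum (I : Type) (r : seq I) (h : I -> U) :
  F (\sum_(i <- r) h i) = \sum_(i <- r) F (h i).
Proof. exact: (big_morph F linPD linP0). Qed.
End LinearProp.

Lemma tensorE (k : fieldType) (U V : lmodType k) (t : tensor U V) :
  t = \sum_(p <- repr t) p.1 \ox p.2.
Proof.
apply: tensor_ext => X f fb; rewrite (linP_sum (tlift_linear fb)).
by apply: eq_bigr => p _; rewrite tlift_tpure.
Qed.

Lemma tlift_unique (k : fieldType) (U V W : lmodType k)
    (F G : tensor U V -> W) : linear F -> linear G ->
  (forall u v, F (u \ox v) = G (u \ox v)) -> F =1 G.
Proof.
move=> Fl Gl h t; rewrite [t]tensorE (linP_sum Fl) (linP_sum Gl).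
by apply: eq_bigr => p _; exact: h.
Qed.

Lemma bilin_tlift (k : fieldType) (U V X Y W : lmodType k)
    (g : U -> V -> X -> Y -> W) (t : tensor X Y) :
  (forall x y, bilin (fun u v => g u v x y)) ->
  bilin (fun u v => tlift (g u v) t).
Proof.
move=> gb; split=> [u|v] c z z'; rewrite /tlift /sum_of scaler_sumr -big_split /=;
  apply: eq_bigr => p _; first exact: (gb _ _).1.
exact: (gb p.1 p.2).2.
Qed.

Definition tmap (k : fieldType) (U V U' V' : lmodType k)
    (f : U -> U') (g : V -> V') : tensor U V -> tensor U' V' :=
  tlift (fun u v => f u \ox g v).

Section TmapTheory.
Variables (k : fieldType) (U V U' V' : lmodType k).
Variables (f : U -> U') (g : V -> V').
Hypotheses (fl : linear f) (gl : linear g).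
Lemma tmap_bilin : bilin (fun u v => f u \ox g v).
Proof.
have [h1 h2] := tpure_bilin U' V'.
by split=> [u|v] c z z' /=; [rewrite gl h1 | rewrite fl h2].
Qed.
Lemma tmap_linear : linear (tmap f g).
Proof. exact: tlift_linear tmap_bilin. Qed.
Lemma tmap_tpure u v : tmap f g (u \ox v) = f u \ox g v.
Proof. exact: tlift_tpure tmap_bilin. Qed.
End TmapTheory.

Lemma tlift_tmap (k : fieldType) (U V U' V' W : lmodType k)
    (f : U' -> V' -> W) (g : U -> U') (h : V -> V') (t : tensor U V) :
  bilin f -> linear g -> linear h ->
  tlift f (tmap g h t) = tlift (fun u v => f (g u) (h v)) t.
Proof.
move=> fb gl hl.
have fgh : bilin (fun u v => f (g u) (h v)).
  by split=> [u|v] c z z' /=; [rewrite hl fb.1 | rewrite gl (fb.2 (h v))].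
move: t; apply: tlift_unique => [c x y|c x y|u v].
- by rewrite (tmap_linear gl hl) (tlift_linear fb).
- exact: (tlift_linear fgh).
by rewrite tmap_tpure // !tlift_tpure.
Qed.

Definition tassoc (k : fieldType) (U V W : lmodType k) :
    tensor (tensor U V) W -> tensor U (tensor V W) :=
  tlift (fun s w => tlift (fun u v => u \ox (v \ox w)) s).

Definition tassoc_inv (k : fieldType) (U V W : lmodType k) :
    tensor U (tensor V W) -> tensor (tensor U V) W :=
  tlift (fun u s => tlift (fun v w => (u \ox v) \ox w) s).

Definition tswap (k : fieldType) (U V : lmodType k) :
    tensor U V -> tensor V U :=
  tlift (fun u v => v \ox u).

Definition tmid (k : fieldType) (U V X Y : lmodType k) :
    tensor (tensor U V) (tensor X Y) -> tensor (tensor U X) (tensor V Y) :=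
  tlift (fun s t =>
    tlift (fun u v => tlift (fun x y => (u \ox x) \ox (v \ox y)) t) s).

Record nalg (k : fieldType) := NAlg {
  nalg_sort :> lmodType k;
  nmul : nalg_sort -> nalg_sort -> nalg_sort;
  nmul_bilin : bilin nmul;
  nmulA : associative nmul;
  nmul_nondegl : forall a, (forall b, nmul a b = 0) -> a = 0;
  nmul_nondegr : forall b, (forall a, nmul a b = 0) -> b = 0;
  nalg_local_units : forall s : seq nalg_sort,
    exists e, forall a, a \in s -> nmul e a = a /\ nmul a e = a
}.

Notation "a ** b" := (nmul a b) (at level 40, left associativity).

Section OppositeAlgebra.
Variables (k : fieldType) (A : nalg k).

Definition nopp_mul (a b : A) : A := b ** a.

Fact nopp_bilin : bilin nopp_mul.
Proof. by have [h1 h2] := nmul_bilin A; split; [exact: h2 | exact: h1]. Qed.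
Fact nopp_mulA : associative nopp_mul.
Proof. by move=> a b c; rewrite /nopp_mul nmulA. Qed.
Fact nopp_local_units (s : seq A) :
  exists e, forall a, a \in s -> nopp_mul e a = a /\ nopp_mul a e = a.
Proof.
by have [e he] := nalg_local_units s; exists e => a /he [].
Qed.

Definition nopp : nalg k :=
  NAlg nopp_bilin nopp_mulA (@nmul_nondegr _ A) (@nmul_nondegl _ A)
    nopp_local_units.
End OppositeAlgebra.

Section TensorAlgebra.
Variables (k : fieldType) (A B : nalg k).

Definition ntens_mul (s t : tensor A B) : tensor A B :=
  tlift (fun a b => tlift (fun a' b' => (a ** a') \ox (b ** b')) t) s.

Fact ntens_quad a b : bilin (fun a' b' => (a ** a') \ox (b ** b') : tensor A B).
Proof. exact: (tmap_bilin ((nmul_bilin A).1 a) ((nmul_bilin B).1 b)). Qed.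
Fact ntens_quad' a' b' : bilin (fun a b => (a ** a') \ox (b ** b') : tensor A B).
Proof. exact: (tmap_bilin ((nmul_bilin A).2 a') ((nmul_bilin B).2 b')). Qed.

Fact ntens_bilin : bilin ntens_mul.
Proof.
split=> [s|t] c z z'.
  rewrite /ntens_mul {1 3 5}/tlift /sum_of scaler_sumr -big_split /=.
  by apply: eq_bigr => p _; exact: (tlift_linear (ntens_quad _ _)).
apply: (tlift_linear (f := fun a b => tlift _ t)).
by apply: bilin_tlift => a' b'; exact: ntens_quad'.
Qed.

Lemma ntens_mul_tpure a b a' b' :
  ntens_mul (a \ox b) (a' \ox b') = (a ** a') \ox (b ** b').
Proof.
rewrite /ntens_mul tlift_tpure; last first.
  by apply: bilin_tlift => x y; exact: ntens_quad'.
by rewrite tlift_tpure //; exact: ntens_quad.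
Qed.

Fact ntens_mulA : associative ntens_mul.
Proof.
have [L R] := ntens_bilin.
move=> r s t; move: r.
apply: tlift_unique => [c x y|c x y|a b].
- exact: R.
- by rewrite !R.
move: s; apply: tlift_unique => [c x y|c x y|a' b'].
- by rewrite R L.
- by rewrite L R.
move: t; apply: tlift_unique => [c x y|c x y|a'' b''].
- by rewrite L L.
- by rewrite L.
by rewrite !ntens_mul_tpure !nmulA.
Qed.

Fact ntens_local_units (s : seq (tensor A B)) :
  exists e, forall a, a \in s -> ntens_mul e a = a /\ ntens_mul a e = a.
Proof.
have [L R] := ntens_bilin.
pose u := flatten [seq (repr t : seq (A * B)) | t <- s].
have [e he] := nalg_local_units [seq p.1 | p <- u].
have [f hf] := nalg_local_units [seq p.2 | p <- u].
exists (e \ox f) => t ts.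
have h p : p \in (repr t : seq (A * B)) -> p \in u.
  by move=> pt; apply/flattenP; exists (repr t) => //; exact: map_f.
have ef p : p \in (repr t : seq (A * B)) ->
    ntens_mul (e \ox f) (p.1 \ox p.2) = p.1 \ox p.2
    /\ ntens_mul (p.1 \ox p.2) (e \ox f) = p.1 \ox p.2.
  move=> /h pu; rewrite !ntens_mul_tpure.
  by have [-> ->] := he _ (map_f _ pu); have [-> ->] := hf _ (map_f _ pu).
rewrite [t]tensorE (linP_sum (L _)) (linP_sum (R _)) -tensorE.
by split; rewrite [RHS]tensorE !big_seq; apply: eq_bigr => p /ef [].
Qed.

Fact ntens_nondegl a : (forall b, ntens_mul a b = 0) -> a = 0.
Proof.
move=> h; have [e he] := ntens_local_units [:: a].
by have [_ <-] := he a (mem_head _ _).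
Qed.

Fact ntens_nondegr b : (forall a, ntens_mul a b = 0) -> b = 0.
Proof.
move=> h; have [e he] := ntens_local_units [:: b].
by have [<- _] := he b (mem_head _ _).
Qed.

Definition ntens : nalg k :=
  NAlg ntens_bilin ntens_mulA ntens_nondegl ntens_nondegr ntens_local_units.
End TensorAlgebra.

(* The multiplier algebra M(A).  A multiplier m is given by b |-> m b ([mulL])
   and b |-> b m ([mulR]). *)
Record multiplier (k : fieldType) (A : nalg k) := Multiplier {
  mulL : A -> A;
  mulR : A -> A;
  mulL_linear : linear mulL;
  mulR_linear : linear mulR;
  mulRL : forall a b, mulR a ** b = a ** mulL b
}.

Section MultiplierAlgebra.
Variables (k : fieldType) (A : nalg k).
Implicit Types m n : multiplier A.

Lemma multiplier_ext m n :
  mulL m =1 mulL n -> mulR m =1 mulR n -> m = n.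
Proof.
case: m n => l r ll rl e [l' r' ll' rl' e'] /= /funext h /funext h'.
by subst l' r'; congr Multiplier; exact: Prop_irrelevance.
Qed.

HB.instance Definition _ := gen_eqMixin (multiplier A).
HB.instance Definition _ := gen_choiceMixin (multiplier A).

Let L (a : A) := (nmul_bilin A).1 a.
Let R (a : A) := (nmul_bilin A).2 a.

Fact mzeroP (a b : A) : 0 ** b = a ** 0.
Proof. by rewrite (linP0 (L a)) (linP0 (R b)). Qed.
Fact mzero_linear : linear (fun _ : A => 0 : A).
Proof. by move=> c x y; rewrite scaler0 addr0. Qed.
Definition mzero := Multiplier mzero_linear mzero_linear mzeroP.

Fact mcomb_linear c (f g : A -> A) : linear f -> linear g ->
  linear (fun x => c *: f x + g x).
Proof.
move=> fl gl a x y; rewrite fl gl !scalerDr !scalerA [c * a]mulrC.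
by rewrite !addrA; congr (_ + _); rewrite addrAC.
Qed.
Fact mcombP c m n (a b : A) :
  (c *: mulR m a + mulR n a) ** b = a ** (c *: mulL m b + mulL n b).
Proof. by rewrite L R !mulRL. Qed.
Definition mcomb c m n :=
  Multiplier (mcomb_linear c (@mulL_linear _ _ m) (@mulL_linear _ _ n))
    (mcomb_linear c (@mulR_linear _ _ m) (@mulR_linear _ _ n)) (mcombP c m n).

Definition madd m n := mcomb 1 m n.
Definition mscale c m := mcomb c m mzero.
Definition mopp m := mscale (-1) m.

Fact maddA : associative madd.
Proof. by move=> x y z; apply: multiplier_ext => a /=; rewrite !scale1r addrA. Qed.
Fact maddC : commutative madd.
Proof. by move=> x y; apply: multiplier_ext => a /=; rewrite !scale1r addrC. Qed.
Fact madd0 : left_id mzero madd.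
Proof. by move=> x; apply: multiplier_ext => a /=; rewrite scaler0 add0r. Qed.
Fact maddN : left_inverse mzero mopp madd.
Proof.
by move=> x; apply: multiplier_ext => a /=; rewrite scale1r addr0 scaleN1r addNr.
Qed.
HB.instance Definition _ :=
  GRing.isZmodule.Build (multiplier A) maddA maddC madd0 maddN.

Fact mscaleA a b m : mscale a (mscale b m) = mscale (a * b) m.
Proof. by apply: multiplier_ext => x /=; rewrite !addr0 scalerA. Qed.
Fact mscale1 : left_id 1 mscale.
Proof. by move=> m; apply: multiplier_ext => x /=; rewrite addr0 scale1r. Qed.
Fact mscaleDr : right_distributive mscale +%R.
Proof.
by move=> a m n; apply: multiplier_ext => x /=; rewrite !addr0 !scale1r scalerDr.
Qed.
Fact mscaleDl m : {morph mscale^~ m : a b / a + b}.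
Proof.
by move=> a b; apply: multiplier_ext => x /=; rewrite !addr0 !scale1r scalerDl.
Qed.
HB.instance Definition _ := GRing.Zmodule_isLmodule.Build k (multiplier A)
  mscaleA mscale1 mscaleDr mscaleDl.

Fact mone_linear : linear (fun x : A => x).
Proof. by []. Qed.
Definition mone : multiplier A :=
  Multiplier mone_linear mone_linear (fun _ _ => erefl).

Fact mcomp_linear (f g : A -> A) : linear f -> linear g ->
  linear (fun x => f (g x)).
Proof. by move=> fl gl c x y; rewrite gl fl. Qed.
Fact mcompP m n (a b : A) :
  mulR n (mulR m a) ** b = a ** mulL m (mulL n b).
Proof. by rewrite !mulRL. Qed.
Definition mmul m n : multiplier A :=
  Multiplier (mcomp_linear (@mulL_linear _ _ m) (@mulL_linear _ _ n))
    (mcomp_linear (@mulR_linear _ _ n) (@mulR_linear _ _ m)) (mcompP m n).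

Fact membP (c a b : A) : (a ** c) ** b = a ** (c ** b).
Proof. by rewrite nmulA. Qed.
Definition memb (c : A) : multiplier A := Multiplier (L c) (R c) (membP c).

Lemma memb_inj : injective memb.
Proof.
move=> a b ab; apply/eqP; rewrite -subr_eq0; apply/eqP.
apply: nmul_nondegl => c; have := congr1 (fun m => mulL m c) ab => /= h.
by rewrite addrC -scaleN1r R h scaleN1r addNr.
Qed.

Lemma mulLM m (a b : A) : mulL m (a ** b) = mulL m a ** b.
Proof.
apply/eqP; rewrite -subr_eq0; apply/eqP; apply: nmul_nondegr => d.
rewrite addrC -scaleN1r L scaleN1r -mulRL [d ** (mulL m a ** b)]nmulA.
by rewrite -mulRL -nmulA addNr.
Qed.

Lemma mulRM m (a b : A) : mulR m (a ** b) = a ** mulR m b.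
Proof.
apply/eqP; rewrite -subr_eq0; apply/eqP; apply: nmul_nondegl => d.
rewrite addrC -scaleN1r R scaleN1r mulRL -[a ** mulR m b ** d]nmulA.
by rewrite mulRL nmulA addNr.
Qed.

Lemma memb_mulL m a : memb (mulL m a) = mmul m (memb a).
Proof.
by apply: multiplier_ext => b /=; [rewrite mulLM | rewrite mulRL].
Qed.

Lemma memb_mulR m a : memb (mulR m a) = mmul (memb a) m.
Proof.
by apply: multiplier_ext => b /=; [rewrite mulRL | rewrite mulRM].
Qed.

Definition in_alg m : Prop := exists a, memb a = m.

(* The element of A that the multiplier m is, when m lies in A. *)
Definition elem m : A := xget 0 [set a | memb a = m]%classic.

Lemma elemK m : in_alg m -> memb (elem m) = m.
Proof. by case=> a am; rewrite /elem; case: xgetP => // /(_ a). Qed.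

Lemma membK a : elem (memb a) = a.
Proof. by apply: memb_inj; apply: elemK; exists a. Qed.

End MultiplierAlgebra.

Arguments mone {k A}.
Notation "m *m* n" := (mmul m n) (at level 40, left associativity).

Section TensorMultiplier.
Variables (k : fieldType) (A B : nalg k).

Fact mtensP (m : multiplier A) (n : multiplier B) (s t : ntens A B) :
  @nmul _ (ntens A B) (tmap (mulR m) (mulR n) s) t
    = @nmul _ (ntens A B) s (tmap (mulL m) (mulL n) t).
Proof.
have [L R] := nmul_bilin (ntens A B).
have ml := tmap_linear (@mulL_linear _ _ m) (@mulL_linear _ _ n).
have mr := tmap_linear (@mulR_linear _ _ m) (@mulR_linear _ _ n).
move: s; apply: tlift_unique => [c x y|c x y|a b].
- by rewrite mr R.
- exact: R.
move: t; apply: tlift_unique => [c x y|c x y|a' b'].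
- exact: L.
- by rewrite ml L.
rewrite !tmap_tpure; try solve [exact: mulL_linear | exact: mulR_linear].
by rewrite /= !ntens_mul_tpure !mulRL.
Qed.

Definition mtens (m : multiplier A) (n : multiplier B) :
    multiplier (ntens A B) :=
  Multiplier (A := ntens A B)
    (tmap_linear (@mulL_linear _ _ m) (@mulL_linear _ _ n))
    (tmap_linear (@mulR_linear _ _ m) (@mulR_linear _ _ n)) (mtensP m n).

Fact ntens_opp (s t : tensor A B) :
  @nmul _ (ntens (nopp A) (nopp B)) s t = @nmul _ (ntens A B) t s.
Proof.
have [L R] := nmul_bilin (ntens A B).
have [L' R'] := nmul_bilin (ntens (nopp A) (nopp B)).
move: s; apply: tlift_unique => [c x y|c x y|a b].
- exact: R'.
- exact: L.
move: t; apply: tlift_unique => [c x y|c x y|a' b'].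
- exact: L'.
- exact: R.
by rewrite /= !ntens_mul_tpure.
Qed.

Fact mopPP (m : multiplier (ntens A B)) (s t : ntens (nopp A) (nopp B)) :
  @nmul _ (ntens (nopp A) (nopp B)) (mulL m s) t
    = @nmul _ (ntens (nopp A) (nopp B)) s (mulR m t).
Proof. by rewrite !ntens_opp mulRL. Qed.

(* M(A (x) B) and M(A^op (x) B^op) have the same elements. *)
Definition mop (m : multiplier (ntens A B)) :
    multiplier (ntens (nopp A) (nopp B)) :=
  Multiplier (A := ntens (nopp A) (nopp B))
    (@mulR_linear _ _ m) (@mulL_linear _ _ m) (mopPP m).
End TensorMultiplier.

(* Transport of a multiplier along an isomorphism of algebras theta. *)
Definition mpush (k : fieldType) (A B : nalg k) (theta : A -> B)
    (m : multiplier A) : multiplier B :=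
  xget 0 [set m' | forall t, mulL m' (theta t) = theta (mulL m t)
                          /\ mulR m' (theta t) = theta (mulR m t)]%classic.

Lemma mpushP (k : fieldType) (A B : nalg k) (theta : A -> B)
    (m : multiplier A) :
  linear theta -> {morph theta : a b / a ** b} -> bijective theta ->
  forall t, mulL (mpush theta m) (theta t) = theta (mulL m t)
         /\ mulR (mpush theta m) (theta t) = theta (mulR m t).
Proof.
move=> thl thM [eta ek ke].
have el : linear eta.
  by move=> c u v; apply: (can_inj ek); rewrite thl !ke.
have conj_linear (f : A -> A) : linear f -> linear (fun b => theta (f (eta b))).
  by move=> fl c u v; rewrite el fl thl.
have P a b : theta (mulR m (eta a)) ** b = a ** theta (mulL m (eta b)).
  by rewrite -[b in LHS]ke -thM mulRL thM !ke.
pose m' := Multiplier (conj_linear _ (@mulL_linear _ _ m))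
             (conj_linear _ (@mulR_linear _ _ m)) P.
rewrite /mpush; case: xgetP => [m1 _ //|/(_ m')].
by case=> t /=; rewrite !ek.
Qed.

Definition mhom (k : fieldType) (A B : nalg k) (f : A -> multiplier B) : Prop :=
  linear f /\ forall a b, f (a ** b) = f a *m* f b.

Section MultiplierHopf.
Variables (k : fieldType) (Q : nalg k) (D : Q -> multiplier (ntens Q Q)).

Definition T1 : tensor Q Q -> tensor Q Q :=
  tlift (fun x y => elem (D x *m* mtens mone (memb y))).

Definition T2 : tensor Q Q -> tensor Q Q :=
  tlift (fun x y => elem (mtens (memb x) mone *m* D y)).

Record mult_hopf : Prop := {
  mult_hopf_hom : mhom D;
  mult_hopf_T1 : forall x y, in_alg (D x *m* mtens mone (memb y));
  mult_hopf_T2 : forall x y, in_alg (mtens (memb x) mone *m* D y);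
  mult_hopf_coassoc : forall t : tensor (tensor Q Q) Q,
    tmap T2 id (tassoc_inv (tmap id T1 (tassoc t)))
      = tassoc_inv (tmap id T1 (tassoc (tmap T2 id t)));
  mult_hopf_T1_bij : bijective T1;
  mult_hopf_T2_bij : bijective T2
}.

Record counit (eps : Q -> k) : Prop := {
  counit_linear : linear (eps : Q -> k^o);
  counitM : forall x y, eps (x ** y) = eps x * eps y;
  counit_l : forall x y,
    tlift (fun u v => eps u *: v) (T1 (x \ox y)) = x ** y;
  counit_r : forall x y,
    tlift (fun u v => eps v *: u) (T2 (x \ox y)) = x ** y
}.

(* m(S (x) id)(D(x)(1 (x) y)) = eps(x)y and m(id (x) S)((x (x) 1)D(y)) = eps(y)x. *)
Record antipode (S : Q -> multiplier Q) : Prop := {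
  antipode_linear : linear S;
  antipodeM : forall x y, S (x ** y) = S y *m* S x;
  antipodeE : exists2 eps, counit eps & forall x y,
    tlift (fun u v => mulL (S u) v) (T1 (x \ox y)) = eps x *: y
    /\ tlift (fun u v => mulR (S v) u) (T2 (x \ox y)) = eps y *: x
}.
End MultiplierHopf.

Definition regular_mult_hopf (k : fieldType) (Q : nalg k)
    (D : Q -> multiplier (ntens Q Q)) : Prop :=
  mult_hopf D
  /\ mult_hopf (fun x => mpush (@tswap k Q Q : ntens Q Q -> ntens Q Q) (D x)).

(* The comultiplication of a tensor product of two multiplier Hopf algebras. *)
Definition ntens_comult (k : fieldType) (P Q : nalg k)
    (DP : P -> multiplier (ntens P P)) (DQ : Q -> multiplier (ntens Q Q)) :
    ntens P Q -> multiplier (ntens (ntens P Q) (ntens P Q)) :=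
  tlift (fun x y =>
    mpush (@tmid k P P Q Q : ntens (ntens P P) (ntens Q Q) ->
                             ntens (ntens P Q) (ntens P Q))
      (mtens (DP x) (DQ y))).

Definition nopp_comult (k : fieldType) (Q : nalg k)
    (D : Q -> multiplier (ntens Q Q)) :
    nopp Q -> multiplier (ntens (nopp Q) (nopp Q)) :=
  fun x => mop (D x).

Definition unital_action (k : fieldType) (Q : nalg k) (A : lmodType k)
    (act : Q -> A -> A) : Prop :=
  forall a, exists s : seq (Q * A), a = \sum_(p <- s) act p.1 p.2.

(* In the last field of the next two records the argument y covers the Sweedler
   sum: x |> (a(y |> b)) = sum (x_1 |> a)(x_2 y |> b), and symmetrically. *)
Record left_module_algebra (k : fieldType) (Q : nalg k)
    (D : Q -> multiplier (ntens Q Q)) (A : nalg k) (lact : Q -> A -> A) : Prop := {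
  lact_bilin : bilin lact;
  lactM : forall x y a, lact (x ** y) a = lact x (lact y a);
  lact_unital : unital_action lact;
  lact_mul : forall x y a b,
    lact x (a ** lact y b)
      = tlift (fun u v => lact u a ** lact v b) (T1 D (x \ox y))
}.

Record right_module_algebra (k : fieldType) (Q : nalg k)
    (D : Q -> multiplier (ntens Q Q)) (A : nalg k) (ract : A -> Q -> A) : Prop := {
  ract_bilin : bilin ract;
  ractM : forall x y a, ract a (x ** y) = ract (ract a x) y;
  ract_unital : unital_action (fun x a => ract a x);
  ract_mul : forall x y a b,
    ract (ract a y ** b) x
      = tlift (fun u v => ract a u ** ract b v) (T2 D (y \ox x))
}.

Record bimodule_algebra (k : fieldType) (Q : nalg k)
    (D : Q -> multiplier (ntens Q Q)) (A : nalg k)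
    (lact : Q -> A -> A) (ract : A -> Q -> A) : Prop := {
  bimodule_left : left_module_algebra D lact;
  bimodule_right : right_module_algebra D ract;
  bimodule_compat : forall x y a, ract (lact x a) y = lact x (ract a y)
}.

Section Coactions.
Variables (k : fieldType) (Q A : nalg k).
Variable D : Q -> multiplier (ntens Q Q).
Variable G : A -> multiplier (ntens Q A).
Variable U : A -> multiplier (ntens A Q).

(* G(a)(x (x) 1), U(a)(1 (x) x) and (1 (x) x)U(a) as elements of the tensor
   products. *)
Definition lcoact_cov (a : A) (x : Q) : tensor Q A :=
  elem (G a *m* mtens (memb x) mone).
Definition rcoact_cov (a : A) (x : Q) : tensor A Q :=
  elem (U a *m* mtens mone (memb x)).
Definition rcoact_covl (x : Q) (a : A) : tensor A Q :=
  elem (mtens mone (memb x) *m* U a).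

(* (id (x) G)G(a) and (D (x) id)G(a) are the multipliers X of Q (x) Q (x) A with
   X(x (x) 1 (x) 1) = (id (x) G)(G(a)(x (x) 1)), respectively
   X(D(x) (x) 1) = (D (x) id)(G(a)(x (x) 1)), for all x.  The same convention is
   used for the other iterated coactions. *)
Record left_comodule_algebra : Prop := {
  lcoact_hom : mhom G;
  lcoact_inj : injective G;
  lcoact_in_r : forall a x, in_alg (G a *m* mtens (memb x) mone);
  lcoact_in_l : forall a x, in_alg (mtens (memb x) mone *m* G a);
  lcoact_coassoc : forall a, exists X : multiplier (ntens Q (ntens Q A)),
    forall x,
      X *m* mtens (memb x) mone
        = tlift (fun y b => mtens (memb y) (G b)) (lcoact_cov a x)
      /\
      let assoc : ntens (ntens Q Q) A -> ntens Q (ntens Q A) :=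
        @tassoc k Q Q A in
      X *m* mpush assoc (mtens (D x) mone)
        = mpush assoc
            (tlift (fun y b => mtens (D y) (memb b)) (lcoact_cov a x))
}.

Record right_comodule_algebra : Prop := {
  rcoact_hom : mhom U;
  rcoact_inj : injective U;
  rcoact_in_r : forall a x, in_alg (U a *m* mtens mone (memb x));
  rcoact_in_l : forall a x, in_alg (mtens mone (memb x) *m* U a);
  rcoact_coassoc : forall a, exists X : multiplier (ntens A (ntens Q Q)),
    forall x,
      let assoc : ntens (ntens A Q) Q -> ntens A (ntens Q Q) :=
        @tassoc k A Q Q in
      X *m* mtens mone (mtens mone (memb x))
        = mpush assoc
            (tlift (fun b y => mtens (U b) (memb y)) (rcoact_cov a x))
      /\
      X *m* mtens mone (D x)
        = tlift (fun b y => mtens (memb b) (D y)) (rcoact_cov a x)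
}.

(* X = (id (x) U)G(a) = (G (x) id)U(a) in M(Q (x) A (x) Q). *)
Definition bicoact_spec (a : A) (X : multiplier (ntens Q (ntens A Q))) : Prop :=
  forall x,
    X *m* mtens (memb x) mone
      = tlift (fun y b => mtens (memb y) (U b)) (lcoact_cov a x)
    /\
    X *m* mtens mone (mtens mone (memb x))
      = mpush (@tassoc k Q A Q : ntens (ntens Q A) Q -> ntens Q (ntens A Q))
          (tlift (fun b y => mtens (G b) (memb y)) (rcoact_cov a x)).

Record bicomodule_algebra : Prop := {
  bicomodule_left : left_comodule_algebra;
  bicomodule_right : right_comodule_algebra;
  bicomodule_compat : forall a, exists X, bicoact_spec a X
}.

(* sum a_(-1) (x) a_0 (x) a_(1) *)
Definition bicoact (a : A) : multiplier (ntens Q (ntens A Q)) :=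
  xget 0 [set X | bicoact_spec a X]%classic.

End Coactions.

Record long_module_algebra (k : fieldType) (H : nalg k)
    (D : H -> multiplier (ntens H H)) (A : nalg k)
    (lact : H -> A -> A) (G : A -> multiplier (ntens H A)) : Prop := {
  long_hopf : mult_hopf D;
  long_module : left_module_algebra D lact;
  long_comodule : left_comodule_algebra D G;
  long_compat : forall x y a,
    G (lact x a) *m* mtens (memb y) mone
      = memb (tmap id (lact x) (lcoact_cov G a y) : ntens H A)
}.

Record four_sides_long (k : fieldType) (Q : nalg k)
    (D : Q -> multiplier (ntens Q Q)) (A : nalg k)
    (lact : Q -> A -> A) (ract : A -> Q -> A)
    (G : A -> multiplier (ntens Q A)) (U : A -> multiplier (ntens A Q)) : Prop := {
  fsl_bimodule : bimodule_algebra D lact ract;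
  fsl_bicomodule : bicomodule_algebra D G U;
  fsl_ll : forall x y a,
    G (lact x a) *m* mtens (memb y) mone
      = memb (tmap id (lact x) (lcoact_cov G a y) : ntens Q A);
  fsl_lr : forall x y a,
    U (lact x a) *m* mtens mone (memb y)
      = memb (tmap (lact x) id (rcoact_cov U a y) : ntens A Q);
  fsl_rr : forall x y a,
    U (ract a x) *m* mtens mone (memb y)
      = memb (tmap (ract^~ x) id (rcoact_cov U a y) : ntens A Q);
  fsl_rl : forall x y a,
    G (ract a x) *m* mtens (memb y) mone
      = memb (tmap id (ract^~ x) (lcoact_cov G a y) : ntens Q A)
}.

(* Some e with e |> v = v.  It exists for a unital module over an algebra with
   local units.  Below, Sweedler sums in which an element of Q acts on v are
   covered by inserting such an e between that element and v; their values do
   not depend on the choice of e. *)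
Definition cover (k : fieldType) (Q : nalg k) (V : Type)
    (act : Q -> V -> V) (v : V) : Q :=
  xget 0 [set e | act e v = v]%classic.

(* sum a_0 (a_(-1) e |> b), where e |> b = b *)
Definition left_twisted_product (k : fieldType) (H A : nalg k)
    (lact : H -> A -> A) (G : A -> multiplier (ntens H A)) (a b : A) : A :=
  tlift (fun x a0 => a0 ** lact x b) (lcoact_cov G a (cover lact b)).

Section CoverIndependence.
Variables (k : fieldType) (H A : nalg k) (D : H -> multiplier (ntens H H)).
Variables (lact : H -> A -> A) (G : A -> multiplier (ntens H A)).
Hypothesis lactP : left_module_algebra D lact.
Hypothesis GP : left_comodule_algebra D G.

Lemma coverP (a : A) : lact (cover lact a) a = a.
Proof.
have [s sE] := lact_unital lactP a.
have [e he] := nalg_local_units [seq p.1 | p <- s].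
have ea : lact e a = a.
  rewrite sE (linP_sum ((lact_bilin lactP).1 e)) !big_seq.
  apply: eq_bigr => p ps; rewrite -(lactM lactP).
  by have [-> _] := he _ (map_f _ ps).
by rewrite /cover; case: xgetP => // /(_ e).
Qed.

Lemma twisted_bilin (c : A) : bilin (fun x a0 => a0 ** lact x c).
Proof.
split=> [x|a0] r z z' /=; first exact: (nmul_bilin A).2.
by rewrite ((lact_bilin lactP).2 c) (nmul_bilin A).1.
Qed.

Lemma twisted_cover (a c c' : A) (y y' : H) : lact y c = lact y' c' ->
  tlift (fun x a0 => a0 ** lact x c) (lcoact_cov G a y)
    = tlift (fun x a0 => a0 ** lact x c') (lcoact_cov G a y').
Proof.
move=> yc.
pose t := lcoact_cov G a y; pose t' := lcoact_cov G a y'.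
have [p hp] := nalg_local_units ([seq r.1 | r <- (repr t : seq (H * A))]
                                 ++ [seq r.1 | r <- (repr t' : seq (H * A))]).
have idl : linear (id : A -> A) by [].
have Ll (x : H) : linear (nmul x) := (nmul_bilin H).1 x.
have Rl (x : H) : linear (fun z => z ** x) := (nmul_bilin H).2 x.
have pfix (s : tensor H A) :
    (forall r, r \in (repr s : seq (H * A)) -> p ** r.1 = r.1) ->
    tmap (nmul p) id s = s.
  move=> hs; rewrite [s]tensorE (linP_sum (tmap_linear (Ll p) idl)) -tensorE.
  rewrite [RHS]tensorE !big_seq; apply: eq_bigr => r rs.
  by rewrite tmap_tpure // hs.
have pt : tmap (nmul p) id t = t.
  by apply: pfix => r rt; have [] // := hp r.1; rewrite mem_cat map_f.
have pt' : tmap (nmul p) id t' = t'.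
  by apply: pfix => r rt; have [] // := hp r.1; rewrite mem_cat orbC map_f.
pose u : tensor H A := elem (mtens (memb p) mone *m* G a).
have uE : memb (u : ntens H A) = mtens (memb p) mone *m* G a.
  exact: elemK (lcoact_in_l GP a p).
have move_cov (z : H) : tmap (nmul p) id (lcoact_cov G a z) = lcoact_cov G a z ->
    lcoact_cov G a z = tmap (fun x => x ** z) id u.
  move=> pz.
  have zE : memb (lcoact_cov G a z : ntens H A) = G a *m* mtens (memb z) mone.
    exact: elemK (lcoact_in_r GP a z).
  apply: (@memb_inj _ (ntens H A)); rewrite -[in LHS]pz.
  rewrite -[tmap _ _ _]/(mulL (mtens (memb p) mone) _) memb_mulL
    -[tmap _ _ u]/(mulR (mtens (memb z) mone) _) memb_mulR.
  by rewrite zE uE; apply: multiplier_ext.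
rewrite -/t -/t' /t /t' (move_cov y) // (move_cov y') //.
rewrite !tlift_tmap //; try exact: twisted_bilin; try exact: Rl.
by congr (tlift _ u); apply/funext => x; apply/funext => a0;
  rewrite !(lactM lactP) yc.
Qed.

(* a . (h |> b) = sum a_0 (a_(-1) h |> b) for every h *)
Lemma left_twisted_productE (a b : A) (h : H) :
  left_twisted_product lact G a (lact h b)
    = tlift (fun x a0 => a0 ** lact x b) (lcoact_cov G a h).
Proof. exact: (twisted_cover _ (coverP _)). Qed.
End CoverIndependence.

Section QxQop.
Variables (k : fieldType) (Q A : nalg k).
Variables (lact : Q -> A -> A) (ract : A -> Q -> A) (Sinv : Q -> Q).
Variables (G : A -> multiplier (ntens Q A)) (U : A -> multiplier (ntens A Q)).

Definition bimod_act (h : ntens Q (nopp Q)) (a : A) : A :=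
  tlift (fun x y : Q => ract (lact x a) y) h.

(* a |-> sum (a_(-1) (x) S^-1(a_(1))) (x) a_0 *)
Definition bicomod_coact (a : A) : multiplier (ntens (ntens Q (nopp Q)) A) :=
  mpush
    (tlift (fun x r => tlift (fun a0 y => (x \ox Sinv y) \ox a0) r)
       : ntens Q (ntens A Q) -> ntens (ntens Q (nopp Q)) A)
    (bicoact G U a).
End QxQop.

Section Products.
Variables (k : fieldType) (Q : nalg k) (S Sinv : Q -> Q).

Section OneAlgebra.
Variables (A : nalg k) (lact : Q -> A -> A) (ract : A -> Q -> A).
Variables (G : A -> multiplier (ntens Q A)) (U : A -> multiplier (ntens A Q)).
Let rcover (a : A) : Q := cover (fun x a => ract a x) a.

(* sum a_0 (a_(-1) e |> b <| S^-1(a_(1) S(f))), where e |> b = b = b <| f *)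
Definition bullet (a b : A) : A :=
  tlift (fun x r => tlift (fun a0 y => a0 ** ract (lact x b) (Sinv y)) r)
    (elem (bicoact G U a
           *m* mtens (memb (cover lact b)) (mtens mone (memb (S (rcover b)))))).

(* sum (a_0 <| f b_(1))(a_(-1) e |> b_0), where e |> b = b and a <| f = a; here
   the Long conditions give sum a_(-1) (x) (a_0 <| f) = G(a) and
   sum (e |> b_0) (x) b_(1) = U(b). *)
Definition circledast (a b : A) : A :=
  tlift (fun x a0 => tlift (fun b0 y => ract a0 y ** lact x b0)
                       (rcoact_covl U (rcover a) b))
    (lcoact_cov G a (cover lact b)).

(* sum a_0 <| f a_(1) and sum a_0 <| S^-1(a_(1) S(f)), where a <| f = a; again
   sum (a_0 <| f) (x) a_(1) = U(a). *)
Definition alpha (a : A) : A :=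
  tlift ract (rcoact_covl U (rcover a) a).
Definition alpha_inv (a : A) : A :=
  tlift (fun a0 y => ract a0 (Sinv y)) (rcoact_cov U a (S (rcover a))).
End OneAlgebra.

Section TwoAlgebras.
Variables (A : nalg k) (lact : Q -> A -> A) (ract : A -> Q -> A).
Variable B : nalg k.
Variables (G : B -> multiplier (ntens Q B)) (U : B -> multiplier (ntens B Q)).

Let lcoverBA (t : tensor B A) : Q := cover (fun x => tmap id (lact x)) t.
Let rcoverBA (t : tensor B A) : Q := cover (fun x => tmap id (ract^~ x)) t.
Let lcoverAB (t : tensor A B) : Q := cover (fun x => tmap (lact x) id) t.
Let rcoverAB (t : tensor A B) : Q := cover (fun x => tmap (ract^~ x) id) t.

(* (b' * a')(b * a) = sum b'b_0 * (S^-1(S(e) b_(-1)) |> a' <| f b_(1))a *)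
Definition star_r (s t : tensor B A) : tensor B A :=
  let e := lcoverBA s in let f := rcoverBA s in
  tlift (fun b' a' => tlift (fun b a =>
    tlift (fun x r => tlift (fun b0 y =>
        (b' ** b0) \ox (ract (lact (Sinv x) a') y ** a)) r)
      (elem (mtens (memb (S e)) (mtens mone (memb f)) *m* bicoact G U b))) t) s.

(* (a * b)(a' * b') = sum a(b_(-1) e |> a' <| S^-1(b_(1) S(f))) * b_0b' *)
Definition star_l (s t : tensor A B) : tensor A B :=
  let e := lcoverAB t in let f := rcoverAB t in
  tlift (fun a b => tlift (fun a' b' =>
    tlift (fun x r => tlift (fun b0 y =>
        (a ** ract (lact x a') (Sinv y)) \ox (b0 ** b')) r)
      (elem (bicoact G U b *m* mtens (memb e) (mtens mone (memb (S f)))))) t) s.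

(* (b' <> a')(b <> a) = sum b'_0b_0 <> (a' <| f b_(1))(b'_(-1) e |> a) *)
Definition diamond_r (s t : tensor B A) : tensor B A :=
  let e := lcoverBA t in let f := rcoverBA s in
  tlift (fun b' a' => tlift (fun b a =>
    tlift (fun x b'0 => tlift (fun b0 y =>
        (b'0 ** b0) \ox (ract a' y ** lact x a))
      (rcoact_covl U f b)) (lcoact_cov G b' e)) t) s.

(* (a <> b)(a' <> b') = sum (a <| f b'_(1))(b_(-1) e |> a') <> b_0b'_0 *)
Definition diamond_l (s t : tensor A B) : tensor A B :=
  let e := lcoverAB t in let f := rcoverAB s in
  tlift (fun a b => tlift (fun a' b' =>
    tlift (fun x b0 => tlift (fun b'0 y =>
        (ract a y ** lact x a') \ox (b0 ** b'0))
      (rcoact_covl U f b')) (lcoact_cov G b e)) t) s.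
End TwoAlgebras.
End Products.

Definition assoc_product (k : fieldType) (V : lmodType k) (m : V -> V -> V) : Prop :=
  bilin m /\ associative m.

Record alg_iso (k : fieldType) (V W : lmodType k) (mV : V -> V -> V)
    (mW : W -> W -> W) (f : V -> W) (g : W -> V) : Prop := {
  alg_iso_dom : assoc_product mV;
  alg_iso_cod : assoc_product mW;
  alg_iso_linear : linear f;
  alg_isoM : {morph f : a b / mV a b >-> mW a b};
  alg_isoK : cancel f g;
  alg_isoVK : cancel g f
}.

Definition alg_isomorphic (k : fieldType) (V W : lmodType k)
    (mV : V -> V -> V) (mW : W -> W -> W) : Prop :=
  exists f g, alg_iso mV mW f g.

(* Main.v *)
Require Import Defs.
From HB Require Import structures.
From mathcomp Require Import all_boot ssralg.
From mathcomp Require Import boolp classical_sets.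

(** Every identity of the statement is one between elements of tensor products in
    which the legs that lie in Q have been covered.  It becomes transparent in
    terms of operators.  A left coaction of Q on A and a left action of Q on V
    give the operator
<<
      L : A (x) V -> A (x) V,   a (x) v |-> sum a_0 (x) a_(-1) |> v,
>>
    see [coact_on]; a cover of a_(-1) is any e with e |> v = v, and it does not
    matter which.  The right action and the right coaction of Q are a left action
    and a left coaction of the opposite of Q, so they give an operator R by the
    same construction.  Multiplicativity of the coaction describes L on (ab) (x) v
    ([half_Lmul]); coassociativity and the module algebra axiom describe it on
    a (x) bb' ([half_Ltmul]).  The Long conditions, and the compatibility of the
    two actions and of the two coactions, say that L and R commute whichever
    argument they share (section [Rules]).  Finally the antipode makes R
    invertible, the inverse Ri being built from sum S^-1(a_(1)) (x) a_0
    ([cov_invK], [covK_inv]).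

    With these rules the products are words in the operators.  On three arguments
    both bracketings of the circled product are the triple product preceded by
    the same six operators, which commute; hence its associativity
    ([circ_assoc]).  The twisted product is Ri after L, followed by the product.
    The map alpha contracts R, and alpha(ab) is expressed by R
    ([contract_mul]); in the image of a twisted product this R cancels Ri, which
    leaves the circled product ([rho_twisted]).  As alpha is invertible, by the
    contraction of Ri, it is an isomorphism and carries associativity back.  On
    A (x) A the map a (x) b |-> sum a <| b_(1) (x) b_0, which is R up to a flip,
    turns the left star into the left diamond for the same reason ([lstar_R]).
    The pair on the right is the pair on the left for the opposite algebra, with
    the two sides of Q exchanged ([rdiam_rstar_iso]).

    The first claim needs the multiplier Hopf algebra Q (x) Q^op, whose
    comultiplication is assembled from the four coverings D(x)(1 (x) y),
    (x (x) 1)D(y), D(x)(y (x) 1), (1 (x) x)D(y); the last two lie in Q (x) Q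
    because Q is regular.  The coaction on A is the composite of two commuting
    coactions ([tcov]).  The second one, a |-> sum S^-1(a_(1)) (x) a_0, is
    coassociative because it inverts R: inverting the relation that expresses
    coassociativity reverses the order of its factors ([coassoc_inv]).

    The coactions enter these arguments only through the elements
    c a x = Gamma(a)(x (x) 1) and cl x a = (x (x) 1)Gamma(a) of Q (x) A, and the few
    relations between them that the record [covered] lists. *)

Set Implicit Arguments.
Unset Strict Implicit.
Unset Printing Implicit Defensive.

Import GRing.Theory.
Local Open Scope ring_scope.

(** * Sums over a tensor *)

Notation "\tsum_ ( x , y <- t ) E" := (tlift (fun x y => E) t)
  (at level 41, E at level 41, x name, y name, t at level 60,
   format "'[' \tsum_ ( x ,  y  <-  t ) '/  '  E ']'").

Section Linearity.
Variable k : fieldType.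
Implicit Types U V W X : lmodType k.

Lemma lin_id U : linear (fun x : U => x). Proof. by []. Qed.
Lemma lin_idfun U : linear (@id U). Proof. by []. Qed.

Lemma lin_comp U V W (f : V -> W) (g : U -> V) :
  linear f -> linear g -> linear (fun x => f (g x)).
Proof. by move=> fl gl c x y; rewrite gl fl. Qed.

Lemma bilin_r U V W (f : U -> V -> W) u : bilin f -> linear (f u).
Proof. by case. Qed.

Lemma bilin_l U V W (f : U -> V -> W) v : bilin f -> linear (fun u => f u v).
Proof. by case=> _ h; exact: h. Qed.

Lemma lin_tsum U V W X (f : X -> U -> V -> W) t :
  (forall u v, linear (fun x => f x u v)) -> linear (fun x => tlift (f x) t).
Proof.
move=> fl c x y; rewrite /tlift /sum_of scaler_sumr -big_split /=.
by apply: eq_bigr => p _; exact: fl.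
Qed.

Lemma lin_scalel U V (f : U -> k^o) (v : V) :
  linear f -> linear (fun u => f u *: v).
Proof. by move=> fl c x y; rewrite fl scalerDl scalerA. Qed.

Lemma lin_scaler U V (c : k) (g : U -> V) : linear g -> linear (fun u => c *: g u).
Proof. by move=> gl a x y; rewrite gl scalerDr !scalerA mulrC. Qed.

Lemma lin_scale V (c : k) : linear ( *:%R c : V -> V).
Proof. by apply: lin_scaler; exact: lin_id. Qed.

Lemma tlift_lin U V W (f : U -> V -> W) : bilin f -> linear (tlift f).
Proof. exact: tlift_linear. Qed.
End Linearity.

Create HintDb lin discriminated.
#[global] Hint Resolve lin_id lin_idfun lin_scale bilin_r tlift_lin : lin.
#[global] Hint Resolve tpure_bilin nmul_bilin mulL_linear mulR_linear : lin.

(** [lin] proves goals [linear f], [bilin f] and [trilin f] by following the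
    bound variable through the expression: across sums over a tensor, and into the
    last, else the last but one, argument of an application.  Linearity of the
    operations that occur is looked up among the hypotheses and the hints. *)
Ltac lin_first :=
  lazymatch goal with
  | |- GRing.linear_for _ (fun x => ?h x ?v) => apply: (@bilin_l _ _ _ _ h v)
  | |- GRing.linear_for _ (fun x => ?h (@?g x) ?v) =>
      apply: (@lin_comp _ _ _ _ (fun z => h z v) g); cbv beta
  end.
Ltac lin_last :=
  lazymatch goal with
  | |- GRing.linear_for _ (fun x => ?h x) => change_no_check (linear h)
  | |- GRing.linear_for _ (fun x => ?h (@?g x)) =>
      apply: (@lin_comp _ _ _ _ h g); cbv beta
  end.
Ltac lin_step :=
  lazymatch goal with
  | |- bilin _ => first [solve [eauto 3 with lin nocore] | split; intro; cbv beta]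
  | |- GRing.linear_for _ (fun x => x) => exact: lin_id
  | |- GRing.linear_for _ (fun x => @tlift _ _ _ _ (@?f x) (@?t x)) =>
      lazymatch t with
      | (fun _ => ?t0) =>
          apply: (@lin_tsum _ _ _ _ _ f t0); intros ? ?; cbv beta
      | _ => lin_last
      end
  | |- GRing.linear_for _ (fun x => @GRing.scale _ _ (@?f x) (@?g x)) =>
      lazymatch g with
      | (fun _ => ?v) => apply: (@lin_scalel _ _ _ f v); cbv beta
      | _ => apply: lin_scaler; cbv beta
      end
  | |- GRing.linear_for _ (fun x => _ (@?g x)) =>
      lazymatch g with
      | (fun x => x) => lin_last
      | (fun _ => ?v) => lin_first
      | _ => lin_last
      end
  | |- GRing.linear_for _ ?h =>
      first [solve [eauto 4 with lin nocore] | apply: tmap_linear | apply: tlift_linear]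
  end.

(** The commutation rules below are stated for an arbitrary trilinear summand, so
    that they apply to two adjacent sums inside a longer nest. *)
Definition trilin (k : fieldType) (U V W X : lmodType k) (F : U -> V -> W -> X) :=
  (forall u, bilin (F u)) /\ (forall v w, linear (fun u => F u v w)).

Lemma trilin_bilin (k : fieldType) (U V W X : lmodType k)
  (F : U -> V -> W -> X) u : trilin F -> bilin (F u).
Proof. by case. Qed.

Lemma trilin_1 (k : fieldType) (U V W X : lmodType k)
  (F : U -> V -> W -> X) v w : trilin F -> linear (fun u => F u v w).
Proof. by case. Qed.
#[global] Hint Resolve trilin_bilin trilin_1 : lin.

Ltac lin :=
  repeat first
    [ assumption
    | lazymatch goal with |- trilin _ => split; intros; cbv beta end
    | lin_step
    | solve [auto 2 with lin nocore] ].

Section TensorCalculus.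
Variable k : fieldType.
Implicit Types U V W X Y : lmodType k.

Lemma eq_tsum U V W (f g : U -> V -> W) t :
  (forall u v, f u v = g u v) -> tlift f t = tlift g t.
Proof. by move=> fg; apply: eq_bigr => p _; exact: fg. Qed.

Lemma lin_tsumE U V W X (F : W -> X) (f : U -> V -> W) t :
  linear F -> F (tlift f t) = \tsum_(u, v <- t) F (f u v).
Proof. by move=> Fl; rewrite (linP_sum Fl). Qed.

Lemma tsum_pure U V W (f : U -> V -> W) u v : bilin f -> tlift f (u \ox v) = f u v.
Proof. exact: tlift_tpure. Qed.

Lemma tsum_bind U V U' V' W (f : U -> V -> W) (g : U' -> V' -> tensor U V) t :
  bilin f -> tlift f (tlift g t) = \tsum_(u, v <- t) tlift f (g u v).
Proof. by move=> fb; apply: lin_tsumE; exact: tlift_linear. Qed.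

Lemma tsum_swap U V U' V' W (f : U -> V -> U' -> V' -> W) t t' :
  \tsum_(u, v <- t) \tsum_(u', v' <- t') f u v u' v'
    = \tsum_(u', v' <- t') \tsum_(u, v <- t) f u v u' v'.
Proof. exact: exchange_big. Qed.

Lemma tsum_eta U V (t : tensor U V) : \tsum_(u, v <- t) u \ox v = t.
Proof. by rewrite [RHS]tensorE. Qed.

Lemma tsum_map U V U' V' W (f : U' -> V' -> W) (g : U -> U') (h : V -> V') t :
  bilin f -> linear g -> linear h ->
  tlift f (tmap g h t) = \tsum_(u, v <- t) f (g u) (h v).
Proof. exact: tlift_tmap. Qed.

Lemma tmapE U V U' V' (g : U -> U') (h : V -> V') t :
  tmap g h t = \tsum_(u, v <- t) (g u \ox h v).
Proof. by []. Qed.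

Lemma tsum_swapE U V W (f : V -> U -> W) (t : tensor U V) :
  bilin f -> tlift f (tswap t) = \tsum_(u, v <- t) f v u.
Proof.
move=> fb; rewrite /tswap tsum_bind //; apply: eq_tsum => u v.
exact: tsum_pure.
Qed.

Lemma tswap_linear U V : linear (@tswap k U V).
Proof. by rewrite /tswap; lin. Qed.

Lemma tswapK U V : cancel (@tswap k U V) (@tswap k V U).
Proof.
move=> t; rewrite {1}/tswap tsum_swapE; last by lin.
exact: tsum_eta.
Qed.

Lemma eq_lin U V W (F G : tensor U V -> W) t : linear F -> linear G ->
  (forall u v, F (u \ox v) = G (u \ox v)) -> F t = G t.
Proof. by move=> Fl Gl h; exact: (tlift_unique Fl Gl h). Qed.

(** The tensors are quantified in the conclusion so that the two bilinear maps are
    found by unification. *)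
Lemma eq_bilin U V X Y W (F G : tensor U V -> tensor X Y -> W) : bilin F -> bilin G ->
  (forall u v x y, F (u \ox v) (x \ox y) = G (u \ox v) (x \ox y)) ->
  forall s t, F s t = G s t.
Proof.
move=> [F1 F2] [G1 G2] h s; apply: tlift_unique => // x y.
by move: s; apply: tlift_unique.
Qed.

Lemma tmap_comp U V U' V' U2 V2 (g : U -> U') (h : V -> V') (g' : U' -> U2)
    (h' : V' -> V2) t : linear g -> linear h -> linear g' -> linear h' ->
  tmap g' h' (tmap g h t) = tmap (fun u => g' (g u)) (fun v => h' (h v)) t.
Proof. by move=> gl hl gl' hl'; rewrite {1}/tmap tsum_map //; lin. Qed.

Lemma tmap_tsum U V U' V' U2 V2 (f : U -> V -> tensor U' V') (g : U' -> U2)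
    (h : V' -> V2) t : linear g -> linear h ->
  tmap g h (tlift f t) = \tsum_(u, v <- t) tmap g h (f u v).
Proof. by move=> gl hl; apply: lin_tsumE; exact: tmap_linear. Qed.

Lemma tmap_id U V (t : tensor U V) : tmap id id t = t.
Proof. exact: tsum_eta. Qed.

Lemma eq_tmap U V U' V' (g g' : U -> U') (h h' : V -> V') t :
  g =1 g' -> h =1 h' -> tmap g h t = tmap g' h' t.
Proof. by move=> eg eh; apply: eq_tsum => u v; rewrite eg eh. Qed.
End TensorCalculus.
#[global] Hint Resolve tswap_linear : lin.

(** * Local units *)

(** Local units apart from any algebra, so that they pass from products and unital
    actions to the legs of a tensor product. *)
Definition lunital (k : fieldType) (H : Type) (V : lmodType k)
    (op : H -> V -> V) : Prop :=
  (forall e, linear (op e))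
  /\ forall s : seq V, exists e, forall v, v \in s -> op e v = v.

Section LocalUnits.
Variable k : fieldType.
Implicit Types U V W : lmodType k.

Lemma lunital_cancel (H : Type) V (op : H -> V -> V) v w :
  lunital op -> (forall z, op z v = op z w) -> v = w.
Proof.
case=> _ /(_ [:: v; w]) [e he] eq_op; rewrite -(he v) ?eq_op ?he //.
  by rewrite !inE eqxx orbT.
by rewrite !inE eqxx.
Qed.

Lemma lunital_tmap1 (H : Type) U V (op : H -> V -> V) :
  lunital op -> lunital (fun e => tmap (op e) (@id U)).
Proof.
case=> opl opu; split=> [e|s]; first by apply: tmap_linear.
have [e he] := opu (flatten [seq [seq p.1 | p <- (repr t : seq (V * U))] | t <- s]).
exists e => t ts; rewrite [t]tensorE (linP_sum (tmap_linear _ _)) // !big_seq.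
apply: eq_bigr => p pt.
rewrite tmap_tpure // he //; apply/flattenP.
exists [seq p.1 | p <- (repr t : seq (V * U))]; last exact: map_f.
by apply/mapP; exists t.
Qed.

Lemma lunital_tmap2 (H : Type) U V (op : H -> V -> V) :
  lunital op -> lunital (fun e => tmap (@id U) (op e)).
Proof.
case=> opl opu; split=> [e|s]; first by apply: tmap_linear.
have [e he] := opu (flatten [seq [seq p.2 | p <- (repr t : seq (U * V))] | t <- s]).
exists e => t ts; rewrite [t]tensorE (linP_sum (tmap_linear _ _)) // !big_seq.
apply: eq_bigr => p pt.
rewrite tmap_tpure // he //; apply/flattenP.
exists [seq p.2 | p <- (repr t : seq (U * V))]; last exact: map_f.
by apply/mapP; exists t.
Qed.

Lemma lunital_nmul (H : nalg k) : lunital (@nmul k H).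
Proof.
split=> [e|s]; first exact: (nmul_bilin H).1.
by have [e he] := nalg_local_units s; exists e => v /he [].
Qed.

Lemma lunital_nmulr (H : nalg k) : lunital (fun e x : H => x ** e).
Proof.
split=> [e|s]; first exact: (nmul_bilin H).2.
by have [e he] := nalg_local_units s; exists e => v /he [].
Qed.

Lemma lunital2 (op : Type) V (f : op -> V -> V) v w :
  lunital f -> exists e, f e v = v /\ f e w = w.
Proof.
case=> _ /(_ [:: v; w]) [e he]; exists e.
by split; apply: he; rewrite !inE eqxx ?orbT.
Qed.
End LocalUnits.

(** * Multipliers *)

Section Multipliers.
Variable k : fieldType.

Section One.
Variable A : nalg k.
Implicit Types (m n : multiplier A) (a b : A).

(** By non-degeneracy the left half of a multiplier determines the right half. *)
Lemma mulR_ext m n : mulL m =1 mulL n -> mulR m =1 mulR n.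
Proof.
move=> h a; apply/eqP; rewrite -subr_eq0; apply/eqP; apply: nmul_nondegl => b.
by rewrite -scaleN1r addrC (nmul_bilin A).2 !mulRL h scaleN1r addNr.
Qed.

Lemma multiplier_extL m n : mulL m =1 mulL n -> m = n.
Proof. by move=> h; apply: multiplier_ext => //; exact: mulR_ext. Qed.

Lemma memb_mul a b : memb (a ** b) = memb a *m* memb b.
Proof. exact: memb_mulL (memb a) b. Qed.

Lemma mmulA m n p : m *m* (n *m* p) = m *m* n *m* p.
Proof. exact: multiplier_ext. Qed.

Lemma mmul1m m : mone *m* m = m.
Proof. exact: multiplier_ext. Qed.

Lemma mmulm1 m : m *m* mone = m.
Proof. exact: multiplier_ext. Qed.

Lemma memb_linear : linear (@memb k A).
Proof.
move=> c a b; apply: multiplier_extL => x /=.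
by rewrite addr0 scale1r (nmul_bilin A).2.
Qed.

Lemma mulL_lin a : linear (fun m => mulL m a).
Proof. by move=> c m n /=; rewrite addr0 scale1r. Qed.

Lemma mulL_comb c m n a : mulL (c *: m + n) a = c *: mulL m a + mulL n a.
Proof. exact: (mulL_lin a c m n). Qed.

Lemma mulL_bilin : bilin (@mulL k A).
Proof. by split=> [m|a]; [exact: mulL_linear | exact: mulL_lin]. Qed.

Lemma mmul_bilin : bilin (@mmul k A).
Proof.
split=> [m|n] c p q; apply: multiplier_extL => x /=;
  by rewrite !addr0 !scale1r // (@mulL_linear _ _ m).
Qed.

Lemma elemE m a : memb a = m -> elem m = a.
Proof. by move=> <-; exact: membK. Qed.
End One.

Section Two.
Variables A B : nalg k.
Implicit Types (m : multiplier A) (n : multiplier B).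

Lemma mtens_pure m n a b : mulL (mtens m n) (a \ox b) = mulL m a \ox mulL n b.
Proof. by rewrite /= tmap_tpure //; exact: mulL_linear. Qed.

Lemma mulL_tlin (m : multiplier (ntens A B)) :
  linear (mulL m : tensor A B -> tensor A B).
Proof. exact (@mulL_linear k (ntens A B) m). Qed.

Lemma eq_multiplier2 (m m' : multiplier (ntens A B)) :
  (forall a b, mulL m (a \ox b) = mulL m' (a \ox b)) -> m = m'.
Proof.
move=> h; apply: multiplier_extL => t;
  exact (@eq_lin k A B (tensor A B) _ _ t (mulL_tlin m) (mulL_tlin m') h).
Qed.

Lemma mtens_memb (a : A) (b : B) : mtens (memb a) (memb b) = memb (a \ox b : ntens A B).
Proof.
apply: eq_multiplier2 => x y; rewrite mtens_pure /=.
by rewrite ntens_mul_tpure.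
Qed.

Lemma mtens_mul m m' n n' : mtens m n *m* mtens m' n' = mtens (m *m* m') (n *m* n').
Proof. by apply: eq_multiplier2 => x y; rewrite mtens_pure /= !tmap_tpure //; lin. Qed.

Lemma mtens_bilin : bilin (@mtens k A B).
Proof.
have tb := tpure_bilin A B.
split=> [m|n] c p q; apply: eq_multiplier2 => x y;
  rewrite mulL_comb !mtens_pure mulL_comb;
  by [exact: tb.1 | exact: tb.2].
Qed.

Lemma mtens1 : mtens (@mone k A) (@mone k B) = mone.
Proof. by apply: eq_multiplier2 => x y; rewrite mtens_pure. Qed.
End Two.

Section Push.
Variables (A B : nalg k) (theta : A -> B).
Hypotheses (thl : linear theta) (thM : {morph theta : a b / a ** b}).
Hypothesis thb : bijective theta.

Lemma mpushE m t : mulL (mpush theta m) (theta t) = theta (mulL m t).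
Proof. by have [] := mpushP m thl thM thb t. Qed.

Lemma mpush_ext (m : multiplier B) n :
  (forall t, mulL m (theta t) = theta (mulL n t)) -> m = mpush theta n.
Proof.
move=> h; apply: multiplier_extL => t; case: thb => eta _ ek.
by rewrite -(ek t) h mpushE.
Qed.

Lemma mpush_linear : linear (mpush theta).
Proof.
move=> c m n; apply/esym/mpush_ext => t.
transitivity (c *: mulL (mpush theta m) (theta t) + mulL (mpush theta n) (theta t));
  first exact: mulL_comb.
by rewrite mulL_comb thl !mpushE.
Qed.

Lemma mpush_mul m n : mpush theta (m *m* n) = mpush theta m *m* mpush theta n.
Proof. by apply/esym/mpush_ext => t /=; rewrite !mpushE //. Qed.

Lemma mpush_memb a : mpush theta (memb a) = memb (theta a).
Proof. by apply/esym/mpush_ext => t /=; rewrite thM. Qed.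
End Push.
End Multipliers.
#[global] Hint Resolve memb_linear mulL_bilin mmul_bilin mtens_bilin : lin.

(** * Covered coactions and their operators *)

Notation "y *| t" := (tmap (nmul y) id t) (at level 40, left associativity).
Notation "t |* y" := (tmap (fun x => x ** y) id t) (at level 40, left associativity).

(** [c a x] stands for Gamma(a)(x (x) 1) and [cl x a] for (x (x) 1)Gamma(a); the
    last condition is what remains of the fact that both come from one multiplier. *)
Record covered (k : fieldType) (H : nalg k) (A : lmodType k)
    (c : A -> H -> tensor H A) (cl : H -> A -> tensor H A) : Prop := {
  cov_bilin : bilin c;
  covl_bilin : bilin cl;
  covM : forall a x y, c a (x ** y) = c a x |* y;
  covlM : forall a x y, cl (x ** y) a = x *| cl y a;
  cov_link : forall a x y, y *| c a x = cl y a |* x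
}.

Record module (k : fieldType) (H : nalg k) (V : lmodType k) (act : H -> V -> V) :
    Prop := {
  act_bilin : bilin act;
  actM : forall x y v, act (x ** y) v = act x (act y v);
  act_unital : unital_action act
}.
#[global] Hint Resolve cov_bilin covl_bilin act_bilin : lin.

Section OneSided.
Variables (k : fieldType) (H : nalg k) (V : lmodType k).
Implicit Types (x y : H) (t : tensor H V).

Lemma lm_lin y : linear (fun t => y *| t). Proof. by apply: tmap_linear; lin. Qed.
Lemma rm_lin y : linear (fun t => t |* y). Proof. by apply: tmap_linear; lin. Qed.

Lemma lm_pure y x (v : V) : y *| (x \ox v) = (y ** x) \ox v.
Proof. by rewrite tmap_tpure; lin. Qed.

Lemma rm_pure y x (v : V) : (x \ox v) |* y = (x ** y) \ox v.
Proof. by rewrite tmap_tpure; lin. Qed.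

Lemma lm_cancel t t' : (forall z, z *| t = z *| t') -> t = t'.
Proof. exact: (lunital_cancel (lunital_tmap1 V (lunital_nmul H))). Qed.

Lemma rm_cancel t t' : (forall z, t |* z = t' |* z) -> t = t'.
Proof. exact: (lunital_cancel (lunital_tmap1 V (lunital_nmulr H))). Qed.
End OneSided.

Lemma lunital_cover (k : fieldType) (H : nalg k) (V : lmodType k) (op : H -> V -> V) v :
  lunital op -> op (Defs.cover op v) v = v.
Proof.
move=> opu; have [e [he _]] := lunital2 v v opu.
by rewrite /Defs.cover; case: xgetP => // /(_ e).
Qed.

Section ModuleUnits.
Variables (k : fieldType) (H : nalg k) (V : lmodType k) (act : H -> V -> V).
Hypothesis actP : module act.

(** Unitality gives each vector as a sum of terms x |> w, and a local unit of the
    elements x fixes it; finitely many vectors are handled by writing all of them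
    as e |> w for a single e. *)
Lemma module_lunital : lunital act.
Proof.
have ab := act_bilin actP.
split=> [e|s]; first by lin.
have [e he] : exists e, forall v, v \in s -> exists w, v = act e w; last first.
  suff [p hp] : exists p, p ** e = e.
    by exists p => v /he [w ->]; rewrite -(actM actP) hp.
  have [p hp] := nalg_local_units [:: e].
  by exists p; have [] := hp e (mem_head _ _).
elim: s => [|v s [e he]]; first by have [e _] := nalg_local_units (Nil H); exists e.
have [r rE] := act_unital actP v.
have [p hp] := nalg_local_units (e :: [seq q.1 | q <- r]).
have pv : act p v = v.
  rewrite rE (linP_sum (ab.1 p)) !big_seq.
  apply: eq_bigr => q qr; rewrite -(actM actP).
  by have [|-> _] := hp q.1 => //; rewrite inE map_f ?orbT.
exists p => w; rewrite inE => /orP[/eqP -> |/he [w' ->]]; first by exists v.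
exists (act e w'); rewrite -(actM actP).
by have [|-> _] := hp e => //; rewrite mem_head.
Qed.

Lemma cover_act v : act (Defs.cover act v) v = v.
Proof. exact: lunital_cover module_lunital. Qed.
End ModuleUnits.

Section Coacting.
Variables (k : fieldType) (H : nalg k).
Implicit Types A V : lmodType k.

(** a (x) v |-> sum a_0 (x) a_(-1) e |> v, where e |> v = v *)
Definition coact_on A V (act : H -> V -> V) (c : A -> H -> tensor H A) (a : A) (v : V) :
    tensor A V :=
  \tsum_(x, a0 <- c a (Defs.cover act v)) (a0 \ox act x v).

Section Basics.
Variables (A V : lmodType k) (act : H -> V -> V).
Variables (c : A -> H -> tensor H A) (cl : H -> A -> tensor H A).
Hypotheses (actP : module act) (cP : covered c cl).
Notation L := (coact_on act c).

(** A common left unit p of both sides is moved across the coaction, where it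
    becomes the only cover, while y and y' are left to act on v and v'. *)
Lemma coact_on_cover a y y' v v' : act y v = act y' v' ->
  \tsum_(x, a0 <- c a y) (a0 \ox act x v)
    = \tsum_(x, a0 <- c a y') (a0 \ox act x v').
Proof.
move=> yv.
have [p [py py']] := lunital2 (c a y) (c a y') (lunital_tmap1 A (lunital_nmul H)).
rewrite -py -py' !(cov_link cP) !tsum_map; lin.
by apply: eq_tsum => x a0; rewrite !(actM actP) yv.
Qed.

Lemma coact_onE a y v :
  L a (act y v) = \tsum_(x, a0 <- c a y) (a0 \ox act x v).
Proof. by apply: coact_on_cover; rewrite (cover_act actP). Qed.

Lemma coact_on_unit a e v : act e v = v ->
  L a v = \tsum_(x, a0 <- c a e) (a0 \ox act x v).
Proof. by move=> {1}<-; exact: coact_onE. Qed.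

Lemma coact_on_bilin : bilin L.
Proof.
split=> [a r v w|v]; last by rewrite /coact_on; lin.
have [e [ev ew]] := lunital2 v w (module_lunital actP).
rewrite (coact_on_unit a ev) (coact_on_unit a ew) (@coact_on_unit a e).
  have h : linear (fun v => \tsum_(x, a0 <- c a e) (a0 \ox act x v)) by lin.
  exact: h.
by rewrite (act_bilin actP).1 ev ew.
Qed.
End Basics.
End Coacting.

Section CoactOnLaws.
Variables (k : fieldType) (H : nalg k).
Implicit Types A B V W : lmodType k.

Lemma coact_on_source A B V (act : H -> V -> V) (c : A -> H -> tensor H A)
    (c' : B -> H -> tensor H B) (g : A -> B) a v :
  bilin act -> linear g -> (forall a x, c' (g a) x = tmap id g (c a x)) ->
  coact_on act c' (g a) v = tmap g id (coact_on act c a v).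
Proof.
move=> ab gl gc; rewrite /coact_on gc tmap_tsum; lin.
rewrite tsum_map; lin.
by apply: eq_tsum => x a0; rewrite tmap_tpure.
Qed.

Lemma coact_on_target A V W (act : H -> V -> V) (act' : H -> W -> W)
    (c : A -> H -> tensor H A) (cl : H -> A -> tensor H A) (h : V -> W) a v :
  covered c cl -> module act -> module act' -> linear h ->
  (forall x v, h (act x v) = act' x (h v)) ->
  coact_on act' c a (h v) = tmap id h (coact_on act c a v).
Proof.
move=> cP aP aP' hl hact.
rewrite -{1}(cover_act aP v) hact (coact_onE aP' cP) /coact_on tmap_tsum; lin.
by apply: eq_tsum => x a0; rewrite tmap_tpure // hact.
Qed.

Lemma coact_on_mul A V (act : H -> V -> V) (c : A -> H -> tensor H A)
    (cl : H -> A -> tensor H A) (m : A -> A -> A) :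
  covered c cl -> module act -> bilin m ->
  (forall a b x, c (m a b) x
     = \tsum_(y, b0 <- c b x) \tsum_(z, a0 <- c a y) (z \ox m a0 b0)) ->
  forall a b v, coact_on act c (m a b) v
    = \tsum_(b0, w <- coact_on act c b v) \tsum_(a0, u <- coact_on act c a w)
        (m a0 b0 \ox u).
Proof.
move=> cP aP mb mc a b v.
have Lb := coact_on_bilin aP cP.
rewrite {1}/coact_on mc tsum_bind; lin.
rewrite {2}/coact_on tsum_bind; lin.
apply: eq_tsum => y b0; rewrite tsum_bind; lin.
rewrite tsum_pure; lin.
rewrite (coact_onE aP cP) tsum_bind; lin.
by apply: eq_tsum => z a0; rewrite !tsum_pure; lin.
Qed.

(** (id (x) c)c = (Delta (x) id)c multiplied on the right by Delta(x)(1 (x) y) (x) 1,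
    which is [T x y] on the first two legs. *)
Definition coassocr A (T : H -> H -> tensor H H) (c : A -> H -> tensor H A) :=
  forall a x y,
    \tsum_(u, v <- T x y) \tsum_(z, b <- c a u) (z \ox c b v)
      = \tsum_(z, b <- c a x) \tsum_(u, v <- T z y) (u \ox (v \ox b)).

(** The same identity multiplied on the left by (1 (x) y)Delta(x) (x) 1, which is
    [T y x] on the first two legs. *)
Definition coassocl A (T : H -> H -> tensor H H) (cl : H -> A -> tensor H A) :=
  forall a x y,
    \tsum_(u, v <- T y x) \tsum_(z, b <- cl u a) (z \ox cl v b)
      = \tsum_(z, b <- cl x a) \tsum_(u, v <- T y z) (u \ox (v \ox b)).

Definition tsurj (T : H -> H -> tensor H H) :=
  forall t, exists s : tensor H H, t = \tsum_(x, y <- s) T x y.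

(** As [T] is onto and the module is unital, it is enough to compare both sides on
    sum (u |> b) (x) (v |> b') with [T x y] = sum u (x) v.  There the module
    algebra axiom makes x act on a product and coassociativity applies. *)
Lemma coact_on_tmul A V (act : H -> V -> V) (T : H -> H -> tensor H H)
    (c : A -> H -> tensor H A) (cl : H -> A -> tensor H A) (m : V -> V -> V) :
  covered c cl -> module act -> bilin m -> bilin T -> tsurj T -> coassocr T c ->
  (forall x y b b', act x (m b (act y b'))
     = \tsum_(u, v <- T x y) m (act u b) (act v b')) ->
  forall a b b', coact_on act c a (m b b')
    = \tsum_(a0, b1 <- coact_on act c a b)
        \tsum_(a00, b'1 <- coact_on act c a0 b') (a00 \ox m b1 b'1).
Proof.
move=> cP aP mb Tb Ts cc mT a b b'.
have Lb := coact_on_bilin aP cP.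
pose F b b' := \tsum_(a0, b1 <- coact_on act c a b)
        \tsum_(a00, b'1 <- coact_on act c a0 b') (a00 \ox m b1 b'1).
have Fb : bilin F by rewrite /F; lin.
have FT x y p q : \tsum_(u, v <- T x y) F (act u p) (act v q)
    = coact_on act c a (\tsum_(u, v <- T x y) m (act u p) (act v q)).
  rewrite -mT (coact_onE aP cP).
  pose Phi (s : tensor H (tensor H A)) :=
    \tsum_(z, r <- s) \tsum_(w, a0 <- r) (a0 \ox m (act z p) (act w q)).
  have Phil : linear Phi by rewrite /Phi; lin.
  transitivity (Phi (\tsum_(u, v <- T x y) \tsum_(z, b <- c a u) (z \ox c b v))).
    rewrite lin_tsumE //; apply: eq_tsum => u v.
    rewrite lin_tsumE // /F (coact_onE aP cP) tsum_bind; lin.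
    apply: eq_tsum => z a0; rewrite tsum_pure; lin.
    rewrite (coact_onE aP cP) tsum_bind /Phi; lin.
    rewrite tsum_pure; lin.
    by apply: eq_tsum => w a00; rewrite tsum_pure; lin.
  rewrite cc lin_tsumE //; apply: eq_tsum => z a0.
  rewrite lin_tsumE // mT (lin_tsumE (F := tpure a0)); last by lin.
  by apply: eq_tsum => u v; rewrite /Phi !tsum_pure; lin.
have [u [ub _]] := lunital2 b b (module_lunital aP).
have [v [vb _]] := lunital2 b' b' (module_lunital aP).
have [s sE] := Ts (u \ox v).
have tot W (G : V -> V -> W) : bilin G ->
    G b b' = \tsum_(x, y <- s) \tsum_(u, v <- T x y) G (act u b) (act v b').
  move=> Gb; rewrite -tsum_bind -?sE; lin.
  by rewrite tsum_pure ?ub ?vb; lin.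
have Ll : linear (coact_on act c a) by lin.
rewrite -/(F b b') (tot _ F) // (tot _ m) // (lin_tsumE _ _ Ll).
by apply: eq_tsum => x y; rewrite FT.
Qed.

(** Both coactions in one formula: (id (x) d)c = (c (x) id)d up to a flip, covered
    by x and y. *)
Definition cocommute K A (c : A -> H -> tensor H A) (d : A -> nalg_sort K -> tensor K A) :=
  forall a x y,
    \tsum_(u, b <- c a x) (u \ox d b y) = \tsum_(v, b <- d a y) \tsum_(u, b' <- c b x)
      (u \ox (v \ox b')).
End CoactOnLaws.

Section NaturalCoactions.
Variables (k : fieldType) (H : nalg k) (A B : lmodType k).
Variables (c : A -> H -> tensor H A) (cl : H -> A -> tensor H A).
Variables (c' : B -> H -> tensor H B) (cl' : H -> B -> tensor H B).
Hypotheses (cP : covered c cl) (cP' : covered c' cl').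
Variable g : A -> B.
Hypothesis gl : linear g.
Hypothesis gc : forall a x, c' (g a) x = tmap id g (c a x).

(** A map that respects one covering respects the other, by cancellation. *)
Lemma covl_nat a x : cl' x (g a) = tmap id g (cl x a).
Proof.
apply: rm_cancel => z; rewrite -(cov_link cP') gc.
have comm t : x *| tmap id g t = tmap id g (x *| t) by rewrite !tmap_comp; lin.
have comm' t : tmap id g t |* z = tmap id g (t |* z) by rewrite !tmap_comp; lin.
by rewrite comm comm' (cov_link cP).
Qed.
End NaturalCoactions.

(** * Commuting operators *)

(** Two operators can share the argument that coacts, the argument that is acted
    upon, or an argument that coacts for one and is acted upon for the other.  In
    the first case they commute because the coactions do; the other two cases are
    instances of [coact_on_equivariant]. *)
Section Commutation.
Variables (k : fieldType) (H K : nalg k).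
Implicit Types A B V W X P U : lmodType k.

Lemma coact_on_comm_source A V W X (actH : H -> V -> V) (actK : K -> W -> W)
    (c : A -> H -> tensor H A) (cl : H -> A -> tensor H A)
    (d : A -> K -> tensor K A) (dl : K -> A -> tensor K A)
    (F : A -> V -> W -> X) a v w :
  covered c cl -> covered d dl -> module actH -> module actK ->
  cocommute c d -> trilin F ->
  \tsum_(a0, v1 <- coact_on actH c a v) \tsum_(a1, w1 <- coact_on actK d a0 w) F a1 v1 w1
  = \tsum_(a0, w1 <- coact_on actK d a w) \tsum_(a1, v1 <- coact_on actH c a0 v)
       F a1 v1 w1.
Proof.
move=> cP dP HP KP cd Ft.
have Lb := coact_on_bilin HP cP; have Rb := coact_on_bilin KP dP.
have [e [ev _]] := lunital2 v v (module_lunital HP).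
have [f [fw _]] := lunital2 w w (module_lunital KP).
rewrite (coact_on_unit HP cP a ev) (coact_on_unit KP dP a fw).
rewrite !tsum_bind; lin.
pose Phi (s : tensor H (tensor K A)) :=
  \tsum_(x, r <- s) \tsum_(y, a0 <- r) F a0 (actH x v) (actK y w).
have Phil : linear Phi by rewrite /Phi; lin.
transitivity (Phi (\tsum_(u, b <- c a e) (u \ox d b f))).
  rewrite lin_tsumE //; apply: eq_tsum => x a0.
  rewrite /Phi !tsum_pure; lin.
  rewrite (coact_on_unit KP dP a0 fw) tsum_bind; lin.
  by apply: eq_tsum => y a1; rewrite tsum_pure; lin.
rewrite cd lin_tsumE //; apply: eq_tsum => y a0.
rewrite lin_tsumE // tsum_pure; lin.
rewrite (coact_on_unit HP cP a0 ev) tsum_bind; lin.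
by apply: eq_tsum => x a1; rewrite /Phi !tsum_pure; lin.
Qed.

Lemma coact_on_equivariant B U V P X (act : K -> U -> U) (act' : K -> V -> V)
    (d : B -> K -> tensor K B) (dl : K -> B -> tensor K B)
    (N : U -> tensor P V) (F : P -> V -> B -> X) b u :
  covered d dl -> module act -> module act' -> linear N ->
  (forall y u, N (act y u) = tmap id (act' y) (N u)) -> trilin F ->
  \tsum_(b0, u1 <- coact_on act d b u) \tsum_(p, v <- N u1) F p v b0
  = \tsum_(p, v <- N u) \tsum_(b0, v1 <- coact_on act' d b v) F p v1 b0.
Proof.
move=> dP KP KP' Nl NE Ft.
have Rb' := coact_on_bilin KP' dP.
have Kb' := act_bilin KP'.
have [f [fu _]] := lunital2 u u (module_lunital KP).
rewrite -fu NE (coact_onE KP dP) tsum_bind ?tsum_map; lin.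
transitivity (\tsum_(y, b0 <- d b f) \tsum_(p, v <- N u) F p (act' y v) b0).
  by apply: eq_tsum => y b0; rewrite tsum_pure ?NE ?tsum_map; lin.
rewrite tsum_swap; apply: eq_tsum => p v.
rewrite (coact_onE KP' dP) tsum_bind; lin.
by apply: eq_tsum => y b0; rewrite tsum_pure; lin.
Qed.
End Commutation.

(** * The contraction of a coaction *)

Section Contraction.
Variables (k : fieldType) (H : nalg k) (A : lmodType k) (act : H -> A -> A).
Variables (c : A -> H -> tensor H A) (cl : H -> A -> tensor H A).
Hypotheses (actP : module act) (cP : covered c cl).
Hypothesis long : forall y a x, c (act y a) x = tmap id (act y) (c a x).
Let ab := act_bilin actP.

(** sum a_(-1) e |> a_0, where e |> a = a; over the opposite of Q this is alpha *)
Definition contract (a : A) : A := \tsum_(x, a0 <- c a (Defs.cover act a)) act x a0.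

Lemma contract_cover a y y' : act y a = act y' a ->
  \tsum_(x, a0 <- c a y) act x a0 = \tsum_(x, a0 <- c a y') act x a0.
Proof.
move=> yy'.
have [p [py py']] := lunital2 (c a y) (c a y') (lunital_tmap1 A (lunital_nmul H)).
have aux z : p *| c a z = c a z ->
    \tsum_(x, a0 <- c a z) act x a0 = \tsum_(x, a0 <- cl p (act z a)) act x a0.
  move=> pz; rewrite -pz (cov_link cP) (covl_nat cP cP (bilin_r z ab) (long z)) !tsum_map; lin.
  by apply: eq_tsum => x a0; rewrite (actM actP).
by rewrite !aux // yy'.
Qed.

(** The Long condition lets the cover y act on a_0 instead. *)
Lemma contractE a y : \tsum_(x, a0 <- c a y) act x a0 = contract (act y a).
Proof.
have [p hp] := nalg_local_units [:: y]; have [py _] := hp y (mem_head _ _).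
have pu : act p (act y a) = act y a by rewrite -(actM actP) py.
rewrite /contract; set g := Defs.cover _ _.
have gu : act g (act y a) = act y a := cover_act actP _.
rewrite long tsum_map; lin.
transitivity (\tsum_(x, a0 <- c a (g ** y)) act x a0).
  by apply: contract_cover; rewrite (actM actP).
rewrite (covM cP) tsum_map; lin.
by apply: eq_tsum => x a0; rewrite (actM actP).
Qed.

Lemma contract_linear : linear contract.
Proof.
move=> r a b.
have [e [ea eb]] := lunital2 a b (module_lunital actP).
rewrite -{1}ea -{1}eb -(ab.1 e) -contractE.
have h : linear (fun a => \tsum_(x, a0 <- c a e) act x a0) by lin.
by rewrite h !contractE ea eb.
Qed.

Lemma contract_nat g a : linear g ->
  (forall x a, g (act x a) = act x (g a)) ->
  (forall a x, c (g a) x = tmap id g (c a x)) -> contract (g a) = g (contract a).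
Proof.
move=> gl gact gc; have [e [ea _]] := lunital2 a a (module_lunital actP).
rewrite -ea gact -!contractE gc tsum_map ?(lin_tsumE _ _ gl); lin.
by apply: eq_tsum => x a0; rewrite gact.
Qed.

(** As for [coact_on_tmul], a (x) b is replaced by sum (u |> a) (x) (v |> b) with
    [T x y] = sum u (x) v.  Multiplicativity of the coaction separates a_(-1) from
    b_(-1), coassociativity splits each in two, and the module algebra axiom
    distributes the halves. *)
Lemma contract_mul (T : H -> H -> tensor H H) (m : A -> A -> A) :
  bilin m -> bilin T -> tsurj T -> coassocr T c ->
  (forall a b x, c (m a b) x
     = \tsum_(y, b0 <- c b x) \tsum_(z, a0 <- c a y) (z \ox m a0 b0)) ->
  (forall x y b b', act x (m b (act y b'))
     = \tsum_(u, v <- T x y) m (act u b) (act v b')) ->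
  forall a b, contract (m a b)
    = \tsum_(b0, a1 <- coact_on act c b a)
        \tsum_(a2, b1 <- coact_on act c (contract a1) (contract b0)) m a2 b1.
Proof.
move=> mb Tb Ts cc cm mT a b.
have Lb := coact_on_bilin actP cP; have rl := contract_linear.
pose R a b := \tsum_(b0, a1 <- coact_on act c b a)
        \tsum_(a2, b1 <- coact_on act c (contract a1) (contract b0)) m a2 b1.
have Rb : bilin R by rewrite /R; lin.
have RT x y p q : \tsum_(u, v <- T x y) R (act u p) (act v q)
    = contract (\tsum_(u, v <- T x y) m (act u p) (act v q)).
  rewrite -mT -contractE cm.
  (* the summand of the right-hand side, as a function of two more legs *)
  pose G u v b0 := \tsum_(z, a0 <- c p u) \tsum_(z', a00 <- c a0 v)
     m (act z a00) (act z' b0).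
  have Gt : trilin G by rewrite /G; lin.
  pose Psi (s : tensor H (tensor H A)) := \tsum_(u, r <- s) \tsum_(v, b0 <- r) G u v b0.
  have Psil : linear Psi by rewrite /Psi; lin.
  transitivity (Psi (\tsum_(u, v <- T x y) \tsum_(z, b <- c q u) (z \ox c b v))).
    rewrite lin_tsumE //; apply: eq_tsum => u v.
    rewrite lin_tsumE // /R (coact_onE actP cP) long tsum_bind ?tsum_map; lin.
    apply: eq_tsum => z b0; rewrite tsum_pure; lin.
    rewrite /Psi tsum_pure; lin.
    pose N p q := \tsum_(a2, b1 <- coact_on act c p q) m a2 b1.
    have Nb : bilin N by rewrite /N; lin.
    have Nl r : linear (fun p => N p r) by lin.
    rewrite -/(N _ _) -!contractE (lin_tsumE _ _ (Nl _)) /G tsum_swap.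
    apply: eq_tsum => w a0; rewrite (lin_tsumE (F := N _)); lin.
    apply: eq_tsum => v' b00; rewrite /N (coact_onE actP cP) long tsum_bind ?tsum_map; lin.
    by apply: eq_tsum => z' a00; rewrite tsum_pure; lin.
  rewrite cc lin_tsumE // long tsum_bind ?tsum_map; lin.
  apply: eq_tsum => y' b0; rewrite tsum_bind; lin.
  rewrite lin_tsumE //; symmetry.
  transitivity (\tsum_(z, a0 <- c p y') \tsum_(u, v <- T z y)
     m (act u a0) (act v b0)).
    by apply: eq_tsum => z a0; rewrite tsum_pure ?mT; lin.
  pose Th (s : tensor H (tensor H A)) :=
    \tsum_(u, r <- s) \tsum_(v, a0 <- r) m (act u a0) (act v b0).
  have Thl : linear Th by rewrite /Th; lin.
  transitivity (Th (\tsum_(u, v <- T y' y) \tsum_(z, b <- c p u) (z \ox c b v))).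
    rewrite cc lin_tsumE //; apply: eq_tsum => z a0; rewrite lin_tsumE //.
    by apply: eq_tsum => u v; rewrite /Th !tsum_pure; lin.
  rewrite lin_tsumE //; apply: eq_tsum => u v; rewrite /Psi !tsum_pure; lin.
  rewrite lin_tsumE //; apply: eq_tsum => z a0.
  by rewrite /Th tsum_pure; lin.
have [u [ua _]] := lunital2 a a (module_lunital actP).
have [v [vb _]] := lunital2 b b (module_lunital actP).
have [s sE] := Ts (u \ox v).
have tot (G : A -> A -> A) : bilin G ->
    G a b = \tsum_(x, y <- s) \tsum_(u, v <- T x y) G (act u a) (act v b).
  move=> Gb; rewrite -tsum_bind -?sE; lin.
  by rewrite tsum_pure ?ua ?vb; lin.
rewrite -/(R a b) (tot _ Rb) (tot _ mb) (lin_tsumE _ _ rl).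
by apply: eq_tsum => x y; rewrite RT.
Qed.
End Contraction.

(** * The inverse of a coaction *)

Section Inverse.
Variables (k : fieldType) (H : nalg k) (S Sinv : H -> H).
Variables (A : lmodType k) (c : A -> H -> tensor H A) (cl : H -> A -> tensor H A).

(** sum S^-1(a_(-1)) e (x) a_0, in which the cover e = S^-1(S(e)) is absorbed by
    a_(-1) from the left. *)
Definition cov_inv (a : A) (e : H) : tensor H A := tmap Sinv id (cl (S e) a).
Definition covl_inv (e : H) (a : A) : tensor H A := tmap Sinv id (c a (S e)).

Hypothesis cP : covered c cl.
Hypotheses (Sl : linear S) (Sinvl : linear Sinv).
Hypotheses (SM : forall x y, S (x ** y) = S y ** S x).
Hypotheses (SK : cancel S Sinv) (SinvK : cancel Sinv S).

Lemma SinvM x y : Sinv (x ** y) = Sinv y ** Sinv x.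
Proof. by apply: (can_inj SK); rewrite SM !SinvK. Qed.

Lemma covered_inv : covered cov_inv covl_inv.
Proof.
split.
- by rewrite /cov_inv; lin.
- by rewrite /covl_inv; lin.
- move=> a x y; rewrite /cov_inv SM (covlM cP) !tmap_comp; lin.
  by apply: eq_tsum => u v; rewrite SinvM SK.
- move=> a x y; rewrite /covl_inv SM (covM cP) !tmap_comp; lin.
  by apply: eq_tsum => u v; rewrite SinvM SK.
move=> a x y; rewrite /cov_inv /covl_inv.
have e1 t : y *| tmap Sinv id t = tmap Sinv id (t |* S y).
  by rewrite !tmap_comp; lin; apply: eq_tsum => u v; rewrite SinvM SK.
have e2 t : tmap Sinv id t |* x = tmap Sinv id (S x *| t).
  by rewrite !tmap_comp; lin; apply: eq_tsum => u v; rewrite SinvM SK.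
by rewrite e1 e2 (cov_link cP).
Qed.

Variables (T1 T4 : H -> H -> tensor H H) (eps : H -> k).
Hypotheses (T1b : bilin T1) (T4b : bilin T4) (epsl : linear (eps : H -> k^o)).
Hypotheses (T1s : tsurj T1) (T4s : tsurj (fun x y => T4 y x)).
Hypotheses (cr : coassocr T1 c) (ccl : coassocl T4 cl).
Hypothesis epsc : forall a x, \tsum_(y, b <- c a x) (eps y *: b) = eps x *: a.
Hypothesis epscl : forall a x, \tsum_(y, b <- cl x a) (eps y *: b) = eps x *: a.
Hypothesis S1 : forall x y, \tsum_(u, v <- T1 x y) (S u ** v) = eps x *: y.
Hypothesis S4 : forall x y, \tsum_(u, v <- T4 y x) (v ** Sinv u) = eps x *: y.

(** With a further cover h on the first leg, S(e) (x) h is a sum of elements on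
    which coassociativity applies; it puts a_(-2) and a_(-1) side by side, and the
    antipode axiom removes them. *)
Lemma cov_invK a e : \tsum_(x, b <- cov_inv a e) c b x = e \ox a.
Proof.
have c'P := covered_inv.
apply: lm_cancel => h; rewrite tmap_tsum; lin.
rewrite tmap_tpure; lin.
pose Phi (s : tensor H (tensor H A)) :=
  \tsum_(u, r <- s) \tsum_(v, b <- r) ((v ** Sinv u) \ox b).
have Phil : linear Phi by rewrite /Phi; lin.
have [s sE] := T4s (S e \ox h).
transitivity (Phi (\tsum_(x, y <- s) \tsum_(u, v <- T4 y x) \tsum_(z, b <- cl u a)
   (z \ox cl v b))).
  rewrite -tsum_bind -?sE; lin.
  rewrite tsum_pure ?lin_tsumE // /cov_inv ?tsum_map; lin.
  apply: eq_tsum => z b; rewrite tsum_pure ?(cov_link cP) /Phi ?tsum_pure; lin.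
  by [].
rewrite lin_tsumE //.
transitivity ((\tsum_(x, y <- s) \tsum_(u, v <- T4 y x) (v ** Sinv u)) \ox a).
  rewrite (lin_tsumE (F := fun r => r \ox a)); lin.
  apply: eq_tsum => x y; rewrite ccl S4 lin_tsumE //.
  transitivity (y \ox (eps x *: a)); last first.
    by rewrite (linPZ (bilin_r y (tpure_bilin H A))) (linPZ (bilin_l a (tpure_bilin H A))).
  rewrite -epscl (lin_tsumE (F := tpure y)); lin.
  apply: eq_tsum => z b; rewrite lin_tsumE //.
  transitivity ((\tsum_(u, v <- T4 y z) (v ** Sinv u)) \ox b).
    rewrite (lin_tsumE (F := fun r => r \ox b)); lin.
    by apply: eq_tsum => u v; rewrite /Phi !tsum_pure; lin.
  by rewrite S4 (linPZ (bilin_r y (tpure_bilin H A))) (linPZ (bilin_l b (tpure_bilin H A))).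
by rewrite -tsum_bind -?sE; lin; rewrite tsum_pure ?SK; lin.
Qed.

Lemma covK_inv a e : \tsum_(x, b <- c a e) cov_inv b x = e \ox a.
Proof.
have c'P := covered_inv.
have c'b := cov_bilin c'P; have cl'b := covl_bilin c'P.
apply: lm_cancel => h; rewrite tmap_tsum; lin.
rewrite tmap_tpure; lin.
pose Phi (s : tensor H (tensor H A)) :=
  \tsum_(u, r <- s) \tsum_(v, b <- r) ((Sinv v ** u) \ox b).
have Phil : linear Phi by rewrite /Phi; lin.
have [s sE] := T1s (e \ox S h).
transitivity (Phi (\tsum_(x, y <- s) \tsum_(u, v <- T1 x y) \tsum_(z, b <- c a u)
   (z \ox c b v))).
  rewrite -tsum_bind -?sE; lin.
  rewrite tsum_pure ?lin_tsumE //; lin.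
  apply: eq_tsum => z b; rewrite (cov_link c'P) /Phi tsum_pure; lin.
  by rewrite /covl_inv tmap_comp ?tmapE; lin.
rewrite lin_tsumE //.
transitivity ((\tsum_(x, y <- s) \tsum_(u, v <- T1 x y) (Sinv v ** u)) \ox a).
  have S1' x y : \tsum_(u, v <- T1 x y) (Sinv v ** u) = eps x *: Sinv y.
    rewrite -(linPZ Sinvl) -S1 lin_tsumE //; apply: eq_tsum => u v.
    by rewrite SinvM SK.
  rewrite (lin_tsumE (F := fun r => r \ox a)); lin.
  apply: eq_tsum => x y; rewrite cr S1' lin_tsumE //.
  transitivity (Sinv y \ox (eps x *: a)); last first.
    by rewrite (linPZ (bilin_r _ (tpure_bilin H A))) (linPZ (bilin_l a (tpure_bilin H A))).
  rewrite -epsc (lin_tsumE (F := tpure (Sinv y))); lin.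
  apply: eq_tsum => z b; rewrite lin_tsumE //.
  transitivity ((\tsum_(u, v <- T1 z y) (Sinv v ** u)) \ox b).
    rewrite (lin_tsumE (F := fun r => r \ox b)); lin.
    by apply: eq_tsum => u v; rewrite /Phi !tsum_pure; lin.
  by rewrite S1' (linPZ (bilin_r _ (tpure_bilin H A))) (linPZ (bilin_l b (tpure_bilin H A))).
by rewrite -tsum_bind -?sE; lin; rewrite tsum_pure ?SK; lin.
Qed.
End Inverse.

Section InverseLaws.
Variables (k : fieldType) (H : nalg k) (A : lmodType k).
Variables (c d : A -> H -> tensor H A) (cl dl : H -> A -> tensor H A).
Hypotheses (cP : covered c cl) (dP : covered d dl).
Hypothesis dc : forall a e, \tsum_(x, b <- d a e) c b x = e \ox a.

Lemma coact_on_inv (V X : lmodType k) (act : H -> V -> V) (F : A -> V -> X) a v :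
  module act -> bilin F ->
  \tsum_(a0, v1 <- coact_on act d a v) \tsum_(a1, v2 <- coact_on act c a0 v1) F a1 v2
    = F a v.
Proof.
move=> aP Fb; have [e [ev _]] := lunital2 v v (module_lunital aP).
have Lb := coact_on_bilin aP cP.
rewrite (coact_on_unit aP dP a ev) tsum_bind; lin.
pose Phi (s : tensor H A) := \tsum_(x, b <- s) F b (act x v).
have Phil : linear Phi by rewrite /Phi; lin.
transitivity (Phi (\tsum_(x, b <- d a e) c b x)).
  rewrite lin_tsumE //; apply: eq_tsum => x b; rewrite tsum_pure; lin.
  rewrite (coact_onE aP cP) tsum_bind; lin.
  by apply: eq_tsum => y b0; rewrite tsum_pure; lin.
by rewrite dc /Phi tsum_pure ?ev; lin.
Qed.

Lemma contract_inv (act : H -> A -> A) a :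
  module act ->
  (forall y a x, c (act y a) x = tmap id (act y) (c a x)) ->
  (forall y a x, d (act y a) x = tmap id (act y) (d a x)) ->
  contract act c (contract act d a) = a.
Proof.
move=> aP lc ld; have [e [ea _]] := lunital2 a a (module_lunital aP).
have rl := contract_linear aP cP lc.
rewrite -{1}ea -(contractE aP dP ld) (lin_tsumE _ _ rl).
transitivity (\tsum_(x, b <- \tsum_(x, b <- d a e) c b x) act x b).
  rewrite tsum_bind; lin; apply: eq_tsum => x b.
  by rewrite (contractE aP cP lc).
by rewrite dc tsum_pure; lin.
Qed.

(** Let C be the map x (x) a |-> c a x, D its inverse x (x) a |-> d a x, and T the
    map x (x) y |-> T x y.  Coassociativity of c is C_23 C_13 T_12 = T_12 C_13,
    hence D_13 D_23 T_12 = T_12 D_13, which is coassociativity of d for the flipped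
    comultiplication. *)
Lemma coassoc_inv (T : H -> H -> tensor H H) :
  (forall a e, \tsum_(x, b <- c a e) d b x = e \ox a) ->
  bilin T -> coassocr T c -> coassocr (fun x y => tswap (T x y)) d.
Proof.
move=> cd Tb cT a x y.
pose P u v a := \tsum_(w, b <- d a v) \tsum_(z, b' <- d b u) (w \ox (z \ox b')).
have Pt : trilin P by rewrite /P; lin.
pose Phi (s : tensor H (tensor H A)) := \tsum_(u, r <- s) \tsum_(v, b <- r) P u v b.
have Phil : linear Phi by rewrite /Phi; lin.
have PhiK u v b : Phi (\tsum_(z, b1 <- c b u) (z \ox c b1 v)) = v \ox (u \ox b).
  rewrite (lin_tsumE _ _ Phil).
  transitivity (\tsum_(z, b1 <- \tsum_(z, b1 <- c b u) d b1 z) (v \ox (z \ox b1))).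
    rewrite tsum_bind; last by lin.
    apply: eq_tsum => z b1; rewrite /Phi tsum_pure; last by lin.
    transitivity (\tsum_(w, b3 <- \tsum_(w, b2 <- c b1 v) d b2 w)
       \tsum_(z', b' <- d b3 z) (w \ox (z' \ox b'))); first by rewrite tsum_bind; lin.
    by rewrite cd tsum_pure; lin.
  by rewrite cd tsum_pure; lin.
transitivity (\tsum_(z, b <- \tsum_(z, b <- d a x) c b z) \tsum_(u, v <- T z y) P u v b).
  rewrite dc tsum_pure; last by lin.
  rewrite tsum_swapE; last by lin.
  apply: eq_tsum => u v; apply: eq_tsum => z b.
  by rewrite -[d b u in LHS]tsum_eta (lin_tsumE (F := tpure z)); lin.
rewrite tsum_bind; last by lin.
apply: eq_tsum => z b; rewrite tsum_swapE; last by lin.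
transitivity (Phi (\tsum_(z', b' <- c b z) \tsum_(u, v <- T z' y) (u \ox (v \ox b')))).
  rewrite (lin_tsumE _ _ Phil); apply: eq_tsum => z' b'; rewrite (lin_tsumE _ _ Phil).
  by apply: eq_tsum => u v; rewrite /Phi !tsum_pure; lin.
by rewrite -cT (lin_tsumE _ _ Phil); apply: eq_tsum => u v; rewrite PhiK.
Qed.
End InverseLaws.

(** * Change of covering and counit *)

Section CoassocSides.
Variables (k : fieldType) (H : nalg k) (A : lmodType k).
Variables (c : A -> H -> tensor H A) (cl : H -> A -> tensor H A).
Variables (T1 T4 : H -> H -> tensor H H).
Hypotheses (cP : covered c cl) (T1b : bilin T1) (T4b : bilin T4).
Hypothesis T1s : tsurj T1.
Hypothesis T41 : forall x y z w,
  \tsum_(p, q <- T4 y x) \tsum_(u, v <- T1 z w) ((p ** u) \ox (q ** v))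
    = tmap id (nmul y) (T1 (x ** z) w).

(** After multiplication on the right by Delta(z)(1 (x) w) the other form applies, and
    both sides become sum (1 (x) y)Delta(x a_(-1) z)(1 (x) w) (x) a_0.  The elements
    Delta(z)(1 (x) w) span, so they can be cancelled. *)
Lemma coassoc_rl : coassocr T1 c -> coassocl T4 cl.
Proof.
move=> cr a x y.
pose op r s (E : tensor H (tensor H A)) :=
  tmap (fun z => z ** r) (fun t : tensor H A => t |* s) E.
have opl r s : linear (op r s) by apply: tmap_linear; lin; apply: rm_lin.
have opt E : bilin (fun r s => op r s E) by rewrite /op /tmap; lin.
have opp r s z t : op r s (z \ox t) = (z ** r) \ox (t |* s).
  by rewrite /op tmap_tpure; lin.
set E1 := LHS; set E2 := RHS.
suff eqT z w : \tsum_(r, s <- T1 z w) op r s E1 = \tsum_(r, s <- T1 z w) op r s E2.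
  have eqop r s : op r s E1 = op r s E2.
    have [t tE] := T1s (r \ox s).
    have aux E : op r s E = \tsum_(z, w <- t) \tsum_(r, s <- T1 z w) op r s E.
      by rewrite -tsum_bind // -tE tsum_pure.
    by rewrite !aux; apply: eq_tsum => z w.
  apply: (lunital_cancel (lunital_tmap1 _ (lunital_nmulr H))) => r.
  apply: (lunital_cancel (lunital_tmap2 _ (lunital_tmap1 _ (lunital_nmulr H)))) => s.
  by rewrite !tmap_comp; lin; exact: eqop.
transitivity (\tsum_(z', b <- cl x a) \tsum_(r, s <- T1 (z' ** z) w)
   (r \ox ((y ** s) \ox b))).
  transitivity (\tsum_(z', b <- c a z) \tsum_(r, s <- T1 (x ** z') w)
   (r \ox ((y ** s) \ox b))); last first.
    have h : \tsum_(z', b <- x *| c a z) \tsum_(r, s <- T1 z' w)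
        (r \ox ((y ** s) \ox b))
      = \tsum_(z', b <- cl x a |* z) \tsum_(r, s <- T1 z' w)
        (r \ox ((y ** s) \ox b)) by rewrite (cov_link cP).
    by move: h; rewrite !tsum_map; lin.
  pose Psi u v (E : tensor H (tensor H A)) := tmap (nmul u) (fun t : tensor H A => v *| t) E.
  have Psil u v : linear (Psi u v) by apply: tmap_linear; lin; apply: lm_lin.
  have Psip u v z' t : Psi u v (z' \ox t) = (u ** z') \ox (v *| t).
    by rewrite /Psi tmap_tpure; lin.
  transitivity (\tsum_(u, v <- T4 y x) Psi u v
      (\tsum_(r, s <- T1 z w) \tsum_(z', b <- c a r) (z' \ox c b s))).
    rewrite /E1.
    under [LHS]eq_tsum => r s do rewrite (lin_tsumE _ _ (opl r s)).
    rewrite tsum_swap; apply: eq_tsum => u v.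
    rewrite (lin_tsumE _ _ (Psil u v)); apply: eq_tsum => r s.
    rewrite (lin_tsumE _ _ (opl r s)) (lin_tsumE _ _ (Psil u v)).
    under [LHS]eq_tsum => z' b do rewrite opp -(cov_link cP).
    under [RHS]eq_tsum => z' b do rewrite Psip.
    have h : \tsum_(z', b <- u *| c a r) (z' \ox (v *| c b s))
      = \tsum_(z', b <- cl u a |* r) (z' \ox (v *| c b s)) by rewrite (cov_link cP).
    by move: h; rewrite !tsum_map; lin.
  rewrite cr.
  under [LHS]eq_tsum => u v do rewrite (lin_tsumE _ _ (Psil u v)).
  rewrite tsum_swap; apply: eq_tsum => z' b.
  pose Th (t : tensor H H) := \tsum_(r, s <- t) (r \ox (s \ox b)).
  have Thl : linear Th by rewrite /Th; lin.
  transitivity (Th (tmap id (nmul y) (T1 (x ** z') w))); last first.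
    by rewrite /Th tsum_map; lin.
  rewrite -T41 lin_tsumE //; apply: eq_tsum => u v.
  rewrite (lin_tsumE _ _ Thl) (lin_tsumE _ _ (Psil u v)); apply: eq_tsum => r s.
  by rewrite Psip /Th tsum_pure ?tmap_tpure; lin.
rewrite /E2.
under [RHS]eq_tsum => r s do rewrite (lin_tsumE _ _ (opl r s)).
rewrite tsum_swap; apply: eq_tsum => z' b.
under [RHS]eq_tsum => r s do rewrite (lin_tsumE _ _ (opl r s)).
pose Th (t : tensor H H) := \tsum_(r, s <- t) (r \ox (s \ox b)).
have Thl : linear Th by rewrite /Th; lin.
transitivity (Th (tmap id (nmul y) (T1 (z' ** z) w))).
  by rewrite /Th tsum_map; lin.
rewrite -T41 lin_tsumE // tsum_swap; apply: eq_tsum => r s.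
rewrite lin_tsumE //; apply: eq_tsum => u v.
by rewrite opp /Th tsum_pure ?tmap_tpure; lin.
Qed.
End CoassocSides.

Lemma covered_op (k : fieldType) (H : nalg k) (A : lmodType k)
    (c : A -> H -> tensor H A) (cl : H -> A -> tensor H A) :
  covered c cl ->
  @covered k (nopp H) A (fun a x => cl x a) (fun x a => c a x).
Proof.
move=> cP; have [h1 h2] := cov_bilin cP; have [h3 h4] := covl_bilin cP.
split=> [||a x y|a x y|a x y].
- by split=> [a|x]; [exact: h4 | exact: h3].
- by split=> [x|a]; [exact: h2 | exact: h1].
- exact: (covlM cP).
- exact: (covM cP).
exact/esym/(cov_link cP).
Qed.

(** Passing to the opposite algebra exchanges the two coverings. *)
Lemma coassoc_lr (k : fieldType) (H : nalg k) (A : lmodType k)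
    (c : A -> H -> tensor H A) (cl : H -> A -> tensor H A)
    (T1 T4 : H -> H -> tensor H H) :
  covered c cl -> bilin T1 -> bilin T4 -> tsurj (fun x y => T4 y x) ->
  (forall x y z w,
    \tsum_(p, q <- T4 w z) \tsum_(u, v <- T1 x y) ((p ** u) \ox (q ** v))
      = tmap id (fun v => v ** y) (T4 w (z ** x))) ->
  coassocl T4 cl -> coassocr T1 c.
Proof.
move=> cP [b1 b2] [b3 b4] Ts T41 ccl.
apply: (@coassoc_rl k (nopp H) A (fun a x => cl x a) (fun x a => c a x)
   (fun x y => T4 y x) (fun y x => T1 x y)) => //.
- exact: covered_op.
by move=> x y z w; rewrite tsum_swap; exact: (T41 x y z w).
Qed.

Section Counit.
Variables (k : fieldType) (H : nalg k) (A : lmodType k).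
Variables (c : A -> H -> tensor H A) (cl : H -> A -> tensor H A).
Variables (T1 : H -> H -> tensor H H) (eps : H -> k).
Hypotheses (cP : covered c cl) (T1b : bilin T1) (epsl : linear (eps : H -> k^o)).
Hypothesis epsM : forall x y, eps (x ** y) = eps x * eps y.
Hypothesis eps1 : exists u, eps u = 1.
Hypothesis epsT : forall x y, \tsum_(u, v <- T1 x y) (eps u *: v) = x ** y.
Hypothesis c_inj : forall a, (forall z, c a z = 0) -> a = 0.
Hypothesis cr : coassocr T1 c.

(** Applying eps to the first leg of c a x gives eps(x)a' for some a' which does not
    depend on x.  Coassociativity then shows that a and a' have the same coaction,
    and the coaction is injective. *)
Lemma coact_counit a :
  (forall x, \tsum_(y, b <- c a x) (eps y *: b) = eps x *: a)
  /\ (forall x, \tsum_(y, b <- cl x a) (eps y *: b) = eps x *: a).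
Proof.
have cb := cov_bilin cP.
pose E (t : tensor H A) := \tsum_(y, b <- t) (eps y *: b).
have El : linear E by rewrite /E; lin.
have Elm y t : E (y *| t) = eps y *: E t.
  rewrite /E tsum_map; lin; rewrite (lin_tsumE (F := fun b : A => eps y *: b)); lin.
  by apply: eq_tsum => u b; rewrite epsM scalerA.
have Erm y t : E (t |* y) = eps y *: E t.
  rewrite /E tsum_map; lin; rewrite (lin_tsumE (F := fun b : A => eps y *: b)); lin.
  by apply: eq_tsum => u b; rewrite epsM scalerA mulrC.
have [u eu] := eps1.
have Ec x : E (c a x) = eps x *: E (cl u a).
  by rewrite -Erm -(cov_link cP) Elm eu scale1r.
suff aE : E (cl u a) = a.
  split=> x; first by rewrite -/(E _) Ec aE.
  have := Erm u (cl x a); rewrite -(cov_link cP) Elm Ec eu !scale1r aE.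
  by move/esym.
apply/eqP; rewrite -subr_eq0; apply/eqP/c_inj => z.
have [e he] := nalg_local_units [:: z]; have [ez _] := he z (mem_head _ _).
rewrite addrC -scaleN1r (bilin_l z cb) scaleN1r.
apply/eqP; rewrite addrC subr_eq0; apply/eqP; rewrite -ez.
pose Phi (s : tensor H (tensor H A)) : tensor H A :=
  \tsum_(u, r <- s) \tsum_(v, b <- r) ((eps u *: v) \ox b).
have Phil : linear Phi by rewrite /Phi; lin.
have := congr1 Phi (cr a e z); rewrite !(lin_tsumE _ _ Phil).
have -> : \tsum_(u, v <- T1 e z) Phi (\tsum_(z, b <- c a u) (z \ox c b v))
     = c (E (cl u a)) (e ** z).
  rewrite -epsT (lin_tsumE (F := c _)); lin; apply: eq_tsum => x v.
  rewrite (linPZ (bilin_r _ cb)) -(linPZ (bilin_l v cb)) -Ec (lin_tsumE _ _ Phil) /E.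
  rewrite (lin_tsumE (F := fun a => c a v)); lin; apply: eq_tsum => y b.
  rewrite /Phi tsum_pure; lin; rewrite (linPZ (bilin_l v cb)).
  rewrite -[c b v in RHS]tsum_eta (lin_tsumE (F := fun t : tensor H A => eps y *: t)); lin.
  by apply: eq_tsum => w b'; rewrite (linPZ (bilin_l b' (tpure_bilin H A))).
move=> ->; rewrite (covM cP) tmapE; apply: eq_tsum => y b.
rewrite (lin_tsumE _ _ Phil) -epsT (lin_tsumE (F := fun r => r \ox b)); lin.
by apply: eq_tsum => x v; rewrite /Phi !tsum_pure; lin.
Qed.
End Counit.

(** * Pairs of coactions *)

Section CommutingCoactions.
Variables (k : fieldType) (H K : nalg k) (A : lmodType k).
Variables (c : A -> H -> tensor H A) (cl : H -> A -> tensor H A).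
Variables (d : A -> K -> tensor K A) (dl : K -> A -> tensor K A).
Hypotheses (cP : covered c cl) (dP : covered d dl).

Lemma cocommute_l : cocommute c d -> cocommute (fun a x => cl x a) d.
Proof.
move=> cd a x y.
apply: rm_cancel => z; rewrite !tmap_tsum; lin.
pose Psi (t : tensor H (tensor K A)) := x *| t.
have Psil : linear Psi by apply: lm_lin.
transitivity (Psi (\tsum_(u, b <- c a z) (u \ox d b y))).
  rewrite (lin_tsumE _ _ Psil).
  have h : \tsum_(u, b <- x *| c a z) (u \ox d b y)
     = \tsum_(u, b <- cl x a |* z) (u \ox d b y) by rewrite (cov_link cP).
  move: h; rewrite !tsum_map; lin => h.
  under eq_tsum => u b do rewrite rm_pure.
  by under [RHS]eq_tsum => u b do rewrite /Psi lm_pure.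
rewrite cd (lin_tsumE _ _ Psil); apply: eq_tsum => v b.
rewrite (lin_tsumE _ _ Psil) tmap_tsum; lin.
have h : \tsum_(u, b' <- x *| c b z) (u \ox (v \ox b'))
     = \tsum_(u, b' <- cl x b |* z) (u \ox (v \ox b')) by rewrite (cov_link cP).
move: h; rewrite !tsum_map; lin => h.
under [RHS]eq_tsum => u b' do rewrite rm_pure.
by under [LHS]eq_tsum => u b' do rewrite /Psi lm_pure.
Qed.

Lemma cocommute_sym : cocommute c d -> cocommute d c.
Proof.
move=> cd a x y.
pose Psi (t : tensor H (tensor K A)) : tensor K (tensor H A) :=
  \tsum_(u, r <- t) \tsum_(v, b <- r) (v \ox (u \ox b)).
have Psil : linear Psi by rewrite /Psi; lin.
have /esym := congr1 Psi (cd a y x); rewrite !(lin_tsumE _ _ Psil) => h.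
transitivity (\tsum_(v, b <- d a x) Psi (\tsum_(u, b' <- c b y) (u \ox (v \ox b')))).
  apply: eq_tsum => v b; rewrite (lin_tsumE _ _ Psil).
  rewrite -[c b y in LHS]tsum_eta (lin_tsumE (F := tpure v)); lin.
  by apply: eq_tsum => u b'; rewrite /Psi !tsum_pure; lin.
by rewrite h; apply: eq_tsum => u b; rewrite /Psi tsum_pure; lin.
Qed.

Lemma cocommute_inv (S Sinv : H -> H) : linear Sinv ->
  cocommute (fun a x => cl x a) d -> cocommute (cov_inv S Sinv cl) d.
Proof.
move=> Sl cd a x y.
rewrite /cov_inv tsum_map; lin.
pose Psi (t : tensor H (tensor K A)) := tmap Sinv id t.
have Psil : linear Psi by apply: tmap_linear; lin.
transitivity (Psi (\tsum_(u, b <- cl (S x) a) (u \ox d b y))).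
  by rewrite (lin_tsumE _ _ Psil); apply: eq_tsum => u b; rewrite /Psi tmap_tpure; lin.
rewrite cd (lin_tsumE _ _ Psil); apply: eq_tsum => u b.
rewrite tsum_map; lin; rewrite (lin_tsumE _ _ Psil); apply: eq_tsum => v b'.
by rewrite /Psi tmap_tpure; lin.
Qed.

(** alpha is a morphism for the other coaction: the coactions commute, and [c] is
    compatible with the action of K. *)
Lemma contract_source (V : lmodType k) (actH : H -> V -> V) (actK : K -> A -> A) a v :
  module actH -> module actK -> cocommute c d ->
  (forall y a x, c (actK y a) x = tmap id (actK y) (c a x)) ->
  (forall y a x, d (actK y a) x = tmap id (actK y) (d a x)) ->
  coact_on actH c (contract actK d a) v
    = tmap (contract actK d) id (coact_on actH c a v).
Proof.
move=> HP KP cd cK dK.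
have Lb := coact_on_bilin HP cP; have rl := contract_linear KP dP dK.
have [f [fa _]] := lunital2 a a (module_lunital KP).
have [e [ev _]] := lunital2 v v (module_lunital HP).
have srcE y b w : coact_on actH c (actK y b) w = tmap (actK y) id (coact_on actH c b w).
  by apply: coact_on_source => //; lin.
rewrite -fa srcE -(contractE KP dP dK) tmap_comp; lin.
pose Phi (s : tensor H (tensor K A)) :=
  \tsum_(x, r <- s) \tsum_(y, b <- r) (actK y b \ox actH x v).
have Phil : linear Phi by rewrite /Phi; lin.
transitivity (Phi (\tsum_(y, b <- d a f) \tsum_(x, b' <- c b e) (x \ox (y \ox b')))).
  rewrite (lin_tsumE (F := fun a => coact_on actH c a v)); lin.
  rewrite (lin_tsumE _ _ Phil); apply: eq_tsum => y b.
  rewrite srcE (coact_on_unit HP cP b ev) (lin_tsumE _ _ Phil) tmap_tsum; lin.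
  by apply: eq_tsum => x b'; rewrite tmap_tpure /Phi ?tsum_pure; lin.
rewrite -cd (lin_tsumE _ _ Phil) (coact_on_unit HP cP a ev) tmap_tsum; lin.
apply: eq_tsum => x b; rewrite tmap_tpure -?(contractE KP dP dK) /Phi ?tsum_pure; lin.
by rewrite (lin_tsumE (F := fun b => b \ox actH x v)); lin.
Qed.
End CommutingCoactions.

Section NaturalCoactions.
Variables (k : fieldType) (H : nalg k) (A B : lmodType k).
Variables (c : A -> H -> tensor H A) (cl : H -> A -> tensor H A).
Variables (c' : B -> H -> tensor H B) (cl' : H -> B -> tensor H B).
Hypotheses (cP : covered c cl) (cP' : covered c' cl').
Variable g : A -> B.
Hypothesis gl : linear g.
Hypothesis gc : forall a x, c' (g a) x = tmap id g (c a x).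

Lemma cov_inv_nat (S Sinv : H -> H) a x : linear Sinv ->
  cov_inv S Sinv cl' (g a) x = tmap id g (cov_inv S Sinv cl a x).
Proof. by move=> Sl; rewrite /cov_inv (covl_nat cP cP' gl gc) !tmap_comp; lin. Qed.
End NaturalCoactions.

Section CoactOnCommutes.
Variables (k : fieldType) (H K : nalg k).
Implicit Types A B V X : lmodType k.

Lemma coact_on_comm_target A B V X (actH : H -> V -> V) (actK : K -> V -> V)
    (c : A -> H -> tensor H A) (cl : H -> A -> tensor H A)
    (d : B -> K -> tensor K B) (dl : K -> B -> tensor K B)
    (F : A -> V -> B -> X) a b v :
  covered c cl -> covered d dl -> module actH -> module actK ->
  (forall x y v, actK y (actH x v) = actH x (actK y v)) -> trilin F ->
  \tsum_(b0, v1 <- coact_on actK d b v) \tsum_(a0, v2 <- coact_on actH c a v1) F a0 v2 b0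
  = \tsum_(a0, v1 <- coact_on actH c a v) \tsum_(b0, v2 <- coact_on actK d b v1)
      F a0 v2 b0.
Proof.
move=> cP dP HP KP HK Ft; have Lb := coact_on_bilin HP cP.
apply: (@coact_on_equivariant k K B V V A X actK actK d dl (coact_on actH c a) F) => //.
  by lin.
by move=> y u; apply: (coact_on_target _ _ cP) => //; lin.
Qed.

Lemma coact_on_comm_mixed A B V X (actH : H -> V -> V) (actK : K -> A -> A)
    (c : A -> H -> tensor H A) (cl : H -> A -> tensor H A)
    (d : B -> K -> tensor K B) (dl : K -> B -> tensor K B)
    (F : A -> V -> B -> X) a b v :
  covered c cl -> covered d dl -> module actH -> module actK ->
  (forall y a x, c (actK y a) x = tmap id (actK y) (c a x)) -> trilin F ->
  \tsum_(b0, a1 <- coact_on actK d b a) \tsum_(a2, v1 <- coact_on actH c a1 v) F a2 v1 b0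
  = \tsum_(a0, v1 <- coact_on actH c a v) \tsum_(b0, a1 <- coact_on actK d b a0)
      F a1 v1 b0.
Proof.
move=> cP dP HP KP cK [Ft1 Ft2]; have Lb := coact_on_bilin HP cP.
have Rb := coact_on_bilin KP dP.
have Fb v1 b0 : linear (fun a => F a v1 b0) by exact: Ft2.
pose G v a b := F a v b.
have Gt : trilin G.
  split=> [w|p q]; last by exact: (bilin_l q (Ft1 p)).
  by split=> [p|q]; [exact: (Ft1 p).1 | exact: Ft2].
transitivity (\tsum_(b0, a1 <- coact_on actK d b a)
   \tsum_(v1, a2 <- tswap (coact_on actH c a1 v)) G v1 a2 b0).
  by apply: eq_tsum => b0 a1; rewrite tsum_swapE; lin.
rewrite (@coact_on_equivariant k K B A A V X actK actK d dl
           (fun a => tswap (coact_on actH c a v))) //.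
- rewrite tsum_swapE //.
  by split=> [w|p]; rewrite /G; lin; apply: Ft1.
- by lin.
move=> y u; rewrite (coact_on_source (c := c) (g := actK y)) //; lin.
rewrite /tswap tsum_map ?tmap_tsum; lin.
by apply: eq_tsum => p q; rewrite tmap_tpure; lin.
Qed.
End CoactOnCommutes.

(** * One-sided systems *)

(** One side of a Long module algebra with invertible antipode: [H] acts on A and
    coacts by [c], and [ci] is the coaction that inverts [c].  The right action and
    the right coaction of Q form such a system over the opposite of Q, for the
    opposite product of A. *)
Record long_half (k : fieldType) (H : nalg k) (A : lmodType k) (m : A -> A -> A)
    (act : H -> A -> A) (c ci : A -> H -> tensor H A) : Prop := {
  half_module : module act;
  half_bilin : bilin m;
  half_cov : exists cl, covered c cl;
  half_covi : exists cl, covered ci cl;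
  half_invK : forall a e, \tsum_(x, b <- ci a e) c b x = e \ox a;
  half_Kinv : forall a e, \tsum_(x, b <- c a e) ci b x = e \ox a;
  half_mul : forall a b x, c (m a b) x
     = \tsum_(y, b0 <- c b x) \tsum_(z, a0 <- c a y) (z \ox m a0 b0);
  half_tmul : exists T : H -> H -> tensor H H,
    [/\ bilin T, tsurj T, coassocr T c
      & forall x y b b', act x (m b (act y b'))
          = \tsum_(u, v <- T x y) m (act u b) (act v b')];
  half_long : forall y a x, c (act y a) x = tmap id (act y) (c a x);
  half_longi : forall y a x, ci (act y a) x = tmap id (act y) (ci a x)
}.

Section Half.
Variables (k : fieldType) (H : nalg k) (A : lmodType k) (m : A -> A -> A).
Variables (act : H -> A -> A) (c ci : A -> H -> tensor H A).
Hypothesis P : long_half m act c ci.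
Notation L := (coact_on act c).
Notation Li := (coact_on act ci).
Notation rho := (contract act c).

Lemma half_Lb : bilin L.
Proof. by have [cl cP] := half_cov P; exact: coact_on_bilin (half_module P) cP. Qed.

Lemma half_Lib : bilin Li.
Proof. by have [cl cP] := half_covi P; exact: coact_on_bilin (half_module P) cP. Qed.

Lemma half_rhol : linear rho.
Proof.
have [cl cP] := half_cov P.
exact: contract_linear (half_module P) cP (half_long P).
Qed.

Lemma half_Lmul a b v :
  L (m a b) v = \tsum_(b0, w <- L b v) \tsum_(a0, u <- L a w) (m a0 b0 \ox u).
Proof.
have [cl cP] := half_cov P.
exact: (coact_on_mul cP (half_module P) (half_bilin P) (half_mul P)).
Qed.

Lemma half_Ltmul a b b' :
  L a (m b b')
    = \tsum_(a0, b1 <- L a b) \tsum_(a1, b'1 <- L a0 b') (a1 \ox m b1 b'1).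
Proof.
have [cl cP] := half_cov P; have [T [Tb Ts cr mT]] := half_tmul P.
exact: (coact_on_tmul cP (half_module P) (half_bilin P) Tb Ts cr mT).
Qed.

Lemma half_LK (X : lmodType k) (F : A -> A -> X) a v : bilin F ->
  \tsum_(a0, v1 <- Li a v) \tsum_(a1, v2 <- L a0 v1) F a1 v2 = F a v.
Proof.
have [cl cP] := half_cov P; have [cli ciP] := half_covi P => Fb.
exact: (coact_on_inv cP ciP (half_invK P) a v (half_module P) Fb).
Qed.

Lemma half_KL (X : lmodType k) (F : A -> A -> X) a v : bilin F ->
  \tsum_(a0, v1 <- L a v) \tsum_(a1, v2 <- Li a0 v1) F a1 v2 = F a v.
Proof.
have [cl cP] := half_cov P; have [cli ciP] := half_covi P => Fb.
exact: (coact_on_inv ciP cP (half_Kinv P) a v (half_module P) Fb).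
Qed.

Lemma half_LK_pure a v : \tsum_(a0, v1 <- Li a v) L a0 v1 = a \ox v.
Proof.
rewrite -(half_LK a v (tpure_bilin A A)).
by apply: eq_tsum => a0 v1; rewrite tsum_eta.
Qed.

Lemma half_KL_pure a v : \tsum_(a0, v1 <- L a v) Li a0 v1 = a \ox v.
Proof.
rewrite -(half_KL a v (tpure_bilin A A)).
by apply: eq_tsum => a0 v1; rewrite tsum_eta.
Qed.

Lemma half_rhoK : cancel rho (contract act ci).
Proof.
have [cl cP] := half_cov P; have [cli ciP] := half_covi P => a.
exact: (contract_inv ciP cP (half_Kinv P) a (half_module P) (half_longi P) (half_long P)).
Qed.

Lemma half_Krho : cancel (contract act ci) rho.
Proof.
have [cl cP] := half_cov P; have [cli ciP] := half_covi P => a.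
exact: (contract_inv cP ciP (half_invK P) a (half_module P) (half_long P) (half_longi P)).
Qed.

Lemma half_rhoM a b :
  rho (m a b) = \tsum_(b0, a1 <- L b a) \tsum_(a2, b1 <- L (rho a1) (rho b0)) m a2 b1.
Proof.
have [cl cP] := half_cov P; have [T [Tb Ts cr mT]] := half_tmul P.
exact: (contract_mul (half_module P) cP (half_long P) (half_bilin P) Tb Ts cr
          (half_mul P) mT).
Qed.

Lemma half_LL (X : lmodType k) (F : A -> A -> A -> X) a b v : trilin F ->
  \tsum_(b0, a1 <- L b a) \tsum_(a2, v1 <- L a1 v) F a2 v1 b0
    = \tsum_(a0, v1 <- L a v) \tsum_(b0, a1 <- L b a0) F a1 v1 b0.
Proof.
have [cl cP] := half_cov P => Ft.
exact: (coact_on_comm_mixed _ _ _ cP cP (half_module P) (half_module P) (half_long P) Ft).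
Qed.
End Half.

(** * The circled and the twisted product *)

(** The left and the right side are compatible: the actions commute, the coactions
    commute, and the two mixed Long conditions hold. *)
Record long_pair (k : fieldType) (H K : nalg k) (A : lmodType k)
    (actH : H -> A -> A) (c : A -> H -> tensor H A)
    (actK : K -> A -> A) (d : A -> K -> tensor K A) : Prop := {
  pair_act : forall x y a, actK y (actH x a) = actH x (actK y a);
  pair_coact : cocommute c d;
  pair_HK : forall y a x, c (actK y a) x = tmap id (actK y) (c a x);
  pair_KH : forall x a y, d (actH x a) y = tmap id (actH x) (d a y)
}.

Section Products.
Variables (k : fieldType) (H K : nalg k) (A : lmodType k) (m : A -> A -> A).
Variables (actH : H -> A -> A) (c ci : A -> H -> tensor H A).
Variables (actK : K -> A -> A) (d di : A -> K -> tensor K A).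
Hypotheses (mA : associative m).
Hypotheses (PH : long_half m actH c ci) (PK : long_half (fun a b => m b a) actK d di).
Hypothesis PP : long_pair actH c actK d.

Notation L := (coact_on actH c).
Notation Li := (coact_on actH ci).
Notation R := (coact_on actK d).
Notation Ri := (coact_on actK di).
Notation rho := (contract actK d).

Let mb : bilin m := half_bilin PH.
Let Lb : bilin L := half_Lb PH.
Let Rb : bilin R := half_Lb PK.
Let Rib : bilin Ri := half_Lib PK.
Let rl : linear rho := half_rhol PK.

Section Rules.
Variables (X : lmodType k) (F : A -> A -> A -> X).
Hypothesis Ft : trilin F.

Lemma LR_source a v w :
  \tsum_(a0, v1 <- L a v) \tsum_(a1, w1 <- R a0 w) F a1 v1 w1
    = \tsum_(a0, w1 <- R a w) \tsum_(a1, v1 <- L a0 v) F a1 v1 w1.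
Proof.
have [cl cP] := half_cov PH; have [dl dP] := half_cov PK.
exact: (coact_on_comm_source _ _ _ cP dP (half_module PH) (half_module PK)
          (pair_coact PP) Ft).
Qed.

Lemma LR_target a b v :
  \tsum_(b0, v1 <- R b v) \tsum_(a0, v2 <- L a v1) F a0 v2 b0
    = \tsum_(a0, v1 <- L a v) \tsum_(b0, v2 <- R b v1) F a0 v2 b0.
Proof.
have [cl cP] := half_cov PH; have [dl dP] := half_cov PK.
exact: (coact_on_comm_target _ _ _ cP dP (half_module PH) (half_module PK)
          (pair_act PP) Ft).
Qed.

Lemma LR_mixed a b v :
  \tsum_(b0, a1 <- R b a) \tsum_(a2, v1 <- L a1 v) F a2 v1 b0
    = \tsum_(a0, v1 <- L a v) \tsum_(b0, a1 <- R b a0) F a1 v1 b0.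
Proof.
have [cl cP] := half_cov PH; have [dl dP] := half_cov PK.
exact: (coact_on_comm_mixed _ _ _ cP dP (half_module PH) (half_module PK)
          (pair_HK PP) Ft).
Qed.

Lemma RL_mixed a b v :
  \tsum_(b0, a1 <- L b a) \tsum_(a2, v1 <- R a1 v) F a2 v1 b0
    = \tsum_(a0, v1 <- R a v) \tsum_(b0, a1 <- L b a0) F a1 v1 b0.
Proof.
have [cl cP] := half_cov PH; have [dl dP] := half_cov PK.
exact: (coact_on_comm_mixed _ _ _ dP cP (half_module PK) (half_module PH)
          (pair_KH PP) Ft).
Qed.
End Rules.

(** sum (a_0 <| b_(1))(a_(-1) |> b_0) *)
Definition circ (a b : A) : A :=
  \tsum_(a0, b1 <- L a b) \tsum_(b2, a1 <- R b1 a0) m a1 b2.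

Lemma circ_bilin : bilin circ.
Proof. by rewrite /circ; lin. Qed.

(** The six operators on functions of three arguments.  The first index names the
    argument that coacts, the second the one that is acted upon. *)
Section Operators.
Variable X : lmodType k.
Implicit Type F : A -> A -> A -> X.
Definition L12 F a b c0 := \tsum_(x, y <- L a b) F x y c0.
Definition L13 F a b c0 := \tsum_(x, y <- L a c0) F x b y.
Definition L23 F a b c0 := \tsum_(x, y <- L b c0) F a x y.
Definition R21 F a b c0 := \tsum_(x, y <- R b a) F y x c0.
Definition R31 F a b c0 := \tsum_(x, y <- R c0 a) F y b x.
Definition R32 F a b c0 := \tsum_(x, y <- R c0 b) F a y x.

Lemma trilin_op F : trilin F ->
  [/\ trilin (L12 F), trilin (L13 F), trilin (L23 F)
    & [/\ trilin (R21 F), trilin (R31 F) & trilin (R32 F)]].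
Proof.
move=> Ft; split; [| | |split]; rewrite /L12 /L13 /L23 /R21 /R31 /R32; lin.
Qed.

Lemma R21_L23 F : trilin F -> R21 (L23 F) = L23 (R21 F).
Proof.
move=> Ft; apply/funext => a; apply/funext => b; apply/funext => c0.
by rewrite /R21 /L23 -(LR_source (F := fun y z x => F x y z)); lin.
Qed.

Lemma R21_L13 F : trilin F -> R21 (L13 F) = L13 (R21 F).
Proof.
move=> Ft; apply/funext => a; apply/funext => b; apply/funext => c0.
by rewrite /R21 /L13 (LR_mixed (F := fun x z y => F x y z)); lin.
Qed.

Lemma R21_R32 F : trilin F -> R32 (R21 F) = R21 (R32 F).
Proof.
move=> Ft; apply/funext => a; apply/funext => b; apply/funext => c0.
by rewrite /R21 /R32 (half_LL PK (F := fun y x z => F x y z)); lin.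
Qed.

Lemma L13_R32 F : trilin F -> L13 (R32 F) = R32 (L13 F).
Proof.
move=> Ft; apply/funext => a; apply/funext => b; apply/funext => c0.
by rewrite /L13 /R32 (RL_mixed (F := fun z y x => F x y z)); lin.
Qed.

Lemma L12_L23 F : trilin F -> L12 (L23 F) = L23 (L12 F).
Proof.
move=> Ft; apply/funext => a; apply/funext => b; apply/funext => c0.
by rewrite /L12 /L23 (half_LL PH (F := fun y z x => F x y z)); lin.
Qed.

Lemma L12_R32 F : trilin F -> L12 (R32 F) = R32 (L12 F).
Proof.
move=> Ft; apply/funext => a; apply/funext => b; apply/funext => c0.
by rewrite /L12 /R32 -(LR_target (F := fun x y z => F x y z)); lin.
Qed.
End Operators.

Lemma circ_mull p q c0 :
  circ (m p q) c0 = \tsum_(q0, c1 <- L q c0) \tsum_(p0, c2 <- L p c1)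
    \tsum_(c3, q1 <- R c2 q0) \tsum_(c4, p1 <- R c3 p0) m (m p1 q1) c4.
Proof.
rewrite /circ (half_Lmul PH) tsum_bind; lin; apply: eq_tsum => q0 c1.
rewrite tsum_bind; lin; apply: eq_tsum => p0 c2; rewrite tsum_pure; lin.
rewrite (half_Ltmul PK c2 q0 p0) tsum_bind; lin; apply: eq_tsum => c3 q1.
by rewrite tsum_bind; lin; apply: eq_tsum => c4 p1; rewrite tsum_pure; lin.
Qed.

Lemma circ_mulr a p q :
  circ a (m p q) = \tsum_(a0, p1 <- L a p) \tsum_(a1, q1 <- L a0 q)
    \tsum_(p2, a2 <- R p1 a1) \tsum_(q2, a3 <- R q1 a2) m a3 (m p2 q2).
Proof.
rewrite /circ (half_Ltmul PH) tsum_bind; lin; apply: eq_tsum => a0 p1.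
rewrite tsum_bind; lin; apply: eq_tsum => a1 q1; rewrite tsum_pure; lin.
rewrite (half_Lmul PK q1 p1) tsum_bind; lin; apply: eq_tsum => p2 a2.
by rewrite tsum_bind; lin; apply: eq_tsum => q2 a3; rewrite tsum_pure; lin.
Qed.

(** By [circ_mulr] and [circ_mull] both sides are the triple product preceded by the
    six operators, in two different orders. *)
Lemma circ_assoc : associative circ.
Proof.
move=> a b c0; have cb := circ_bilin.
pose F a b c0 := m a (m b c0).
have Ft : trilin F by rewrite /F; lin.
transitivity (L23 (R32 (L12 (L13 (R21 (R31 F))))) a b c0).
  rewrite {2}/circ lin_tsumE; lin; apply: eq_tsum => b0 c1.
  rewrite lin_tsumE; lin; apply: eq_tsum => c2 b1.
  exact: circ_mulr.
have [_ _ _ [_ Ft1 Ft2]] := trilin_op Ft.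
have [_ L13t _ [R21t _ R32t]] := trilin_op Ft1.
have [_ L13R32t _ _] := trilin_op R32t.
have [_ L13R21t _ _] := trilin_op R21t.
rewrite -L12_R32 // -L12_L23; last by have [_ _ _ [_ _]] := trilin_op L13R21t.
rewrite -L13_R32 // R21_R32 // -R21_L13 // -R21_L23 //.
symmetry; rewrite {2}/circ.
rewrite (lin_tsumE (F := fun x => circ x c0)); lin; apply: eq_tsum => a0 b1.
rewrite (lin_tsumE (F := fun x => circ x c0)); lin; apply: eq_tsum => b2 a1.
rewrite circ_mull; apply: eq_tsum => q0 c1; apply: eq_tsum => p0 c2.
apply: eq_tsum => c3 q1; apply: eq_tsum => c4 p1.
by rewrite /F mA.
Qed.

(** sum a_0 (a_(-1) |> b <| S^-1(a_(1))), the left twisted product *)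
Definition twisted (a b : A) : A :=
  \tsum_(a0, b1 <- L a b) \tsum_(a1, b2 <- Ri a0 b1) m a1 b2.

Lemma twisted_prod_bilin : bilin twisted.
Proof. by rewrite /twisted; lin. Qed.

(** The image under alpha of a product begins with R, which cancels Ri.  What is left
    is circled because alpha commutes with L in both arguments. *)
Lemma rho_twisted a b : rho (twisted a b) = circ (rho a) (rho b).
Proof.
have [cl cP] := half_cov PH; have [dl dP] := half_cov PK.
have HP := half_module PH; have KP := half_module PK.
rewrite /twisted (lin_tsumE _ _ rl).
transitivity (\tsum_(a0, b1 <- L a b) \tsum_(b2, a1 <- R (rho b1) (rho a0)) m a1 b2).
  apply: eq_tsum => a0 b1; rewrite (lin_tsumE _ _ rl).
  have Fb : bilin (fun a b => \tsum_(b2, a1 <- R (rho b) (rho a)) m a1 b2) by lin.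
  rewrite -(half_LK PK a0 b1 Fb); apply: eq_tsum => a1 b2.
  exact: (half_rhoM PK b2 a1).
have src p v : L (rho p) v = tmap rho id (L p v).
  by apply: (contract_source cP dP) => //; [exact: (pair_coact PP) | exact: (pair_HK PP)
    | exact: (half_long PK)].
have tgt p v : L p (rho v) = tmap id rho (L p v).
  apply: (coact_on_target _ _ cP) => // x w.
  apply: (contract_nat KP dP (half_long PK)) => //.
  - by have := act_bilin HP; lin.
  - by move=> y u; rewrite (pair_act PP).
  exact: (pair_KH PP).
by rewrite /circ src tgt tmap_comp ?tsum_map; lin.
Qed.

Lemma circ_twisted_iso : alg_iso twisted circ rho (contract actK di).
Proof.
have K1 := half_rhoK PK; have K2 := half_Krho PK.
split.
- split; first exact: twisted_prod_bilin.
  move=> a b c0; apply: (can_inj K1).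
  by rewrite !rho_twisted circ_assoc.
- by split; [exact: circ_bilin | exact: circ_assoc].
- exact: rl.
- exact: rho_twisted.
- exact: K1.
exact: K2.
Qed.

(** The left diamond, the left star, the right diamond and the right star product of
    two pure tensors *)
Definition ldiam (a b a' b' : A) : tensor A A :=
  \tsum_(b0, a'1 <- L b a') \tsum_(b'0, a1 <- R b' a) (m a1 a'1 \ox m b0 b'0).
Definition lstar (a b a' b' : A) : tensor A A :=
  \tsum_(b0, a'1 <- L b a') \tsum_(b1, a'2 <- Ri b0 a'1) (m a a'2 \ox m b1 b').
Definition rdiam (b' a' b a : A) : tensor A A :=
  \tsum_(b'0, a1 <- L b' a) \tsum_(b0, a'1 <- R b a') (m b'0 b0 \ox m a'1 a1).
Definition rstar (b' a' b a : A) : tensor A A :=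
  \tsum_(b0, a'1 <- R b a') \tsum_(b1, a'2 <- Li b0 a'1) (m b' b1 \ox m a'2 a).

Lemma ldiam_mull p p' q q' a b :
  ldiam (m p p') (m q q') a b = \tsum_(q'0, a1 <- L q' a) \tsum_(q0, a2 <- L q a1)
    \tsum_(b1, p'1 <- R b p') \tsum_(b2, p1 <- R b1 p)
      (m (m p1 p'1) a2 \ox m (m q0 q'0) b2).
Proof.
rewrite /ldiam (half_Lmul PH) tsum_bind; lin; apply: eq_tsum => q'0 a1.
rewrite tsum_bind; lin; apply: eq_tsum => q0 a2; rewrite tsum_pure; lin.
rewrite (half_Ltmul PK b p' p) tsum_bind; lin; apply: eq_tsum => b1 p'1.
by rewrite tsum_bind; lin; apply: eq_tsum => b2 p1; rewrite tsum_pure; lin.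
Qed.

Lemma ldiam_mulr a b p p' q q' :
  ldiam a b (m p p') (m q q') = \tsum_(b0, p1 <- L b p) \tsum_(b1, p'1 <- L b0 p')
    \tsum_(q0, a1 <- R q a) \tsum_(q'0, a2 <- R q' a1)
      (m a2 (m p1 p'1) \ox m b1 (m q0 q'0)).
Proof.
rewrite /ldiam (half_Ltmul PH) tsum_bind; lin; apply: eq_tsum => b0 p1.
rewrite tsum_bind; lin; apply: eq_tsum => b1 p'1; rewrite tsum_pure; lin.
rewrite (half_Lmul PK q' q) tsum_bind; lin; apply: eq_tsum => q0 a1.
by rewrite tsum_bind; lin; apply: eq_tsum => q'0 a2; rewrite tsum_pure; lin.
Qed.

Lemma R_mul2 p p' q q' :
  R (m q q') (m p p') = \tsum_(q0, p'1 <- R q p') \tsum_(q1, p1 <- R q0 p)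
    \tsum_(q'0, p'2 <- R q' p'1) \tsum_(q'1, p2 <- R q'0 p1) (m q1 q'1 \ox m p2 p'2).
Proof.
rewrite (half_Lmul PK q' q) (half_Ltmul PK q p' p) tsum_bind; lin.
apply: eq_tsum => q0 p'1; rewrite tsum_bind; lin.
apply: eq_tsum => q1 p1; rewrite tsum_pure; lin.
rewrite (half_Ltmul PK q' p'1 p1) tsum_bind; lin; apply: eq_tsum => q'0 p'2.
by rewrite tsum_bind; lin; apply: eq_tsum => q'1 p2; rewrite tsum_pure; lin.
Qed.

(** Both sides are expanded into the same six operators; L and R sharing b' and L
    and R acting on a' are the only ones to be exchanged. *)
Lemma ldiam_assoc a b a' b' a'' b'' :
  \tsum_(p, q <- ldiam a b a' b') ldiam p q a'' b''
    = \tsum_(p, q <- ldiam a' b' a'' b'') ldiam a b p q.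
Proof.
have db a1 b1 : bilin (fun p q => ldiam p q a1 b1) by rewrite /ldiam; lin.
have db' a1 b1 : bilin (fun p q => ldiam a1 b1 p q) by rewrite /ldiam; lin.
transitivity (\tsum_(b0, a'1 <- L b a') \tsum_(b'0, a1 <- R b' a)
  \tsum_(b'1, a''1 <- L b'0 a'') \tsum_(b1, a''2 <- L b0 a''1)
  \tsum_(b''0, a'2 <- R b'' a'1) \tsum_(b''1, a2 <- R b''0 a1)
    (m a2 (m a'2 a''2) \ox m b1 (m b'1 b''1))).
  rewrite [ldiam a b a' b']/ldiam tsum_bind; lin; apply: eq_tsum => b0 a'1.
  rewrite tsum_bind; lin; apply: eq_tsum => b'0 a1; rewrite tsum_pure; lin.
  rewrite ldiam_mull; apply: eq_tsum => b'1 a''1; apply: eq_tsum => b1 a''2.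
  by apply: eq_tsum => b''0 a'2; apply: eq_tsum => b''1 a2; rewrite !mA.
transitivity (\tsum_(b0, a'1 <- L b a') \tsum_(b'0, a''1 <- L b' a'')
  \tsum_(b'1, a1 <- R b'0 a) \tsum_(b1, a''2 <- L b0 a''1)
  \tsum_(b''0, a'2 <- R b'' a'1) \tsum_(b''1, a2 <- R b''0 a1)
    (m a2 (m a'2 a''2) \ox m b1 (m b'1 b''1))).
  apply: eq_tsum => b0 a'1.
  rewrite (LR_source (F := fun b'1 a''1 a1 => \tsum_(b1, a''2 <- L b0 a''1)
  \tsum_(b''0, a'2 <- R b'' a'1) \tsum_(b''1, a2 <- R b''0 a1)
    (m a2 (m a'2 a''2) \ox m b1 (m b'1 b''1)))) //; lin.
rewrite tsum_swap; symmetry.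
rewrite [ldiam a' b' a'' b'']/ldiam tsum_bind; lin; apply: eq_tsum => b'0 a''1.
rewrite tsum_bind; lin.
transitivity (\tsum_(b''0, a'1 <- R b'' a') \tsum_(b0, a'2 <- L b a'1)
  \tsum_(b1, a''2 <- L b0 a''1) \tsum_(b'1, a1 <- R b'0 a)
  \tsum_(b''1, a2 <- R b''0 a1)
    (m a2 (m a'2 a''2) \ox m b1 (m b'1 b''1))).
  by apply: eq_tsum => b''0 a'1; rewrite tsum_pure ?ldiam_mulr; lin.
rewrite (LR_target (F := fun b0 a'2 b''0 => \tsum_(b1, a''2 <- L b0 a''1)
  \tsum_(b'1, a1 <- R b'0 a) \tsum_(b''1, a2 <- R b''0 a1)
    (m a2 (m a'2 a''2) \ox m b1 (m b'1 b''1)))); last by lin.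
apply: eq_tsum => b0 a'1.
rewrite tsum_swap [RHS]tsum_swap; apply: eq_tsum => b1 a''2.
by rewrite tsum_swap.
Qed.

(** R applied to the star product of two pure tensors starts with an R that cancels
    the Ri of that product. *)
Lemma lstar_R a b a' b' :
  \tsum_(p, q <- lstar a b a' b') R q p
    = \tsum_(b0, a1 <- R b a) \tsum_(b'0, a'1 <- R b' a') tswap (ldiam a1 b0 a'1 b'0).
Proof.
rewrite /lstar tsum_bind; lin.
transitivity (\tsum_(b0, a'1 <- L b a') \tsum_(b1, a1 <- R b0 a)
    \tsum_(b'0, a'2 <- R b' a'1) \tsum_(b'1, a2 <- R b'0 a1)
      (m b1 b'1 \ox m a2 a'2)).
  apply: eq_tsum => b0 a'1.
  pose G b1 a'2 := \tsum_(b2, a1 <- R b1 a) \tsum_(b'0, a'3 <- R b' a'2)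
     \tsum_(b'1, a2 <- R b'0 a1) (m b2 b'1 \ox m a2 a'3).
  have Gb : bilin G by rewrite /G; lin.
  rewrite -/(G b0 a'1) -(half_LK PK b0 a'1 Gb) tsum_bind; lin.
  apply: eq_tsum => b1 a'2; rewrite tsum_pure; lin.
  exact: R_mul2.
rewrite (LR_source (F := fun b1 a'1 a1 => \tsum_(b'0, a'2 <- R b' a'1)
   \tsum_(b'1, a2 <- R b'0 a1) (m b1 b'1 \ox m a2 a'2))); last by lin.
apply: eq_tsum => b0 a1.
rewrite -(LR_target (F := fun b1 a'2 b'0 =>
   \tsum_(b'1, a2 <- R b'0 a1) (m b1 b'1 \ox m a2 a'2))); last by lin.
apply: eq_tsum => b'0 a'1; rewrite /ldiam lin_tsumE; lin.
apply: eq_tsum => b1 a'2; rewrite lin_tsumE; lin.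
by apply: eq_tsum => b'1 a2; rewrite /tswap tsum_pure; lin.
Qed.

End Products.

(** * Products on a tensor square *)

Section TensorProducts.
Variable k : fieldType.

Definition lift4 (U V : lmodType k) (G : U -> V -> U -> V -> tensor U V)
    (s t : tensor U V) : tensor U V :=
  \tsum_(a, b <- s) \tsum_(a', b' <- t) G a b a' b'.

Definition quadlin (U V W : lmodType k) (G : U -> V -> U -> V -> W) :=
  (forall a b, bilin (G a b)) /\ (forall a' b', bilin (fun a b => G a b a' b')).

Section Lift4.
Variables (U V : lmodType k) (G : U -> V -> U -> V -> tensor U V).
Hypothesis Gq : quadlin G.

Lemma lift4_bilin : bilin (lift4 G).
Proof.
case: Gq => G1 G2; split=> [s|t]; rewrite /lift4.
  by lin; apply: tlift_linear; exact: G1.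
apply: tlift_linear; split=> [a|b]; apply: lin_tsum => a' b'.
  exact: (G2 a' b').1.
exact: (G2 a' b').2.
Qed.

Lemma lift4_pure a b a' b' : lift4 G (a \ox b) (a' \ox b') = G a b a' b'.
Proof.
case: Gq => G1 G2; rewrite /lift4 tsum_pure.
  by rewrite tsum_pure //; exact: G1.
split=> [x|x]; apply: lin_tsum => y z; first exact: (G2 y z).1.
exact: (G2 y z).2.
Qed.

Lemma lift4_tmap (g g' : U -> U) (h h' : V -> V) s t :
  linear g -> linear g' -> linear h -> linear h' ->
  lift4 G (tmap g h s) (tmap g' h' t)
    = \tsum_(a, b <- s) \tsum_(a', b' <- t) G (g a) (h b) (g' a') (h' b').
Proof.
case: Gq => G1 G2 gl gl' hl hl'; rewrite /lift4 tsum_map //.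
  by apply: eq_tsum => a b; rewrite tsum_map.
by split=> x; apply: lin_tsum => u v; [exact: (G2 u v).1 | exact: (G2 u v).2].
Qed.

Lemma lift4_assoc :
  (forall a b a' b' a'' b'', \tsum_(p, q <- G a b a' b') G p q a'' b''
     = \tsum_(p, q <- G a' b' a'' b'') G a b p q) ->
  associative (lift4 G).
Proof.
move=> GA; have Lb := lift4_bilin; case: Gq => G1 G2 r s t.
apply: (@eq_lin _ _ _ _ (fun r => lift4 G r (lift4 G s t))
         (fun r => lift4 G (lift4 G r s) t)); [by lin | by lin | move=> a b].
apply: (@eq_lin _ _ _ _ (fun s => lift4 G (a \ox b) (lift4 G s t))
         (fun s => lift4 G (lift4 G (a \ox b) s) t)); [by lin | by lin | move=> a' b'].
apply: (@eq_lin _ _ _ _ (fun t => lift4 G (a \ox b) (lift4 G (a' \ox b') t))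
         (fun t => lift4 G (lift4 G (a \ox b) (a' \ox b')) t));
  [by lin | by lin | move=> a'' b''].
rewrite !lift4_pure {1}/lift4 tsum_pure.
  rewrite -GA /lift4; apply: eq_tsum => p q.
  by rewrite tsum_pure //; exact: G1.
by split=> [x|x]; apply: lin_tsum => y z; [exact: (G2 y z).1 | exact: (G2 y z).2].
Qed.

Lemma lift4_flip (G' : V -> U -> V -> U -> tensor V U) s t :
  (forall b' a' b a, G' b' a' b a = tswap (G a b a' b')) ->
  lift4 G' s t = tswap (lift4 G (tswap t) (tswap s)).
Proof.
move=> GE; have sl := @tswap_linear k U V; case: Gq => G1 G2.
rewrite {2}/lift4 tsum_swapE; last first.
  by split=> x; apply: lin_tsum => u v; [exact: (G2 u v).1 | exact: (G2 u v).2].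
rewrite (lin_tsumE _ _ sl) /lift4 tsum_swap; apply: eq_tsum => b a.
rewrite tsum_swapE // (lin_tsumE _ _ sl).
by apply: eq_tsum => b' a'; rewrite GE.
Qed.
End Lift4.

(** An isomorphism of algebras is also one of the opposite algebras, and these are
    carried by sw to the other two products. *)
Lemma alg_isomorphic_opp (V : lmodType k) (sw : V -> V) (mV mW mV' mW' : V -> V -> V) :
  linear sw -> involutive sw ->
  (forall s t, mV' s t = sw (mV (sw t) (sw s))) ->
  (forall s t, mW' s t = sw (mW (sw t) (sw s))) ->
  alg_isomorphic mV mW -> alg_isomorphic mV' mW'.
Proof.
move=> swl swK eV eW [f [g P]].
have prod m m' : (forall s t, m' s t = sw (m (sw t) (sw s))) ->
    assoc_product m -> assoc_product m'.
  move=> e [[m1 m2] mA]; split; last by move=> r s t; rewrite !e !swK mA.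
  by split=> [s|t] c x y; rewrite !e swl ?m1 ?m2 swl.
have gl : linear g.
  by move=> c s t; apply: (can_inj (alg_isoK P)); rewrite (alg_iso_linear P) !(alg_isoVK P).
exists (fun s => sw (f (sw s))), (fun s => sw (g (sw s))); split.
- exact: prod eV (alg_iso_dom P).
- exact: prod eW (alg_iso_cod P).
- by move=> c s t; rewrite swl (alg_iso_linear P) swl.
- by move=> s t /=; rewrite eV eW !swK (alg_isoM P).
- by move=> s; rewrite swK (alg_isoK P) swK.
by move=> s; rewrite swK (alg_isoVK P) swK.
Qed.

(** Associativity is carried along the bijection, so it is needed on one side only. *)
Lemma alg_isomorphic_by (V : lmodType k) (mV mW : V -> V -> V) (f g : V -> V) :
  assoc_product mV -> bilin mW -> linear f -> linear g ->
  cancel f g -> cancel g f -> (forall a b, f (mW a b) = mV (f a) (f b)) ->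
  alg_isomorphic mV mW.
Proof.
move=> mVP mWb fl gl fK gK fM; exists g, f; split=> //.
- split=> // a b c; apply: (can_inj fK).
  by rewrite !fM mVP.2.
- by move=> a b /=; apply: (can_inj fK); rewrite fM !gK.
Qed.
End TensorProducts.

Section Isomorphisms.
Variables (k : fieldType) (H K : nalg k) (A : lmodType k) (m : A -> A -> A).
Variables (actH : H -> A -> A) (c ci : A -> H -> tensor H A).
Variables (actK : K -> A -> A) (d di : A -> K -> tensor K A).
Hypotheses (mA : associative m).
Hypotheses (PH : long_half m actH c ci) (PK : long_half (fun a b => m b a) actK d di).
Hypothesis PP : long_pair actH c actK d.

Notation L := (coact_on actH c).
Notation Li := (coact_on actH ci).
Notation R := (coact_on actK d).
Notation Ri := (coact_on actK di).

Let mb : bilin m := half_bilin PH.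
Let Lb : bilin L := half_Lb PH.
Let Lib : bilin Li := half_Lib PH.
Let Rb : bilin R := half_Lb PK.
Let Rib : bilin Ri := half_Lib PK.

Lemma ldiam_quad : quadlin (ldiam m actH c actK d).
Proof. by split=> a b; rewrite /ldiam; lin. Qed.
Lemma rdiam_quad : quadlin (rdiam m actH c actK d).
Proof. by split=> a b; rewrite /rdiam; lin. Qed.
Lemma lstar_quad : quadlin (lstar m actH c actK di).
Proof. by split=> a b; rewrite /lstar; lin. Qed.
Lemma rstar_quad : quadlin (rstar m actH ci actK d).
Proof. by split=> a b; rewrite /rstar; lin. Qed.

Lemma ldiam_product : assoc_product (lift4 (ldiam m actH c actK d)).
Proof.
split; first exact: lift4_bilin ldiam_quad.
by apply: (lift4_assoc ldiam_quad) => *; apply: (ldiam_assoc mA PH PK PP).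
Qed.

(** The isomorphism is sum a <| b_(1) (x) b_0. *)
Lemma ldiam_lstar_iso :
  alg_isomorphic (lift4 (ldiam m actH c actK d)) (lift4 (lstar m actH c actK di)).
Proof.
pose f (t : tensor A A) := tswap (\tsum_(a, b <- t) R b a).
pose g (t : tensor A A) := tswap (\tsum_(a, b <- t) Ri b a).
have fl : linear f by rewrite /f; lin.
have gl : linear g by rewrite /g; lin.
have sb := lift4_bilin lstar_quad; have [db _] := ldiam_product.
apply: (alg_isomorphic_by (f := f) (g := g)) => //.
- exact: ldiam_product.
- move=> t; apply: (@eq_lin _ _ _ _ (fun t => g (f t)) id); lin => a b.
  rewrite /f tsum_pure; lin.
  rewrite /g tsum_swapE; lin.
  rewrite (half_KL_pure PK).
  by rewrite /tswap tsum_pure; lin.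
- move=> t; apply: (@eq_lin _ _ _ _ (fun t => f (g t)) id); lin => a b.
  rewrite /g tsum_pure; lin.
  rewrite /f tsum_swapE; lin.
  rewrite (half_LK_pure PK).
  by rewrite /tswap tsum_pure; lin.
apply: eq_bilin => [||a b a' b']; [by lin | by lin |].
rewrite (lift4_pure lstar_quad) /f (lstar_R PH PK PP) !tsum_pure; lin.
have q1 := ldiam_quad.1; have q2 := ldiam_quad.2.
have sl := @tswap_linear k A A.
rewrite /lift4 tsum_swapE.
  rewrite lin_tsumE //; apply: eq_tsum => b0 a1.
  rewrite tsum_swapE; last exact: q1.
  rewrite lin_tsumE //.
  by apply: eq_tsum => b'0 a'1; rewrite tswapK.
by split=> x; apply: lin_tsum => u v; case: (q2 u v) => h1 h2; [exact: h1|exact: h2].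
Qed.

End Isomorphisms.

Section Opposite.
Variables (k : fieldType) (H K : nalg k) (A : lmodType k) (m : A -> A -> A).
Variables (actH : H -> A -> A) (c ci : A -> H -> tensor H A).
Variables (actK : K -> A -> A) (d di : A -> K -> tensor K A).
Hypotheses (mA : associative m).
Hypotheses (PH : long_half m actH c ci) (PK : long_half (fun a b => m b a) actK d di).
Hypothesis PP : long_pair actH c actK d.
Notation mop := (fun a b => m b a).

Lemma long_pair_sym : long_pair actK d actH c.
Proof.
split; [by move=> x y a; rewrite (pair_act PP) | | exact: pair_KH PP | exact: pair_HK PP].
exact: (cocommute_sym (pair_coact PP)).
Qed.

(** After a flip of the legs, the two products are the opposites of the left diamond
    and the left star for the opposite product, with H and K exchanged. *)
Lemma rdiam_rstar_iso :
  alg_isomorphic (lift4 (rdiam m actH c actK d)) (lift4 (rstar m actH ci actK d)).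
Proof.
have sl := @tswap_linear k A A.
have mopA : associative mop by move=> x y z; rewrite mA.
apply: (alg_isomorphic_opp sl (@tswapK k A A)) (ldiam_lstar_iso mopA PK PH long_pair_sym).
  move=> s t; apply: lift4_flip => [|b' a' b a]; first exact: (ldiam_quad PK PH).
  rewrite /rdiam tsum_swap (lin_tsumE _ _ sl); apply: eq_tsum => b0 a'1.
  by rewrite (lin_tsumE _ _ sl); apply: eq_tsum => b'0 a1; rewrite /tswap tsum_pure; lin.
move=> s t; apply: lift4_flip => [|b' a' b a]; first exact: (lstar_quad PK PH).
rewrite (lin_tsumE _ _ sl); apply: eq_tsum => b0 a'1.
by rewrite (lin_tsumE _ _ sl); apply: eq_tsum => b1 a'2; rewrite /tswap tsum_pure; lin.
Qed.
End Opposite.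

(** * Covered comultiplications *)

Section OneSidedMultipliers.
Variables (k : fieldType) (A B : nalg k).
Implicit Types (s t : tensor A B).

Lemma memb_lm1 a t :
  memb (tmap (nmul a) id t : ntens A B) = mtens (memb a) mone *m* memb (t : ntens A B).
Proof. exact: (memb_mulL (mtens (memb a) mone) (t : ntens A B)). Qed.

Lemma memb_lm2 b t :
  memb (tmap id (nmul b) t : ntens A B) = mtens mone (memb b) *m* memb (t : ntens A B).
Proof. exact: (memb_mulL (mtens mone (memb b)) (t : ntens A B)). Qed.

Lemma memb_rm1 a t :
  memb (tmap (fun x => x ** a) id t : ntens A B)
    = memb (t : ntens A B) *m* mtens (memb a) mone.
Proof. exact: (memb_mulR (mtens (memb a) mone) (t : ntens A B)). Qed.

Lemma memb_rm2 b t :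
  memb (tmap id (fun x => x ** b) t : ntens A B)
    = memb (t : ntens A B) *m* mtens mone (memb b).
Proof. exact: (memb_mulR (mtens mone (memb b)) (t : ntens A B)). Qed.

Lemma memb_tinj s t : memb (s : ntens A B) = memb (t : ntens A B) -> s = t.
Proof. exact: (@memb_inj _ (ntens A B)). Qed.

Lemma memb_tlin : linear (fun t : tensor A B => memb (t : ntens A B)).
Proof. exact (@memb_linear k (ntens A B)). Qed.

Lemma memb_tsum (U V : lmodType k) (f : U -> V -> tensor A B) (t : tensor U V) :
  memb (tlift f t : ntens A B) = \tsum_(u, v <- t) memb (f u v : ntens A B).
Proof. exact: (lin_tsumE _ _ memb_tlin). Qed.

Lemma mtens_comm (a : multiplier A) (b : multiplier B) :
  mtens a mone *m* mtens mone b = mtens mone b *m* mtens a mone.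
Proof. by rewrite !mtens_mul !mmul1m !mmulm1. Qed.

Lemma bilin_memb (U V : lmodType k) (f : U -> V -> tensor A B) :
  bilin (fun u v => memb (f u v : ntens A B)) -> bilin f.
Proof.
have ml := @memb_linear k (ntens A B).
case=> f1 f2; split=> [u|v] r x y; apply: memb_tinj.
  by have := f1 u r x y => /= ->; rewrite -ml.
by have := f2 v r x y => /= ->; rewrite -ml.
Qed.

End OneSidedMultipliers.

Section Swap.
Variables (k : fieldType) (A B : nalg k).
Notation sw := (@tswap k A B : ntens A B -> ntens B A).

Lemma tswap_mul : {morph sw : s t / s ** t}.
Proof.
have sl := @tswap_linear k A B.
have mb := nmul_bilin (ntens A B); have mb' := nmul_bilin (ntens B A).
apply: eq_bilin => [||a b a' b'].
- by split=> s; [exact: (lin_comp sl (bilin_r s mb)) | exact: (lin_comp sl (bilin_l s mb))].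
- by split=> s; [exact: (lin_comp (bilin_r _ mb') sl) | exact: (lin_comp (bilin_l _ mb') sl)].
rewrite /= ntens_mul_tpure /tswap !tsum_pure; lin.
by rewrite ntens_mul_tpure.
Qed.

Lemma tswap_bij : bijective sw.
Proof. by exists (@tswap k B A); exact: tswapK. Qed.

Let swl : linear sw := @tswap_linear k A B.

Lemma mpush_swE m t : mulL (mpush sw m) (sw t) = sw (mulL m t).
Proof. exact (@mpushE k (ntens A B) (ntens B A) sw swl tswap_mul tswap_bij m t). Qed.

Lemma mpush_sw_mul m n : mpush sw (m *m* n) = mpush sw m *m* mpush sw n.
Proof. exact (@mpush_mul k (ntens A B) (ntens B A) sw swl tswap_mul tswap_bij m n). Qed.

Lemma mpush_sw_memb t : mpush sw (memb t) = memb (sw t).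
Proof. exact (@mpush_memb k (ntens A B) (ntens B A) sw swl tswap_mul tswap_bij t). Qed.

Lemma mpush_sw_inj : injective (mpush sw).
Proof.
move=> m n mn; apply: multiplier_extL => t; apply: (can_inj (@tswapK k A B)).
by have := mpush_swE m t; rewrite mn mpush_swE.
Qed.

Lemma mpush_swap (m : multiplier A) (n : multiplier B) :
  mpush sw (mtens m n) = mtens n m.
Proof.
symmetry; apply (@mpush_ext k (ntens A B) (ntens B A) sw swl tswap_mul tswap_bij) => t.
move: t; apply: tlift_unique.
- exact: (lin_comp (mulL_tlin _) (@tswap_linear k A B)).
- exact: (lin_comp (@tswap_linear k A B) (mulL_tlin _)).
by move=> a b; rewrite /= tmap_tpure; lin; rewrite /tswap !tsum_pure ?tmap_tpure; lin.
Qed.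
End Swap.

Section Comultiplication.
Variables (k : fieldType) (Q : nalg k) (D : Q -> multiplier (ntens Q Q)).
Notation sw := (@tswap k Q Q : ntens Q Q -> ntens Q Q).
Notation Dc := (fun x => mpush sw (D x)).
Hypotheses (HD : mult_hopf D) (HDc : mult_hopf Dc).

(** [cm3] and [cm4] take values in Q (x) Q because the co-opposite of Q is again a
    multiplier Hopf algebra. *)
Definition cm1 (x y : Q) : tensor Q Q := elem (D x *m* mtens mone (memb y)).
Definition cm2 (x y : Q) : tensor Q Q := elem (mtens (memb x) mone *m* D y).
Definition cm3 (x y : Q) : tensor Q Q := elem (D x *m* mtens (memb y) mone).
Definition cm4 (x y : Q) : tensor Q Q := elem (mtens mone (memb x) *m* D y).

Lemma memb_cm1 x y : memb (cm1 x y : ntens Q Q) = D x *m* mtens mone (memb y).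
Proof. exact: elemK (mult_hopf_T1 HD x y). Qed.
Lemma memb_cm2 x y : memb (cm2 x y : ntens Q Q) = mtens (memb x) mone *m* D y.
Proof. exact: elemK (mult_hopf_T2 HD x y). Qed.

Let swl := @tswap_linear k Q Q.

Lemma cm3_push x y : D x *m* mtens (memb y) mone
  = memb (sw (elem (Dc x *m* mtens mone (memb y)))).
Proof.
apply: mpush_sw_inj; rewrite mpush_sw_mul mpush_swap mpush_sw_memb tswapK.
exact/esym/(elemK (mult_hopf_T1 HDc x y)).
Qed.

Lemma cm4_push x y : mtens mone (memb x) *m* D y
  = memb (sw (elem (mtens (memb x) mone *m* Dc y))).
Proof.
apply: mpush_sw_inj; rewrite mpush_sw_mul mpush_swap mpush_sw_memb tswapK.
exact/esym/(elemK (mult_hopf_T2 HDc x y)).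
Qed.

Lemma memb_cm3 x y : memb (cm3 x y : ntens Q Q) = D x *m* mtens (memb y) mone.
Proof. by apply: elemK; rewrite cm3_push; eexists. Qed.
Lemma memb_cm4 x y : memb (cm4 x y : ntens Q Q) = mtens mone (memb x) *m* D y.
Proof. by apply: elemK; rewrite cm4_push; eexists. Qed.

Let Dl : linear D. Proof. by case: (mult_hopf_hom HD). Qed.
Let DM x y : D (x ** y) = D x *m* D y. Proof. by case: (mult_hopf_hom HD). Qed.

Lemma bilin_eqfun (U V W : lmodType k) (f g : U -> V -> W) :
  (forall u v, f u v = g u v) -> bilin g -> bilin f.
Proof. by move=> fg; have -> : f = g by apply/funext => u; apply/funext => v. Qed.

Lemma cm1_bilin : bilin cm1.
Proof. by apply: bilin_memb; apply: (bilin_eqfun memb_cm1); lin. Qed.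
Lemma cm2_bilin : bilin cm2.
Proof. by apply: bilin_memb; apply: (bilin_eqfun memb_cm2); lin. Qed.
Lemma cm3_bilin : bilin cm3.
Proof. by apply: bilin_memb; apply: (bilin_eqfun memb_cm3); lin. Qed.
Lemma cm4_bilin : bilin cm4.
Proof. by apply: bilin_memb; apply: (bilin_eqfun memb_cm4); lin. Qed.

Lemma T1_pure x y : T1 D (x \ox y) = cm1 x y.
Proof. by rewrite /T1 tsum_pure //; exact: cm1_bilin. Qed.
Lemma T2_pure x y : T2 D (x \ox y) = cm2 x y.
Proof. by rewrite /T2 tsum_pure //; exact: cm2_bilin. Qed.

Lemma cm3E x y : cm3 x y = tswap (elem (Dc x *m* mtens mone (memb y))).
Proof. by apply: memb_tinj; rewrite memb_cm3 cm3_push. Qed.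
Lemma cm4E x y : cm4 x y = tswap (elem (mtens (memb x) mone *m* Dc y)).
Proof. by apply: memb_tinj; rewrite memb_cm4 cm4_push. Qed.

Lemma cm1_surj : tsurj cm1.
Proof. by move=> t; have [g _ gK] := mult_hopf_T1_bij HD; exists (g t); rewrite -{1}(gK t). Qed.
Lemma cm2_surj : tsurj cm2.
Proof. by move=> t; have [g _ gK] := mult_hopf_T2_bij HD; exists (g t); rewrite -{1}(gK t). Qed.
Lemma cm3_surj : tsurj cm3.
Proof.
move=> t; have [g _ gK] := mult_hopf_T1_bij HDc; exists (g (tswap t)).
rewrite -{1}(tswapK t) -{1}(gK (tswap t)) (lin_tsumE _ _ swl).
by apply: eq_tsum => x y; rewrite cm3E.
Qed.
Lemma cm4_surj : tsurj cm4.
Proof.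
move=> t; have [g _ gK] := mult_hopf_T2_bij HDc; exists (g (tswap t)).
rewrite -{1}(tswapK t) -{1}(gK (tswap t)) (lin_tsumE _ _ swl).
by apply: eq_tsum => x y; rewrite cm4E.
Qed.

Lemma tsurj_flip (T : Q -> Q -> tensor Q Q) : bilin T -> tsurj T -> tsurj (fun x y => T y x).
Proof. by move=> Tb Ts t; have [s ->] := Ts t; exists (tswap s); rewrite tsum_swapE; lin. Qed.

Lemma cm_13 x y z : cm1 x y |* z = tmap id (fun u => u ** y) (cm3 x z).
Proof.
by apply: memb_tinj; rewrite memb_rm1 memb_rm2 memb_cm1 memb_cm3 -!mmulA mtens_comm.
Qed.
Lemma cm_24 x y z : tmap id (nmul z) (cm2 x y) = x *| cm4 z y.
Proof.
by apply: memb_tinj; rewrite memb_lm2 memb_lm1 memb_cm2 memb_cm4 !mmulA mtens_comm.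
Qed.
Lemma cm_41 x y z w :
  \tsum_(p, q <- cm4 y x) \tsum_(u, v <- cm1 z w) ((p ** u) \ox (q ** v))
    = tmap id (nmul y) (cm1 (x ** z) w).
Proof.
apply: memb_tinj; rewrite memb_lm2 memb_cm1 DM !mmulA -memb_cm4 -mmulA -memb_cm1.
exact: (@memb_mul k (ntens Q Q)).
Qed.
Lemma cm_23' y x z w :
  \tsum_(p, q <- cm2 y x) \tsum_(u, v <- cm3 z w) ((p ** u) \ox (q ** v))
    = y *| cm3 (x ** z) w.
Proof.
apply: memb_tinj; rewrite memb_lm1 memb_cm3 DM !mmulA -memb_cm2 -mmulA -memb_cm3.
exact: (@memb_mul k (ntens Q Q)).
Qed.

Lemma cm_coassoc x y w :
  \tsum_(p, q <- cm1 y w) \tsum_(u, v <- cm2 x p) (u \ox (v \ox q))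
    = \tsum_(r, s <- cm2 x y) \tsum_(v, q <- cm1 s w) (r \ox (v \ox q)).
Proof.
have T1b := cm1_bilin; have T2b := cm2_bilin.
have T1l : linear (T1 D) by exact: (tlift_linear T1b).
have T2l : linear (T2 D) by exact: (tlift_linear T2b).
have := congr1 (@tassoc k Q Q Q) (mult_hopf_coassoc HD ((x \ox y) \ox w)).
have al : linear (@tassoc k Q Q Q) by rewrite /tassoc; lin.
have il : linear (@tassoc_inv k Q Q Q) by rewrite /tassoc_inv; lin.
have ap u v q : @tassoc k Q Q Q ((u \ox v) \ox q) = u \ox (v \ox q).
  by rewrite /tassoc !tsum_pure; lin.
have ip u v q : @tassoc_inv k Q Q Q (u \ox (v \ox q)) = (u \ox v) \ox q.
  by rewrite /tassoc_inv !tsum_pure; lin.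
rewrite ap !tmap_tpure; lin; rewrite T1_pure T2_pure => h.
have e1 : x \ox cm1 y w = \tsum_(p, q <- cm1 y w) (x \ox (p \ox q)).
  by rewrite -{1}[cm1 y w]tsum_eta (lin_tsumE (F := tpure x)); lin.
have idl := @lin_idfun k Q.
rewrite e1 (lin_tsumE _ _ il) (tmap_tsum _ _ T2l idl) (lin_tsumE _ _ al) in h.
transitivity (\tsum_(p, q <- cm1 y w)
   @tassoc k Q Q Q (tmap (T2 D) id (@tassoc_inv k Q Q Q (x \ox (p \ox q))))).
  apply: eq_tsum => p q; rewrite ip tmap_tpure; lin; rewrite T2_pure.
  rewrite -[cm2 x p in RHS]tsum_eta (lin_tsumE (F := fun r => r \ox q)); lin.
  by rewrite (lin_tsumE _ _ al); apply: eq_tsum => u v; rewrite ap.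
have e2 : tassoc (cm2 x y \ox w) = \tsum_(r, s <- cm2 x y) (r \ox (s \ox w)).
  rewrite -{1}[cm2 x y]tsum_eta (lin_tsumE (F := fun r => r \ox w)); lin.
  by rewrite (lin_tsumE _ _ al); apply: eq_tsum => r s; rewrite ap.
have e3 : tmap id (T1 D) (tassoc (cm2 x y \ox w))
    = \tsum_(r, s <- cm2 x y) (r \ox cm1 s w).
  rewrite e2 tmap_tsum; lin; apply: eq_tsum => r s.
  by rewrite tmap_tpure; lin; rewrite T1_pure.
rewrite h e3 (lin_tsumE _ _ il) (lin_tsumE _ _ al); apply: eq_tsum => r s.
rewrite -[cm1 s w in LHS]tsum_eta (lin_tsumE (F := tpure r)); lin.
rewrite (lin_tsumE _ _ il) (lin_tsumE _ _ al).
by apply: eq_tsum => v q; rewrite ip ap.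
Qed.
End Comultiplication.

(** * The antipode *)

Section Antipode.
Variables (k : fieldType) (Q : nalg k) (D : Q -> multiplier (ntens Q Q)).
Notation sw := (@tswap k Q Q : ntens Q Q -> ntens Q Q).
Hypotheses (HD : mult_hopf D) (HDc : mult_hopf (fun x => mpush sw (D x))).
Variables S Sinv : Q -> Q.
Hypothesis SP : antipode D (fun x => memb (S x)).
Hypotheses (SK : cancel S Sinv) (SinvK : cancel Sinv S).

Notation c1 := (cm1 D).
Notation c2 := (cm2 D).
Notation c3 := (cm3 D).
Notation c4 := (cm4 D).

Lemma antipode_lin : linear S.
Proof.
move=> r x y; apply: memb_inj; have := antipode_linear SP r x y => /= ->.
by rewrite -(@memb_linear k Q).
Qed.

Lemma antipode_inv_lin : linear Sinv.
Proof.
by move=> r x y; apply: (can_inj SK); rewrite antipode_lin !SinvK.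
Qed.

Lemma antipode_mul x y : S (x ** y) = S y ** S x.
Proof. by apply: memb_inj; rewrite (antipodeM SP) memb_mul. Qed.

Let Sl := antipode_lin.
Let Sil := antipode_inv_lin.
Let SiM := @SinvM k Q S Sinv antipode_mul SK SinvK.

Lemma nmul_cancell (x y : Q) : (forall z, z ** x = z ** y) -> x = y.
Proof. exact: (lunital_cancel (lunital_nmul Q)). Qed.

Lemma nmul_cancelr (x y : Q) : (forall z, x ** z = y ** z) -> x = y.
Proof. exact: (lunital_cancel (lunital_nmulr Q)). Qed.

Lemma antipode_counit : exists eps : Q -> k,
  [/\ counit D eps,
      forall x y, \tsum_(u, v <- c1 x y) (S u ** v) = eps x *: y
    & forall x y, \tsum_(u, v <- c2 x y) (u ** S v) = eps y *: x].
Proof.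
have [eps epsP h] := antipodeE SP; exists eps; split=> // x y.
  by have [<- _] := h x y; rewrite (T1_pure HD).
by have [_ <-] := h x y; rewrite (T2_pure HD).
Qed.

Section Counit.
Variable eps : Q -> k.
Hypothesis epsP : counit D eps.
Hypothesis S1 : forall x y, \tsum_(u, v <- c1 x y) (S u ** v) = eps x *: y.
Hypothesis S2 : forall x y, \tsum_(u, v <- c2 x y) (u ** S v) = eps y *: x.

Lemma counit_c1 x y : \tsum_(u, v <- c1 x y) (eps u *: v) = x ** y.
Proof. by rewrite -(counit_l epsP) (T1_pure HD). Qed.
Lemma counit_c2 x y : \tsum_(u, v <- c2 x y) (eps v *: u) = x ** y.
Proof. by rewrite -(counit_r epsP) (T2_pure HD). Qed.

(** If eps vanishes then so do all products, by the counit axiom. *)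
Lemma counit_one : (exists u, eps u = 1) \/ forall x : Q, x = 0.
Proof.
have [[u eu]|ne] := pselect (exists u, eps u != 0).
  left; exists ((eps u)^-1 *: u).
  have el : linear (eps : Q -> k^o) := counit_linear epsP.
  by rewrite (linPZ el) /GRing.scale /= mulVf.
right=> x; apply: nmul_nondegl => y; rewrite -counit_c1.
rewrite /tlift /sum_of big1 // => p _.
have [->|e0] := eqVneq (eps p.1) 0; first by rewrite scale0r.
by case: ne; exists p.1.
Qed.

(** After multiplication by z on the left this follows from the antipode axiom for
    (z (x) 1)Delta(x); then z is cancelled. *)
Lemma antipode_c4' x y : \tsum_(u, v <- c4 y x) (u ** S v) = eps x *: S y.
Proof.
have Ql := (nmul_bilin Q).1; apply: nmul_cancell => z.
have := cm_24 HD HDc z x y.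
move/(congr1 (fun t => \tsum_(u, v <- t) (u ** S v))).
rewrite !tsum_map; lin => h.
rewrite lin_tsumE; lin.
under eq_tsum => u v do rewrite nmulA.
rewrite -h (linPZ (Ql z)).
under eq_tsum => u v do rewrite antipode_mul nmulA.
rewrite -(lin_tsumE (F := fun w => w ** S y)); lin.
by rewrite S2 (linPZ ((nmul_bilin Q).2 _)).
Qed.

Lemma antipode_c4 x y : \tsum_(u, v <- c4 y x) (v ** Sinv u) = eps x *: y.
Proof.
have := congr1 Sinv (antipode_c4' x y).
rewrite (linPZ Sil) SK => <-; rewrite (lin_tsumE _ _ Sil).
by apply: eq_tsum => u v; rewrite SiM SK.
Qed.

Lemma antipode_c3 x y : \tsum_(u, v <- c3 x y) (Sinv v ** u) = eps x *: y.
Proof.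
have Ql := (nmul_bilin Q).2.
have h3 : \tsum_(u, v <- c3 x y) (S u ** v) = eps x *: S y.
  apply: nmul_cancelr => z.
  have := cm_13 HD HDc x z y.
  move/(congr1 (fun t => \tsum_(u, v <- t) (S u ** v))).
  rewrite !tsum_map; lin => h.
  rewrite (lin_tsumE (F := fun w => w ** z)); lin.
  under eq_tsum => u v do rewrite -nmulA.
  rewrite -h (linPZ (Ql z)).
  under eq_tsum => u v do rewrite antipode_mul -nmulA.
  rewrite -(lin_tsumE (F := fun w => S y ** w)); lin.
  by rewrite S1 (linPZ ((nmul_bilin Q).1 _)).
have := congr1 Sinv h3.
rewrite (linPZ Sil) SK => <-; rewrite (lin_tsumE _ _ Sil).
by apply: eq_tsum => u v; rewrite SiM SK.
Qed.

End Counit.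
End Antipode.

(** * Coactions by multipliers *)

Section Assoc.
Variables (k : fieldType) (A B C : nalg k).
Notation assoc := (@tassoc k A B C : ntens (ntens A B) C -> ntens A (ntens B C)).

Lemma tassoc_lin (U V W : lmodType k) : linear (@tassoc k U V W).
Proof. by rewrite /tassoc; lin. Qed.

Lemma tassoc_inv_lin (U V W : lmodType k) : linear (@tassoc_inv k U V W).
Proof. by rewrite /tassoc_inv; lin. Qed.

Lemma tassoc_pure (U V W : lmodType k) (u : U) (v : V) (w : W) :
  tassoc ((u \ox v) \ox w) = u \ox (v \ox w).
Proof. by rewrite /tassoc !tsum_pure; lin. Qed.

Lemma tassoc_inv_pure (U V W : lmodType k) (u : U) (v : V) (w : W) :
  tassoc_inv (u \ox (v \ox w)) = (u \ox v) \ox w.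
Proof. by rewrite /tassoc_inv !tsum_pure; lin. Qed.

Lemma eq_lin3 (U V W X : lmodType k) (F G : tensor (tensor U V) W -> X) :
  linear F -> linear G ->
  (forall u v w, F ((u \ox v) \ox w) = G ((u \ox v) \ox w)) -> F =1 G.
Proof.
move=> Fl Gl h; apply: tlift_unique => // s w.
by move: s; apply: tlift_unique => //; lin.
Qed.

Lemma eq_lin3' (U V W X : lmodType k) (F G : tensor U (tensor V W) -> X) :
  linear F -> linear G ->
  (forall u v w, F (u \ox (v \ox w)) = G (u \ox (v \ox w))) -> F =1 G.
Proof.
move=> Fl Gl h; apply: tlift_unique => // u s.
by move: s; apply: tlift_unique => //; lin.
Qed.

Lemma tassoc_bij : bijective assoc.
Proof.
exists (@tassoc_inv k A B C).
  by apply: eq_lin3 => *; lin; rewrite tassoc_pure tassoc_inv_pure.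
by apply: eq_lin3' => *; lin; rewrite tassoc_inv_pure tassoc_pure.
Qed.

Lemma ntens_bil (P R : nalg k) : bilin (fun s t : tensor P R => (s : ntens P R) ** t : tensor P R).
Proof. exact (nmul_bilin (ntens P R)). Qed.

Lemma tassoc_mul : {morph assoc : s t / s ** t}.
Proof.
have al := @tassoc_lin A B C.
have m1 := @ntens_bil (ntens A B) C; have m2 := @ntens_bil A (ntens B C).
move=> s t; move: s; apply: eq_lin3 => [||a b x].
- exact: (lin_comp al (bilin_l _ m1)).
- exact: (lin_comp (bilin_l (assoc t) m2) al).
move: t; apply: eq_lin3 => [||a' b' x'].
- exact: (lin_comp al (bilin_r _ m1)).
- exact: (lin_comp (bilin_r _ m2) al).
by rewrite /= !tassoc_pure !ntens_mul_tpure /= ntens_mul_tpure tassoc_pure ntens_mul_tpure.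
Qed.

Lemma mpush_assocE m t : mulL (mpush assoc m) (assoc t) = assoc (mulL m t).
Proof.
exact (@mpushE k _ _ assoc (@tassoc_lin A B C) tassoc_mul tassoc_bij m t).
Qed.

Lemma mpush_assoc_mul m n : mpush assoc (m *m* n) = mpush assoc m *m* mpush assoc n.
Proof.
exact (@mpush_mul k _ _ assoc (@tassoc_lin A B C) tassoc_mul tassoc_bij m n).
Qed.

Lemma mpush_assoc_memb t : mpush assoc (memb t) = memb (assoc t).
Proof.
exact (@mpush_memb k _ _ assoc (@tassoc_lin A B C) tassoc_mul tassoc_bij t).
Qed.

Lemma mpush_assoc_lin : linear (mpush assoc).
Proof.
exact (@mpush_linear k _ _ assoc (@tassoc_lin A B C) tassoc_mul tassoc_bij).
Qed.

Lemma mpush_assoc_mtens m n p : mpush assoc (mtens (mtens m n) p) = mtens m (mtens n p).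
Proof.
symmetry; apply (@mpush_ext k _ _ assoc (@tassoc_lin A B C) tassoc_mul tassoc_bij) => t.
have al := @tassoc_lin A B C.
move: t; apply: eq_lin3.
- exact (lin_comp (@mulL_tlin k A (ntens B C) _) al).
- exact (lin_comp al (@mulL_tlin k (ntens A B) C _)).
by move=> a b x; rewrite tassoc_pure !mtens_pure tassoc_pure.
Qed.
End Assoc.

Section LeftCoaction.
Variables (k : fieldType) (Q A : nalg k) (D : Q -> multiplier (ntens Q Q)).
Variable G : A -> multiplier (ntens Q A).
Hypothesis GP : left_comodule_algebra D G.

Definition lcov (a : A) (x : Q) : tensor Q A := lcoact_cov G a x.
Definition lcovl (x : Q) (a : A) : tensor Q A := elem (mtens (memb x) mone *m* G a).

Lemma memb_lcov a x : memb (lcov a x : ntens Q A) = G a *m* mtens (memb x) mone.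
Proof. exact: elemK (lcoact_in_r GP a x). Qed.
Lemma memb_lcovl x a : memb (lcovl x a : ntens Q A) = mtens (memb x) mone *m* G a.
Proof. exact: elemK (lcoact_in_l GP a x). Qed.

Let Gl : linear G. Proof. by case: (lcoact_hom GP). Qed.
Let GM a b : G (a ** b) = G a *m* G b. Proof. by case: (lcoact_hom GP). Qed.

Lemma lcov_bilin : bilin lcov.
Proof. by apply: bilin_memb; apply: (bilin_eqfun memb_lcov); lin. Qed.
Lemma lcovl_bilin : bilin lcovl.
Proof. by apply: bilin_memb; apply: (bilin_eqfun memb_lcovl); lin. Qed.

Lemma mtens_mul1 (x y : Q) :
  mtens (memb (x ** y)) (@mone k A) = mtens (memb x) mone *m* mtens (memb y) mone.
Proof. by rewrite mtens_mul mmul1m memb_mul. Qed.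

Lemma lcov_covered : covered lcov lcovl.
Proof.
split; first exact: lcov_bilin.
- exact: lcovl_bilin.
- by move=> a x y; apply: memb_tinj; rewrite memb_rm1 !memb_lcov mtens_mul1 mmulA.
- by move=> a x y; apply: memb_tinj; rewrite memb_lm1 !memb_lcovl mtens_mul1 mmulA.
by move=> a x y; apply: memb_tinj; rewrite memb_lm1 memb_rm1 memb_lcov memb_lcovl mmulA.
Qed.

Lemma mulL_lcoact a x b : mulL (G a) (x \ox b) = tmap id (fun a0 => a0 ** b) (lcov a x).
Proof.
apply: memb_tinj; rewrite memb_rm2 memb_lcov -mmulA mtens_mul mmulm1 mmul1m mtens_memb.
exact: (@memb_mulL k (ntens Q A)).
Qed.

Lemma lcov_mul a b x :
  lcov (a ** b) x
    = \tsum_(y, b0 <- lcov b x) \tsum_(z, a0 <- lcov a y) (z \ox (a0 ** b0)).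
Proof.
apply: memb_tinj; rewrite memb_lcov GM -mmulA -memb_lcov.
rewrite -(@memb_mulL k (ntens Q A)) -[lcov b x in LHS]tsum_eta.
rewrite (lin_tsumE _ _ (@mulL_tlin k Q A (G a))).
by congr memb; apply: eq_tsum => y b0; rewrite mulL_lcoact tmapE.
Qed.

Lemma lcov_inj a : (forall z, lcov a z = 0) -> a = 0.
Proof.
move=> h; apply: (lcoact_inj GP); rewrite (linP0 Gl).
apply: eq_multiplier2 => x b; rewrite mulL_lcoact h.
by rewrite (linP0 (tmap_linear (@lin_idfun k Q) (bilin_l b (nmul_bilin A)))).
Qed.

Hypothesis HD : mult_hopf D.

(** Both sides are X(Delta(x)(1 (x) y) (x) 1) for the iterated coaction X, by its two
    descriptions. *)
Lemma lcov_coassoc : coassocr (cm1 D) lcov.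
Proof.
move=> a x y; have [X XE] := lcoact_coassoc GP a.
have mb3 := @mmul_bilin k (ntens Q (ntens Q A)).
pose one (v : Q) : multiplier (ntens Q (ntens Q A)) := mtens mone (mtens (memb v) mone).
have cutX u v : X *m* mtens (memb u) mone *m* one v
   = memb (\tsum_(z, b <- lcov a u) (z \ox lcov b v) : ntens Q (ntens Q A)).
  have [-> _] := XE u.
  rewrite (lin_tsumE (F := fun m => m *m* one v)); last exact: (bilin_l _ mb3).
  rewrite (memb_tsum (A := Q) (B := ntens Q A)); apply: eq_tsum => z b.
  by rewrite mtens_mul mmulm1 -memb_lcov mtens_memb.
pose as3 := @tassoc k Q Q A : ntens (ntens Q Q) A -> ntens Q (ntens Q A).
pose E1 : multiplier (ntens Q (ntens Q A)) :=
  X *m* mpush as3 (mtens (memb (cm1 D x y : ntens Q Q)) mone).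
have pl := @mpush_assoc_lin k Q Q A; rewrite -/as3 in pl.
apply: (@memb_tinj k Q (ntens Q A)); transitivity E1.
  rewrite /E1 -[cm1 D x y in RHS]tsum_eta memb_tsum.
  rewrite (lin_tsumE (F := fun m => mtens m mone));
    last exact: (bilin_l _ (@mtens_bilin k (ntens Q Q) A)).
  rewrite (lin_tsumE _ _ pl) (lin_tsumE _ _ (bilin_r X mb3)).
  rewrite (memb_tsum (A := Q) (B := ntens Q A)); apply: eq_tsum => u v.
  rewrite -mtens_memb /as3 mpush_assoc_mtens -cutX -mmulA.
  by rewrite mtens_mul mmulm1 mmul1m.
have [_ /= eqX] := XE x; rewrite -/as3 in eqX.
have -> : E1 = X *m* mpush as3 (mtens (D x) mone)
    *m* mpush as3 (mtens (mtens mone (memb y)) mone).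
  by rewrite -mmulA -mpush_assoc_mul mtens_mul mmul1m -(memb_cm1 HD).
rewrite eqX -mpush_assoc_mul.
rewrite (lin_tsumE (F := fun m => m *m* mtens (mtens mone (memb y)) mone)); last first.
  exact: (bilin_l _ (@mmul_bilin k (ntens (ntens Q Q) A))).
rewrite (lin_tsumE _ _ pl) (memb_tsum (A := Q) (B := ntens Q A)); apply: eq_tsum => z b.
rewrite mtens_mul mmulm1 -(memb_cm1 HD) mtens_memb mpush_assoc_memb.
rewrite -[cm1 D z y in LHS]tsum_eta (lin_tsumE (F := fun t => t \ox b)); lin.
rewrite (lin_tsumE _ _ (@tassoc_lin k Q Q A)); congr memb.
by apply: eq_tsum => u v; rewrite tassoc_pure.
Qed.
End LeftCoaction.

Section RightCoaction.
Variables (k : fieldType) (Q A : nalg k) (D : Q -> multiplier (ntens Q Q)).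
Variable U : A -> multiplier (ntens A Q).
Hypothesis UP : right_comodule_algebra D U.

Definition rcov (a : A) (x : Q) : tensor A Q := rcoact_cov U a x.
Definition rcovl (x : Q) (a : A) : tensor A Q := rcoact_covl U x a.

(** The right coaction as a left coaction of the co-opposite of Q *)
Definition fcov (a : A) (x : Q) : tensor Q A := tswap (rcov a x).
Definition fcovl (x : Q) (a : A) : tensor Q A := tswap (rcovl x a).

Lemma fcovE a x : fcov a x = tswap (rcov a x). Proof. by []. Qed.
Lemma memb_rcov a x : memb (rcov a x : ntens A Q) = U a *m* mtens mone (memb x).
Proof. exact: elemK (rcoact_in_r UP a x). Qed.
Lemma memb_rcovl x a : memb (rcovl x a : ntens A Q) = mtens mone (memb x) *m* U a.
Proof. exact: elemK (rcoact_in_l UP a x). Qed.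

Let Ul : linear U. Proof. by case: (rcoact_hom UP). Qed.
Let UM a b : U (a ** b) = U a *m* U b. Proof. by case: (rcoact_hom UP). Qed.

Lemma rcov_bilin : bilin rcov.
Proof. by apply: bilin_memb; apply: (bilin_eqfun memb_rcov); lin. Qed.
Lemma rcovl_bilin : bilin rcovl.
Proof. by apply: bilin_memb; apply: (bilin_eqfun memb_rcovl); lin. Qed.

Lemma mtens_mul2 (x y : Q) :
  mtens (@mone k A) (memb (x ** y)) = mtens mone (memb x) *m* mtens mone (memb y).
Proof. by rewrite mtens_mul mmul1m memb_mul. Qed.

Lemma tswap_map (V W V' W' : lmodType k) (f : V -> V') (g : W -> W') t :
  linear f -> linear g -> tswap (tmap f g t) = tmap g f (tswap t).
Proof.
move=> fl gl; rewrite {2}/tswap tmap_tsum // tmapE lin_tsumE; last exact: tswap_linear.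
by apply: eq_tsum => v w; rewrite tmap_tpure // /tswap tsum_pure; lin.
Qed.

Lemma fcov_covered : covered fcov fcovl.
Proof.
have b1 := rcov_bilin; have b2 := rcovl_bilin.
split; first by rewrite /fcov; lin.
- by rewrite /fcovl; lin.
- move=> a x y; rewrite /fcov -tswap_map; lin; congr tswap.
  by apply: memb_tinj; rewrite memb_rm2 !memb_rcov mtens_mul2 mmulA.
- move=> a x y; rewrite /fcovl -tswap_map; lin; congr tswap.
  by apply: memb_tinj; rewrite memb_lm2 !memb_rcovl mtens_mul2 mmulA.
move=> a x y; rewrite /fcov /fcovl -!tswap_map; lin; congr tswap.
by apply: memb_tinj; rewrite memb_lm2 memb_rm2 memb_rcov memb_rcovl mmulA.
Qed.

Lemma mulL_rcoact a x b : mulL (U a) (b \ox x) = tmap (fun a0 => a0 ** b) id (rcov a x).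
Proof.
apply: memb_tinj; rewrite memb_rm1 memb_rcov -mmulA mtens_mul mmulm1 mmul1m mtens_memb.
exact: (@memb_mulL k (ntens A Q)).
Qed.

Lemma mulR_rcoact a x b : mulR (U a) (b \ox x) = tmap (nmul b) id (rcovl x a).
Proof.
apply: memb_tinj; rewrite memb_lm1 memb_rcovl mmulA mtens_mul mmulm1 mmul1m mtens_memb.
exact: (@memb_mulR k (ntens A Q)).
Qed.

Lemma mulR_tlin (m : multiplier (ntens A Q)) :
  linear (mulR m : tensor A Q -> tensor A Q).
Proof. exact (@mulR_linear k (ntens A Q) m). Qed.

Lemma rcovl_mul a b x :
  rcovl x (a ** b)
    = \tsum_(a0, y <- rcovl x a) \tsum_(b0, z <- rcovl y b) ((a0 ** b0) \ox z).
Proof.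
apply: memb_tinj; rewrite memb_rcovl UM mmulA -memb_rcovl.
rewrite -(@memb_mulR k (ntens A Q)) -[rcovl x a in LHS]tsum_eta.
rewrite (lin_tsumE _ _ (mulR_tlin (U b))).
by congr memb; apply: eq_tsum => y b0; rewrite mulR_rcoact tmapE.
Qed.

Lemma rcov_mul a b x :
  rcov (a ** b) x
    = \tsum_(b0, y <- rcov b x) \tsum_(a0, z <- rcov a y) ((a0 ** b0) \ox z).
Proof.
apply: memb_tinj; rewrite memb_rcov UM -mmulA -memb_rcov.
rewrite -(@memb_mulL k (ntens A Q)) -[rcov b x in LHS]tsum_eta.
rewrite (lin_tsumE _ _ (@mulL_tlin k A Q (U a))).
by congr memb; apply: eq_tsum => y b0; rewrite mulL_rcoact tmapE.
Qed.

Lemma fcovl_mul a b x :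
  fcovl x (a ** b)
    = \tsum_(y, a0 <- fcovl x a) \tsum_(z, b0 <- fcovl y b) (z \ox (a0 ** b0)).
Proof.
have b2 := rcovl_bilin.
rewrite /fcovl tsum_swapE; lin; rewrite rcovl_mul lin_tsumE; lin.
apply: eq_tsum => a0 y; rewrite tsum_swapE ?lin_tsumE; lin.
by apply: eq_tsum => b0 z; rewrite /tswap tsum_pure; lin.
Qed.

Lemma rcovl_inj a : (forall z, fcovl z a = 0) -> a = 0.
Proof.
move=> h; apply: (rcoact_inj UP); rewrite (linP0 Ul).
have h' z : rcovl z a = 0.
  by apply: (can_inj (@tswapK k A Q)); rewrite -/(fcovl z a) h (linP0 (@tswap_linear k A Q)).
have R0 t : mulR (U a) t = 0.
  move: t; apply: tlift_unique.
  - exact: mulR_tlin.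
  - by move=> r x y; rewrite scaler0 addr0.
  move=> b x; rewrite mulR_rcoact h'.
  by rewrite (linP0 (tmap_linear (bilin_r b (nmul_bilin A)) (@lin_idfun k Q))).
apply: multiplier_extL => t; apply: nmul_nondegr => s.
rewrite -mulRL R0 (linP0 (bilin_l t (nmul_bilin (ntens A Q)))).
by [].
Qed.
End RightCoaction.

Section MultiplierCoassociativity.
Variables (k : fieldType) (Q A : nalg k) (D : Q -> multiplier (ntens Q Q)).
Variable G : A -> multiplier (ntens Q A).
Variable U : A -> multiplier (ntens A Q).
Hypotheses (HD : mult_hopf D)
  (HDc : mult_hopf (fun x => mpush (@tswap k Q Q : ntens Q Q -> ntens Q Q) (D x))).
Hypotheses (GP : left_comodule_algebra D G) (UP : right_comodule_algebra D U).

Notation rcov := (rcov U).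
Notation fcov := (fcov U).
Notation lcov := (lcov G).

(** Both sides are X(1 (x) Delta(x)(y (x) 1)) for the iterated coaction X; the cover y
    is on the leg that the second application of the coaction produces. *)
Lemma rcov_coassoc3 a x y :
  \tsum_(v, u <- cm3 D x y) \tsum_(b, z <- rcov a u) tassoc (rcov b v \ox z)
    = \tsum_(b, z <- rcov a x) (b \ox cm3 D z y).
Proof.
have [X XE] := rcoact_coassoc UP a.
have mb3 := @mmul_bilin k (ntens A (ntens Q Q)).
have mt3 := @mtens_bilin k A (ntens Q Q).
have pl := @mpush_assoc_lin k A Q Q.
pose one (v : Q) : multiplier (ntens A (ntens Q Q)) := mtens mone (mtens (memb v) mone).
have cutX u v : X *m* mtens mone (mtens mone (memb u)) *m* one v
   = memb (\tsum_(b, z <- rcov a u) tassoc (rcov b v \ox z) : ntens A (ntens Q Q)).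
  have [-> _] := XE u.
  rewrite /one -mpush_assoc_mtens -mpush_assoc_mul.
  rewrite (lin_tsumE (F := fun m => m *m* mtens (mtens mone (memb v)) mone)); last first.
    exact: (bilin_l _ (@mmul_bilin k (ntens (ntens A Q) Q))).
  rewrite (lin_tsumE _ _ pl) (memb_tsum (A := A) (B := ntens Q Q)); apply: eq_tsum => b z.
  by rewrite mtens_mul mmulm1 -(memb_rcov UP) mtens_memb mpush_assoc_memb.
apply: (@memb_tinj k A (ntens Q Q)).
transitivity (X *m* mtens mone (memb (cm3 D x y : ntens Q Q))).
  rewrite -[cm3 D x y in RHS]tsum_eta memb_tsum.
  rewrite (lin_tsumE (F := mtens mone)); last exact: (bilin_r _ mt3).
  rewrite (lin_tsumE _ _ (bilin_r X mb3)).
  rewrite (memb_tsum (A := A) (B := ntens Q Q)); apply: eq_tsum => v u.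
  by rewrite -cutX -mtens_memb -mmulA !mtens_mul !mmul1m mmulm1.
rewrite (memb_cm3 HDc) -[mone in LHS]mmul1m -mtens_mul mmulA.
have [_ ->] := XE x.
rewrite (lin_tsumE (F := fun m => m *m* one y)); last exact: (bilin_l _ mb3).
rewrite (memb_tsum (A := A) (B := ntens Q Q)); apply: eq_tsum => b z.
by rewrite mtens_mul mmulm1 -(memb_cm3 HDc) mtens_memb.
Qed.

Lemma fcov_coassoc : coassocr (fun x y => tswap (cm3 D x y)) fcov.
Proof.
move=> a x y.
have b3 := cm3_bilin HD HDc.
have fb := cov_bilin (fcov_covered UP).
pose Psi (t : tensor A (tensor Q Q)) : tensor Q (tensor Q A) :=
  \tsum_(b, r <- t) \tsum_(v, u <- r) (u \ox (v \ox b)).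
have Psil : linear Psi by rewrite /Psi; lin.
have := congr1 Psi (rcov_coassoc3 a x y); rewrite !(lin_tsumE _ _ Psil) => h.
rewrite tsum_swapE; last by lin.
transitivity (\tsum_(v, u <- cm3 D x y) Psi (\tsum_(b, z <- rcov a u) tassoc (rcov b v \ox z))).
  apply: eq_tsum => v u; rewrite (lin_tsumE _ _ Psil) {1}fcovE tsum_swapE; lin.
  apply: eq_tsum => b z.
  rewrite -[rcov b v in RHS]tsum_eta (lin_tsumE (F := fun t => t \ox z)); lin.
  rewrite (lin_tsumE _ _ (@tassoc_lin k A Q Q)) (lin_tsumE _ _ Psil).
  rewrite !fcovE /tswap (lin_tsumE (F := tpure z)); lin.
  by apply: eq_tsum => b' w; rewrite tassoc_pure /Psi !tsum_pure; lin.
rewrite h [fcov a x]fcovE tsum_swapE; last by lin.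
apply: eq_tsum => b z; rewrite /Psi tsum_pure; lin.
by rewrite tsum_swapE; lin.
Qed.

(** Both sides are X(x (x) 1 (x) y) for the multiplier X = (id (x) U)G(a). *)
Lemma cocommute_lr : bicomodule_algebra D G U -> cocommute lcov fcov.
Proof.
move=> BP a x y; have [X XE] := bicomodule_compat BP a.
have lb := lcov_bilin GP.
have mb3 := @mmul_bilin k (ntens Q (ntens A Q)).
have pl := @mpush_assoc_lin k Q A Q.
have [E1 _] := XE x; have [_ E2] := XE y.
have key : \tsum_(z, b <- lcov a x) (z \ox rcov b y)
    = \tsum_(b, w <- rcov a y) tassoc (lcov b x \ox w).
  apply: (@memb_tinj k Q (ntens A Q)).
  transitivity (X *m* mtens (memb x) mone *m* mtens mone (mtens mone (memb y))).
    rewrite E1 (lin_tsumE (F := fun m => m *m* mtens mone (mtens mone (memb y)))); last first.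
      exact: (bilin_l _ mb3).
    rewrite (memb_tsum (A := Q) (B := ntens A Q)); apply: eq_tsum => z b.
    by rewrite mtens_mul mmulm1 -(memb_rcov UP) mtens_memb.
  rewrite -mmulA mtens_comm mmulA E2.
  rewrite -(@mtens1 k A Q) -mpush_assoc_mtens -mpush_assoc_mul.
  rewrite (lin_tsumE (F := fun m => m *m* mtens (mtens (memb x) mone) mone)); last first.
    exact: (bilin_l _ (@mmul_bilin k (ntens (ntens Q A) Q))).
  rewrite (lin_tsumE _ _ pl) (memb_tsum (A := Q) (B := ntens A Q)); apply: eq_tsum => b w.
  by rewrite mtens_mul mmulm1 -(memb_lcov GP) mtens_memb mpush_assoc_memb.
pose Psi (t : tensor Q (tensor A Q)) := tmap id (@tswap k A Q) t.
have Psil : linear Psi by apply: tmap_linear; lin.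
have := congr1 Psi key; rewrite !(lin_tsumE _ _ Psil) => h.
transitivity (\tsum_(z, b <- lcov a x) Psi (z \ox rcov b y)).
  by apply: eq_tsum => z b; rewrite /Psi tmap_tpure; lin.
rewrite h [fcov a y]fcovE tsum_swapE; last by lin.
apply: eq_tsum => b w; rewrite -[lcov b x in LHS]tsum_eta (lin_tsumE (F := fun t => t \ox w)); lin.
rewrite (lin_tsumE _ _ (@tassoc_lin k Q A Q)) (lin_tsumE _ _ Psil).
apply: eq_tsum => u b'; rewrite tassoc_pure /Psi tmap_tpure; lin.
by rewrite /tswap tsum_pure; lin.
Qed.
End MultiplierCoassociativity.

(** * Opposite and tensor product of multiplier Hopf algebras *)

Lemma mult_hopf_intro (k : fieldType) (Q : nalg k) (D : Q -> multiplier (ntens Q Q))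
    (t1 t2 : Q -> Q -> tensor Q Q) :
  mhom D ->
  (forall x y, memb (t1 x y : ntens Q Q) = D x *m* mtens mone (memb y)) ->
  (forall x y, memb (t2 x y : ntens Q Q) = mtens (memb x) mone *m* D y) ->
  (forall x y w,
    \tsum_(p, q <- t1 y w) \tsum_(u, v <- t2 x p) (u \ox (v \ox q))
      = \tsum_(r, s <- t2 x y) \tsum_(v, q <- t1 s w) (r \ox (v \ox q))) ->
  bijective (tlift t1) -> bijective (tlift t2) -> mult_hopf D.
Proof.
move=> Dh m1 m2 co bj1 bj2; have [Dl DM] := Dh.
have e1 x y : elem (D x *m* mtens mone (memb y)) = t1 x y by exact: elemE.
have e2 x y : elem (mtens (memb x) mone *m* D y) = t2 x y by exact: elemE.
have T1E : T1 D = tlift t1 by apply/funext => t; apply: eq_tsum.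
have T2E : T2 D = tlift t2 by apply/funext => t; apply: eq_tsum.
have b1 : bilin t1 by apply: bilin_memb; apply: (bilin_eqfun m1); lin.
have b2 : bilin t2 by apply: bilin_memb; apply: (bilin_eqfun m2); lin.
split=> //; try by rewrite ?T1E ?T2E.
- by move=> x y; exists (t1 x y).
- by move=> x y; exists (t2 x y).
have l1 : linear (T1 D) by rewrite T1E; lin.
have l2 : linear (T2 D) by rewrite T2E; lin.
have al := @tassoc_lin k Q Q Q; have il := @tassoc_inv_lin k Q Q Q.
apply: eq_lin3.
- by lin.
- by lin.
move=> x y w; rewrite tassoc_pure !tmap_tpure; lin.
rewrite T1E T2E (tsum_pure _ _ b1) (tsum_pure _ _ b2).
have h := congr1 (@tassoc_inv k Q Q Q) (co x y w).
rewrite !(lin_tsumE _ _ il) in h.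
transitivity (\tsum_(p, q <- t1 y w) tassoc_inv (\tsum_(u, v <- t2 x p) (u \ox (v \ox q)))).
  rewrite -[t1 y w in LHS]tsum_eta (lin_tsumE (F := tpure x)); lin.
  rewrite (lin_tsumE _ _ il) tmap_tsum -?T2E; lin; apply: eq_tsum => p q.
  rewrite tassoc_inv_pure tmap_tpure -?T2E; lin; rewrite T2E (tsum_pure _ _ b2).
  rewrite -[t2 x p in LHS]tsum_eta (lin_tsumE (F := fun t => t \ox q)); lin.
  by rewrite (lin_tsumE _ _ il); apply: eq_tsum => u v; rewrite tassoc_inv_pure.
rewrite h.
have e3 : tmap id (tlift t1) (tassoc (t2 x y \ox w)) = \tsum_(r, s <- t2 x y) (r \ox t1 s w).
  rewrite -{1}[t2 x y]tsum_eta (lin_tsumE (F := fun t => t \ox w)); lin.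
  rewrite (lin_tsumE _ _ al) tmap_tsum -?T1E; lin; apply: eq_tsum => r s.
  by rewrite tassoc_pure tmap_tpure -?T1E; lin; rewrite T1E (tsum_pure _ _ b1).
rewrite e3 (lin_tsumE _ _ il); apply: eq_tsum => r s; congr tassoc_inv.
by rewrite -[t1 s w in RHS]tsum_eta (lin_tsumE (F := tpure r)); lin.
Qed.

Section Opposite.
Variables (k : fieldType) (Q : nalg k).
Notation Qo := (nopp Q).

Lemma mop_mul (m n : multiplier (ntens Q Q)) : mop (m *m* n) = mop n *m* mop m.
Proof. exact: multiplier_ext. Qed.

Lemma mop_memb (t : tensor Q Q) : mop (memb (t : ntens Q Q)) = memb (t : ntens Qo Qo).
Proof.
by apply: multiplier_ext => s; symmetry; exact: (ntens_opp (A := Q) (B := Q)).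
Qed.

Lemma mop_lin : linear (@mop k Q Q).
Proof. by move=> c m n; exact: multiplier_ext. Qed.

Lemma mop_memb1 (x : Q) :
  mop (mtens (memb x) (@mone k Q)) = mtens (memb (x : Qo)) (@mone k Qo).
Proof. exact: multiplier_ext. Qed.

Lemma mop_memb2 (x : Q) :
  mop (mtens (@mone k Q) (memb x)) = mtens (@mone k Qo) (memb (x : Qo)).
Proof. exact: multiplier_ext. Qed.

Variable D : Q -> multiplier (ntens Q Q).
Notation Dc := (fun x => mpush (@tswap k Q Q : ntens Q Q -> ntens Q Q) (D x)).
Hypothesis Dreg : regular_mult_hopf D.
Let HD := Dreg.1.
Let HDc := Dreg.2.

(** Passing to the opposite algebra exchanges left and right multiplication, so the
    coverings of its comultiplication are those by the other pair. *)
Lemma memb_op1 (x y : Q) :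
  memb (cm4 D y x : ntens Qo Qo) = nopp_comult D x *m* mtens mone (memb (y : Qo)).
Proof. by rewrite -mop_memb (memb_cm4 HDc) mop_mul mop_memb2. Qed.

Lemma memb_op2 (x y : Q) :
  memb (cm3 D y x : ntens Qo Qo) = mtens (memb (x : Qo)) mone *m* nopp_comult D y.
Proof. by rewrite -mop_memb (memb_cm3 HDc) mop_mul mop_memb1. Qed.

(** Coassociativity of the co-opposite, read backwards *)
Lemma cm_coassoc34 x y w :
  \tsum_(p, q <- cm4 D w y) \tsum_(u, v <- cm3 D p x) (u \ox (v \ox q))
    = \tsum_(r, s <- cm3 D y x) \tsum_(v, q <- cm4 D w s) (r \ox (v \ox q)).
Proof.
have := cm_coassoc HDc w y x.
have e1 u v : cm1 Dc u v
    = tswap (cm3 D u v) by rewrite cm3E // tswapK.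
have e2 u v : cm2 Dc u v
    = tswap (cm4 D u v) by rewrite cm4E // tswapK.
rewrite e1 e2 !tsum_swapE.
- pose Rev (t : tensor Q (tensor Q Q)) : tensor Q (tensor Q Q) :=
    \tsum_(u, r <- t) \tsum_(v, q <- r) (q \ox (v \ox u)).
  have Rl : linear Rev by rewrite /Rev; lin.
  move/(congr1 Rev); rewrite !(lin_tsumE _ _ Rl) => h; symmetry.
  transitivity (\tsum_(q, p <- cm3 D y x) Rev
    (\tsum_(u, v <- tswap (cm4 D w p)) (u \ox (v \ox q)))).
    apply: eq_tsum => q p; rewrite tsum_swapE; lin; rewrite (lin_tsumE _ _ Rl).
    by apply: eq_tsum => v u; rewrite /Rev !tsum_pure; lin.
  transitivity (\tsum_(s, r <- cm4 D w y) Rev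
    (\tsum_(v, q <- tswap (cm3 D s x)) (r \ox (v \ox q)))).
    rewrite -[LHS]/(tlift _ _).
    under eq_tsum => q p do rewrite -e2.
    rewrite h; apply: eq_tsum => s r; congr Rev.
    by rewrite -e1.
  apply: eq_tsum => s r; rewrite tsum_swapE; lin; rewrite (lin_tsumE _ _ Rl).
  by apply: eq_tsum => v u; rewrite /Rev !tsum_pure; lin.
- by have := cm1_bilin HDc; move: (cm1 _) => c1' c1b; lin.
by have := cm2_bilin HDc; move: (cm2 _) => c2' c2b; lin.
Qed.

Lemma mult_hopf_nopp : mult_hopf (nopp_comult D).
Proof.
have [Dl DM] := mult_hopf_hom HD.
have b3 := cm3_bilin HD HDc; have b4 := cm4_bilin HD HDc.
have sl := @tswap_linear k Q Q.
apply: (@mult_hopf_intro k Qo (nopp_comult D) (fun x y => cm4 D y x) (fun x y => cm3 D y x)).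
- split; first by move=> c x y; rewrite /nopp_comult Dl; exact: mop_lin.
  by move=> x y; rewrite /nopp_comult -mop_mul -DM.
- exact: memb_op1.
- exact: memb_op2.
- exact: cm_coassoc34.
- have [g gK Kg] := mult_hopf_T2_bij HDc.
  have e t : tlift (fun x y => cm4 D y x) t = tswap (T2 Dc (tswap t)).
    rewrite /T2 (lin_tsumE _ _ sl) tsum_swapE.
      by apply: eq_tsum => x y; rewrite cm4E.
    by apply: (bilin_eqfun (g := fun x y => cm4 D x y)) => // x y; rewrite cm4E.
  exists (fun t => tswap (g (tswap t))) => t; rewrite e ?tswapK ?gK ?Kg ?tswapK //.
have [g gK Kg] := mult_hopf_T1_bij HDc.
have e t : tlift (fun x y => cm3 D y x) t = tswap (T1 Dc (tswap t)).
  rewrite /T1 (lin_tsumE _ _ sl) tsum_swapE.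
    by apply: eq_tsum => x y; rewrite cm3E.
  by apply: (bilin_eqfun (g := fun x y => cm3 D x y)) => // x y; rewrite cm3E.
by exists (fun t => tswap (g (tswap t))) => t; rewrite e ?tswapK ?gK ?Kg ?tswapK.
Qed.
End Opposite.

Section Middle.
Variable k : fieldType.

Lemma tmid_lin (U V X Y : lmodType k) : linear (@tmid k U V X Y).
Proof. by rewrite /tmid; lin. Qed.

Lemma tmid_tsum (U V X Y : lmodType k) (s : tensor U V) (t : tensor X Y) :
  tmid (s \ox t) = \tsum_(u, v <- s) \tsum_(x, y <- t) ((u \ox x) \ox (v \ox y)).
Proof. by rewrite /tmid tsum_pure; lin. Qed.

Lemma tmid_pure (U V X Y : lmodType k) (u : U) (v : V) (x : X) (y : Y) :
  tmid ((u \ox v) \ox (x \ox y)) = (u \ox x) \ox (v \ox y).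
Proof. by rewrite tmid_tsum !tsum_pure; lin. Qed.

Lemma eq_lin4 (U V X Y W : lmodType k) (F G : tensor (tensor U V) (tensor X Y) -> W) :
  linear F -> linear G ->
  (forall u v x y, F ((u \ox v) \ox (x \ox y)) = G ((u \ox v) \ox (x \ox y))) -> F =1 G.
Proof.
move=> Fl Gl h; apply: eq_lin3 => // u v s.
by move: s; apply: tlift_unique => //; lin.
Qed.

Lemma tmidK (U V X Y : lmodType k) : cancel (@tmid k U V X Y) (@tmid k U X V Y).
Proof.
move=> t.
move: t; apply: eq_lin4; lin => u v x y.
by rewrite !tmid_pure.
Qed.
End Middle.

Section TensorHopf.
Variables (k : fieldType) (P Q : nalg k).
Notation mid := (@tmid k P P Q Q : ntens (ntens P P) (ntens Q Q) ->
                                   ntens (ntens P Q) (ntens P Q)).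
Notation PQ := (ntens P Q).

Lemma tmid_mul : {morph mid : s t / s ** t}.
Proof.
have al := @tmid_lin k P P Q Q.
have m1 := @ntens_bil k (ntens P P) (ntens Q Q); have m2 := @ntens_bil k PQ PQ.
move=> s t; move: s; apply: eq_lin4 => [||a b x y].
- exact: (lin_comp al (bilin_l _ m1)).
- exact: (lin_comp (bilin_l (mid t) m2) al).
move: t; apply: eq_lin4 => [||a' b' x' y'].
- exact: (lin_comp al (bilin_r _ m1)).
- exact: (lin_comp (bilin_r _ m2) al).
by rewrite /= !tmid_pure !ntens_mul_tpure /= !ntens_mul_tpure tmid_pure.
Qed.

Lemma tmid_bij : bijective mid.
Proof. by exists (@tmid k P Q P Q); exact: tmidK. Qed.

Lemma mpush_mid_mul m n : mpush mid (m *m* n) = mpush mid m *m* mpush mid n.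
Proof. exact (@mpush_mul k _ _ mid (@tmid_lin k P P Q Q) tmid_mul tmid_bij m n). Qed.

Lemma mpush_mid_memb t : mpush mid (memb t) = memb (mid t).
Proof. exact (@mpush_memb k _ _ mid (@tmid_lin k P P Q Q) tmid_mul tmid_bij t). Qed.

Lemma mpush_mid_lin : linear (mpush mid).
Proof. exact (@mpush_linear k _ _ mid (@tmid_lin k P P Q Q) tmid_mul tmid_bij). Qed.

Lemma mpush_mid_mtens m n m' n' :
  mpush mid (mtens (mtens m n) (mtens m' n')) = mtens (mtens m m') (mtens n n').
Proof.
symmetry; apply (@mpush_ext k _ _ mid (@tmid_lin k P P Q Q) tmid_mul tmid_bij) => t.
have al := @tmid_lin k P P Q Q.
move: t; apply: eq_lin4.
- exact (lin_comp (@mulL_tlin k PQ PQ _) al).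
- exact (lin_comp al (@mulL_tlin k (ntens P P) (ntens Q Q) _)).
by move=> a b x y; rewrite tmid_pure !mtens_pure tmid_pure.
Qed.

Variables (DP : P -> multiplier (ntens P P)) (DQ : Q -> multiplier (ntens Q Q)).
Hypotheses (HP : mult_hopf DP) (HQ : mult_hopf DQ).
Notation D := (ntens_comult DP DQ).

Lemma ntens_comult_bilin :
  bilin (fun (x : P) (y : Q) => mpush mid (mtens (DP x) (DQ y))).
Proof.
have [Pl _] := mult_hopf_hom HP; have [Ql _] := mult_hopf_hom HQ.
by have ml := mpush_mid_lin; lin.
Qed.

Lemma ntens_comult_pure (x : P) (y : Q) : D (x \ox y) = mpush mid (mtens (DP x) (DQ y)).
Proof. by rewrite /ntens_comult tsum_pure //; exact: ntens_comult_bilin. Qed.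

Lemma ntens_comult_lin : linear D.
Proof. exact: (tlift_linear ntens_comult_bilin). Qed.

Definition tens2 (f : P -> P -> tensor P P) (g : Q -> Q -> tensor Q Q)
    (h h' : tensor P Q) : tensor (tensor P Q) (tensor P Q) :=
  \tsum_(x, y <- h) \tsum_(x', y' <- h') tmid (f x x' \ox g y y').

Lemma tens2_bilin f g : bilin f -> bilin g -> bilin (tens2 f g).
Proof. by move=> fb gb; rewrite /tens2; lin. Qed.

Lemma tens2_pure f g x y x' y' : bilin f -> bilin g ->
  tens2 f g (x \ox y) (x' \ox y') = tmid (f x x' \ox g y y').
Proof. by move=> fb gb; rewrite /tens2 !tsum_pure; lin. Qed.

Lemma tens2_bij f g : bilin f -> bilin g -> bijective (tlift f) -> bijective (tlift g) ->
  bijective (tlift (tens2 f g)).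
Proof.
move=> fb gb [f' fK Kf] [g' gK Kg].
have fl := tlift_linear fb; have gl := tlift_linear gb; have tb := tens2_bilin fb gb.
have f'l : linear f' by move=> c u v; apply: (can_inj fK); rewrite fl !Kf.
have g'l : linear g' by move=> c u v; apply: (can_inj gK); rewrite gl !Kg.
have e t : tlift (tens2 f g) t = tmid (tmap (tlift f) (tlift g) (tmid t)).
  move: t; apply: eq_lin4.
  - by lin.
  - by lin.
  by move=> x y x' y'; rewrite tsum_pure // tens2_pure // tmid_pure tmap_tpure // !tsum_pure.
exists (fun t => tmid (tmap f' g' (tmid t))) => t; rewrite e tmidK tmap_comp //.
  rewrite (eq_tmap _ (g' := id) (h' := id)) // ?tmap_id ?tmidK //.
rewrite (eq_tmap _ (g' := id) (h' := id)) // ?tmap_id ?tmidK //.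
Qed.

Lemma tens2_coassoc f1 g1 f2 g2 x y w :
  bilin f1 -> bilin g1 -> bilin f2 -> bilin g2 ->
  (forall x y w, \tsum_(p, q <- f1 y w) \tsum_(u, v <- f2 x p) (u \ox (v \ox q))
      = \tsum_(r, s <- f2 x y) \tsum_(v, q <- f1 s w) (r \ox (v \ox q))) ->
  (forall x y w, \tsum_(p, q <- g1 y w) \tsum_(u, v <- g2 x p) (u \ox (v \ox q))
      = \tsum_(r, s <- g2 x y) \tsum_(v, q <- g1 s w) (r \ox (v \ox q))) ->
  \tsum_(p, q <- tens2 f1 g1 y w) \tsum_(u, v <- tens2 f2 g2 x p) (u \ox (v \ox q))
    = \tsum_(r, s <- tens2 f2 g2 x y) \tsum_(v, q <- tens2 f1 g1 s w) (r \ox (v \ox q)).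
Proof.
move=> f1b g1b f2b g2b cf cg.
have t1 := tens2_bilin f1b g1b; have t2 := tens2_bilin f2b g2b.
move: x y; apply: eq_bilin => [||x1 x2 y1 y2]; [by lin | by lin |].
move: w; apply: tlift_unique => [||w1 w2]; [by lin | by lin |].
rewrite !tens2_pure // !tmid_tsum.
pose Phi (s : tensor P (tensor P P)) (t : tensor Q (tensor Q Q)) :
    tensor (tensor P Q) (tensor (tensor P Q) (tensor P Q)) :=
  \tsum_(a, r <- s) \tsum_(b, c <- r) \tsum_(a', r' <- t) \tsum_(b', c' <- r')
     ((a \ox a') \ox ((b \ox b') \ox (c \ox c'))).
have Phib : bilin Phi by rewrite /Phi; lin.
have Phil t : linear (fun s => Phi s t) by lin.
have Phir s : linear (Phi s) by lin.
transitivity (Phi (\tsum_(p, q <- f1 y1 w1) \tsum_(u, v <- f2 x1 p) (u \ox (v \ox q)))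
   (\tsum_(p, q <- g1 y2 w2) \tsum_(u, v <- g2 x2 p) (u \ox (v \ox q)))).
  rewrite (lin_tsumE _ _ (Phil _)) tsum_bind; lin; apply: eq_tsum => p q.
  rewrite tsum_bind ?(lin_tsumE _ _ (Phir _)); lin; apply: eq_tsum => p' q'.
  rewrite tsum_pure ?tens2_pure ?tmid_tsum ?tsum_bind; lin.
  rewrite (lin_tsumE _ _ (Phil _)); apply: eq_tsum => u v.
  rewrite tsum_bind ?(lin_tsumE _ _ (Phir _)); lin; apply: eq_tsum => u' v'.
  by rewrite /Phi !tsum_pure; lin.
rewrite cf cg (lin_tsumE _ _ (Phil _)) [RHS]tsum_bind; lin; apply: eq_tsum => p q.
rewrite [RHS]tsum_bind ?(lin_tsumE _ _ (Phir _)); lin; apply: eq_tsum => p' q'.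
rewrite [RHS]tsum_pure ?tens2_pure ?tmid_tsum; lin.
rewrite [RHS]tsum_bind ?(lin_tsumE _ _ (Phil _)); lin; apply: eq_tsum => u v.
rewrite [RHS]tsum_bind ?(lin_tsumE _ _ (Phir _)); lin; apply: eq_tsum => u' v'.
by rewrite /Phi !tsum_pure; lin.
Qed.

Let p1 := cm1_bilin HP.
Let q1 := cm1_bilin HQ.
Let p2 := cm2_bilin HP.
Let q2 := cm2_bilin HQ.

Lemma memb_tens1 h h' : memb (tens2 (cm1 DP) (cm1 DQ) h h' : ntens PQ PQ)
  = D h *m* mtens mone (memb (h' : PQ)).
Proof.
have mmb := @mmul_bilin k (ntens PQ PQ); have mtb := @mtens_bilin k PQ PQ.
have ml := @memb_tlin k PQ PQ; have ml' := @memb_tlin k P Q.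
have tb := tens2_bilin p1 q1; have Dl := ntens_comult_lin.
move: h h'; apply: eq_bilin => [||x y x' y'].
- by split=> h; [exact: (lin_comp ml (bilin_r h tb)) | exact: (lin_comp ml (bilin_l h tb))].
- split=> h; last exact: (lin_comp (bilin_l _ mmb) Dl).
  exact: (lin_comp (bilin_r _ mmb) (lin_comp (bilin_r _ mtb) ml')).
rewrite tens2_pure // ntens_comult_pure -mtens_memb.
rewrite -{1}(@mtens1 k P Q) -mpush_mid_mtens -mpush_mid_mul mtens_mul.
by rewrite -(memb_cm1 HP) -(memb_cm1 HQ) mtens_memb mpush_mid_memb.
Qed.

Lemma memb_tens2 h h' : memb (tens2 (cm2 DP) (cm2 DQ) h h' : ntens PQ PQ)
  = mtens (memb (h : PQ)) mone *m* D h'.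
Proof.
have mmb := @mmul_bilin k (ntens PQ PQ); have mtb := @mtens_bilin k PQ PQ.
have ml := @memb_tlin k PQ PQ; have ml' := @memb_tlin k P Q.
have tb := tens2_bilin p2 q2; have Dl := ntens_comult_lin.
move: h h'; apply: eq_bilin => [||x y x' y'].
- by split=> h; [exact: (lin_comp ml (bilin_r h tb)) | exact: (lin_comp ml (bilin_l h tb))].
- split=> h; first exact: (lin_comp (bilin_r _ mmb) Dl).
  exact: (lin_comp (bilin_l _ mmb) (lin_comp (bilin_l _ mtb) ml')).
rewrite tens2_pure // ntens_comult_pure -mtens_memb.
rewrite -{1}(@mtens1 k P Q) -mpush_mid_mtens -mpush_mid_mul mtens_mul.
by rewrite -(memb_cm2 HP) -(memb_cm2 HQ) mtens_memb mpush_mid_memb.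
Qed.

Lemma mult_hopf_ntens : mult_hopf D.
Proof.
have [_ PM] := mult_hopf_hom HP; have [_ QM] := mult_hopf_hom HQ.
have Dl := ntens_comult_lin; have nb := @ntens_bil k P Q.
have mmb := @mmul_bilin k (ntens PQ PQ).
apply: (@mult_hopf_intro k PQ D (tens2 (cm1 DP) (cm1 DQ)) (tens2 (cm2 DP) (cm2 DQ))).
- split=> //; apply: eq_bilin => [||x y x' y'].
  + by split=> s; [exact: (lin_comp Dl (bilin_r s nb)) | exact: (lin_comp Dl (bilin_l s nb))].
  + by split=> s; [exact: (lin_comp (bilin_r _ mmb) Dl) | exact: (lin_comp (bilin_l _ mmb) Dl)].
  rewrite /= ntens_mul_tpure !ntens_comult_pure PM QM.
  by rewrite -mpush_mid_mul mtens_mul.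
- exact: memb_tens1.
- exact: memb_tens2.
- by move=> x y w; apply: tens2_coassoc => // *; apply: cm_coassoc.
- exact: tens2_bij p1 q1 (mult_hopf_T1_bij HP) (mult_hopf_T1_bij HQ).
exact: tens2_bij p2 q2 (mult_hopf_T2_bij HP) (mult_hopf_T2_bij HQ).
Qed.
End TensorHopf.

(** * Comodule algebras from covered coactions *)

Lemma ntens_mul_purer (k : fieldType) (A B : nalg k) (t : tensor A B) a b :
  ntens_mul t (a \ox b) = \tsum_(u, v <- t) ((u ** a) \ox (v ** b)).
Proof.
rewrite -{1}[t]tsum_eta.
rewrite (lin_tsumE (F := fun t => ntens_mul t (a \ox b)));
  last exact: (bilin_l _ (ntens_bilin A B)).
by apply: eq_tsum => u v; rewrite ntens_mul_tpure.
Qed.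

(** A family of multipliers G(a) is a coaction as soon as its coverings form a covered
    coaction with the properties of one; the iterated coaction, which the definition
    asks for as a multiplier, is built from [c] and [cl]. *)
Section LeftComoduleIntro.
Variables (k : fieldType) (H A : nalg k) (D : H -> multiplier (ntens H H)).
Variable G : A -> multiplier (ntens H A).
Variables (c : A -> H -> tensor H A) (cl : H -> A -> tensor H A).
Hypotheses (HD : mult_hopf D) (cP : covered c cl).
Hypothesis GE : forall a x b, mulL (G a) (x \ox b) = tmap id (fun a0 => a0 ** b) (c a x).
Hypothesis c_mul : forall a b x, c (a ** b) x
   = \tsum_(y, b0 <- c b x) \tsum_(z, a0 <- c a y) (z \ox (a0 ** b0)).
Hypothesis c_inj : forall a, (forall z, c a z = 0) -> a = 0.
Hypothesis c_co : coassocr (cm1 D) c.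

Let cb := cov_bilin cP.
Let clb := covl_bilin cP.

Lemma intro_lin : linear G.
Proof.
move=> r a b; apply: eq_multiplier2 => x y; rewrite mulL_comb !GE.
have h : linear (fun a => tmap id (fun a0 => a0 ** y) (c a x)).
  by lin.
exact: h.
Qed.

Lemma mulL_intro a (t : tensor H A) :
  mulL (G a) t = \tsum_(x, b <- t) tmap id (fun a0 => a0 ** b) (c a x).
Proof.
rewrite -[t in LHS]tsum_eta (lin_tsumE _ _ (@mulL_tlin k H A (G a))).
by apply: eq_tsum => x b; rewrite GE.
Qed.

Lemma memb_intro a x : memb (c a x : ntens H A) = G a *m* mtens (memb x) mone.
Proof.
apply: eq_multiplier2 => x' b;
  rewrite -[mulL (_ *m* _) _]/(mulL (G a) (mulL (mtens (memb x) mone) (x' \ox b))).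
rewrite mtens_pure /= GE (covM cP) tmap_comp; lin.
by rewrite ntens_mul_purer.
Qed.

Lemma memb_introl a x : memb (cl x a : ntens H A) = mtens (memb x) mone *m* G a.
Proof.
apply: eq_multiplier2 => x' b.
rewrite -[mulL (_ *m* _) _]/(mulL (mtens (memb x) mone) (mulL (G a) (x' \ox b))) GE.
transitivity (tmap id (fun a0 => a0 ** b) (x *| c a x')).
  rewrite (cov_link cP) tmap_comp; lin.
  by rewrite /= ntens_mul_purer.
by rewrite [RHS]/= !tmap_comp; lin.
Qed.

Lemma mulR_tbilin t : linear (fun b => mulR (G b) t : tensor H A).
Proof. by move=> r a b; rewrite intro_lin /= addr0 scale1r. Qed.

Lemma mulL_tbilin t : linear (fun b => mulL (G b) t : tensor H A).
Proof. by move=> r a b; rewrite intro_lin mulL_comb. Qed.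

Section Iterated.
Variable a : A.

(** The two halves of (id (x) G)G(a) *)
Definition iterL (s : tensor H (tensor H A)) : tensor H (tensor H A) :=
  \tsum_(x, t <- s) \tsum_(y, b <- c a x) (y \ox mulL (G b) t).
Definition iterR (s : tensor H (tensor H A)) : tensor H (tensor H A) :=
  \tsum_(x, t <- s) \tsum_(y, b <- cl x a) (y \ox mulR (G b) t).

Let Lb : bilin (fun x (t : tensor H A) => \tsum_(y, b <- c a x) (y \ox mulL (G b) t)).
Proof.
have tb := tpure_bilin H (tensor H A).
split=> [x|t].
  by apply: lin_tsum => y b; exact (lin_comp (bilin_r y tb) (@mulL_tlin k H A (G b))).
have Fb : bilin (fun (y : H) (b : A) => y \ox (mulL (G b) t : tensor H A)).
  by split=> [y|b]; [exact (lin_comp (bilin_r y tb) (mulL_tbilin t)) | exact (bilin_l _ tb)].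
exact (lin_comp (tlift_linear Fb) (bilin_r a cb)).
Qed.

Let Rb : bilin (fun x (t : tensor H A) => \tsum_(y, b <- cl x a) (y \ox mulR (G b) t)).
Proof.
have tb := tpure_bilin H (tensor H A).
split=> [x|t].
  by apply: lin_tsum => y b; exact (lin_comp (bilin_r y tb) (@mulR_linear k (ntens H A) (G b))).
have Fb : bilin (fun (y : H) (b : A) => y \ox (mulR (G b) t : tensor H A)).
  by split=> [y|b]; [exact (lin_comp (bilin_r y tb) (mulR_tbilin t)) | exact (bilin_l _ tb)].
exact (lin_comp (tlift_linear Fb) (bilin_l a clb)).
Qed.

Lemma iterL_lin : linear iterL. Proof. exact: tlift_linear. Qed.
Lemma iterR_lin : linear iterR. Proof. exact: tlift_linear. Qed.

Lemma iterP (s t : ntens H (ntens H A)) :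
  (iterR s : ntens H (ntens H A)) ** t = s ** (iterL t : ntens H (ntens H A)).
Proof.
have nb := @ntens_bil k H (ntens H A).
move: s t; apply: eq_bilin => [||x p y q].
- by split=> s; [exact: (bilin_r _ nb) | exact: (lin_comp (bilin_l _ nb) iterR_lin)].
- by split=> s; [exact: (lin_comp (bilin_r _ nb) iterL_lin) | exact: (bilin_l _ nb)].
rewrite /iterL /iterR (tsum_pure _ _ Lb) (tsum_pure _ _ Rb).
pose F (z : H) (b : A) : tensor H (tensor H A) := z \ox ntens_mul p (mulL (G b) q).
have ml : linear (fun b : A => ntens_mul p (mulL (G b) q)).
  exact (lin_comp (bilin_r p (ntens_bilin H A)) (mulL_tbilin q)).
have tb := tpure_bilin H (tensor H A).
have Fb : bilin F.
  by split=> [z|b]; [exact (lin_comp (bilin_r z tb) ml) | exact (bilin_l _ tb)].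
have h : tlift F (x *| c a y) = tlift F (cl x a |* y) by rewrite (cov_link cP).
rewrite !tsum_map in h; lin.
have nb3 := ntens_bilin H (ntens H A).
transitivity (\tsum_(z, b <- cl x a) F (z ** y) b).
  rewrite [LHS]/= (lin_tsumE (F := fun r => @ntens_mul k H (ntens H A) r (y \ox q)));
    last exact (bilin_l _ nb3).
  apply: eq_tsum => z b; rewrite ntens_mul_tpure /F; congr (_ \ox _).
  exact (@mulRL k (ntens H A) (G b) p q).
rewrite -h [RHS]/= (lin_tsumE (F := fun r => @ntens_mul k H (ntens H A) (x \ox p) r));
  last exact (bilin_r _ nb3).
by apply: eq_tsum => z b; rewrite ntens_mul_tpure.
Qed.

Definition iter_mult : multiplier (ntens H (ntens H A)) :=
  Multiplier (A := ntens H (ntens H A)) iterL_lin iterR_lin iterP.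

Lemma iter_pure x t :
  mulL iter_mult (x \ox t) = \tsum_(y, b <- c a x) (y \ox mulL (G b) t).
Proof. exact: (tsum_pure _ _ Lb). Qed.
End Iterated.

Lemma mulL_comult x r s : mulL (D x) (r \ox s) = cm1 D x s |* r.
Proof.
apply: memb_tinj; rewrite memb_rm1 (memb_cm1 HD) -mmulA mtens_mul mmulm1 mmul1m mtens_memb.
exact: (@memb_mulL k (ntens H H)).
Qed.

Lemma lcoact_cov_intro a x : lcoact_cov G a x = c a x.
Proof. exact (@elemE k (ntens H A) _ _ (memb_intro a x)). Qed.

Lemma mulL_tsum (K : nalg k) (U V : lmodType k) (f : U -> V -> multiplier K) t z :
  mulL (tlift f t) z = \tsum_(u, v <- t) mulL (f u v) z.
Proof. exact: (lin_tsumE _ _ (mulL_lin z)). Qed.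

Lemma iter_first a x : iter_mult a *m* mtens (memb x) mone
  = \tsum_(y, b <- c a x) mtens (memb y) (G b).
Proof.
apply: eq_multiplier2 => x' t.
rewrite -[mulL (_ *m* _) _]/(mulL (iter_mult a) (mulL (mtens (memb x) mone) (x' \ox t))).
rewrite mtens_pure /= -[iterL _ _]/(mulL (iter_mult a) _) iter_pure (covM cP).
have tb := tpure_bilin H (tensor H A).
have Fb : bilin (fun (y : H) (b : A) => y \ox (mulL (G b) t : tensor H A)).
  by split=> [y|b]; [exact (lin_comp (bilin_r y tb) (mulL_tbilin t)) | exact (bilin_l _ tb)].
rewrite tsum_map //; last by lin.
rewrite mulL_tsum; apply: eq_tsum => y b.
by rewrite mtens_pure.
Qed.

Lemma iter_second a x :
  let assoc : ntens (ntens H H) A -> ntens H (ntens H A) := @tassoc k H H A in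
  iter_mult a *m* mpush assoc (mtens (D x) mone)
    = mpush assoc (\tsum_(y, b <- c a x) mtens (D y) (memb b)).
Proof.
move=> assoc.
have al : linear assoc := @tassoc_lin k H H A.
apply: multiplier_extL => t0; have [g _ gK] := @tassoc_bij k H H A.
rewrite -(gK t0); move: (g t0) => t {t0 g gK}; rewrite -/assoc.
have iL := @mulL_tlin k H (ntens H A) (iter_mult a).
set M1 := mtens (D x) mone; set M2 := tlift _ _.
move: t; apply: eq_lin3.
- exact (lin_comp (@mulL_tlin k H (ntens H A) (iter_mult a *m* mpush assoc M1)) al).
- exact (lin_comp (@mulL_tlin k H (ntens H A) (mpush assoc M2)) al).
move=> r s b'.
rewrite -[mulL (_ *m* _) _]/(mulL (iter_mult a) (mulL (mpush assoc M1) (assoc ((r \ox s) \ox b')))).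
rewrite !mpush_assocE /M1 mtens_pure mulL_comult /M2 mulL_tsum.
pose Th (t : tensor H (tensor H A)) : tensor H (tensor H A) :=
  tmap (fun u => u ** r) (tmap id (fun b => b ** b')) t.
have Thl : linear Th by apply: tmap_linear; lin.
transitivity (Th (\tsum_(u, v <- cm1 D x s) \tsum_(z, b <- c a u) (z \ox c b v))).
  rewrite -[cm1 D x s in LHS]tsum_eta tmap_tsum; lin.
  rewrite (lin_tsumE (F := fun t : tensor H H => t \ox mulL (mone : multiplier A) b')); last first.
    exact (bilin_l _ (tpure_bilin (tensor H H) A)).
  rewrite (lin_tsumE _ _ (@tassoc_lin k H H A)) (lin_tsumE _ _ iL) (lin_tsumE _ _ Thl);
    apply: eq_tsum => u v.
  rewrite rm_pure /assoc tassoc_pure iter_pure (covM cP).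
  have tb := tpure_bilin H (tensor H A).
  have Fb : bilin (fun (y : H) (b : A) => y \ox (mulL (G b) (v \ox mulL mone b') : tensor H A)).
    by split=> [y|b]; [exact (lin_comp (bilin_r y tb) (mulL_tbilin _)) | exact (bilin_l _ tb)].
  rewrite tsum_map //; last by lin.
  rewrite (lin_tsumE _ _ Thl); apply: eq_tsum => z b; rewrite GE /Th.
  by rewrite tmap_tpure; lin.
rewrite c_co (lin_tsumE _ _ Thl) (lin_tsumE _ _ (@tassoc_lin k H H A)); apply: eq_tsum => z b.
rewrite mtens_pure mulL_comult -[cm1 D z s in RHS]tsum_eta tmap_tsum; lin.
rewrite (lin_tsumE (F := fun t : tensor H H => t \ox mulL (memb b) b')); last first.
  exact (bilin_l _ (tpure_bilin (tensor H H) A)).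
rewrite (lin_tsumE _ _ (@tassoc_lin k H H A)) (lin_tsumE _ _ Thl); apply: eq_tsum => u v.
by rewrite rm_pure /assoc tassoc_pure /Th !tmap_tpure; lin.
Qed.

Lemma left_comodule_intro : left_comodule_algebra D G.
Proof.
have Gl := intro_lin.
split.
- split=> // a b; apply: eq_multiplier2 => x y.
  rewrite -[RHS]/(mulL (G a) (mulL (G b) (x \ox y))) !GE mulL_intro c_mul.
  rewrite tmap_tsum ?tsum_map; lin; last by rewrite /tmap; lin.
  apply: eq_tsum => z b0; rewrite tmap_tsum; lin; rewrite [RHS]tmapE.
  by apply: eq_tsum => w a0; rewrite tmap_tpure ?nmulA; lin.
- move=> a b ab; apply/eqP; rewrite -subr_eq0; apply/eqP/c_inj => z.
  apply: memb_tinj; rewrite memb_intro (linP0 (@memb_tlin k H A)).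
  rewrite addrC -scaleN1r Gl ab scaleN1r addNr.
  exact: (linP0 (bilin_l _ (@mmul_bilin k (ntens H A)))).
- by move=> a x; exists (c a x); exact: memb_intro.
- by move=> a x; exists (cl x a); exact: memb_introl.
move=> a; exists (iter_mult a) => x; rewrite lcoact_cov_intro; split.
  exact: iter_first.
exact: iter_second.
Qed.
End LeftComoduleIntro.

(** * Coactions of a tensor product *)

Section TensorCoaction.
Variables (k : fieldType) (H K : nalg k) (A : lmodType k).
Variables (c : A -> H -> tensor H A) (cl : H -> A -> tensor H A).
Variables (d : A -> K -> tensor K A) (dl : K -> A -> tensor K A).
Hypotheses (cP : covered c cl) (dP : covered d dl).
Notation HK := (ntens H K).

(** Two commuting coactions give one of H (x) K, sum (a_(-1) (x) a'_(-1)) (x) a'_0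
    with a' = a_0. *)
Definition tcov0 (a : A) (x : H) (y : K) : tensor (tensor H K) A :=
  \tsum_(z, a0 <- c a x) \tsum_(w, a1 <- d a0 y) ((z \ox w) \ox a1).
Definition tcovl0 (x : H) (y : K) (a : A) : tensor (tensor H K) A :=
  \tsum_(z, a0 <- cl x a) \tsum_(w, a1 <- dl y a0) ((z \ox w) \ox a1).
Definition tcov (a : A) (h : HK) : tensor HK A := \tsum_(x, y <- h) tcov0 a x y.
Definition tcovl (h : HK) (a : A) : tensor HK A := \tsum_(x, y <- h) tcovl0 x y a.

Lemma tcov0_bilin a : bilin (tcov0 a). Proof. by rewrite /tcov0; lin. Qed.
Lemma tcovl0_bilin a : bilin (fun x y => tcovl0 x y a). Proof. by rewrite /tcovl0; lin. Qed.
Lemma tcov_pure a x y : tcov a (x \ox y) = tcov0 a x y.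
Proof. by rewrite /tcov tsum_pure //; exact: tcov0_bilin. Qed.
Lemma tcovl_pure a x y : tcovl (x \ox y) a = tcovl0 x y a.
Proof. exact: (tsum_pure _ _ (tcovl0_bilin a)). Qed.

Lemma tcov_bilin : bilin tcov.
Proof.
split=> [a|h]; first exact: (tlift_linear (tcov0_bilin a)).
by apply: lin_tsum => x y; rewrite /tcov0; lin.
Qed.
Lemma tcovl_bilin : bilin tcovl.
Proof.
split=> [h|a]; last exact: (tlift_linear (tcovl0_bilin a)).
by apply: lin_tsum => x y; rewrite /tcovl0; lin.
Qed.

Lemma rm_bilin (P : nalg k) (V : lmodType k) :
  bilin (fun (t : tensor P V) (z : P) => t |* z).
Proof.
by split=> [t|z]; [rewrite /tmap; lin | exact: rm_lin].
Qed.

Lemma lm_bilin (P : nalg k) (V : lmodType k) :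
  bilin (fun (z : P) (t : tensor P V) => z *| t).
Proof.
by split=> [z|t]; [exact: lm_lin | rewrite /tmap; lin].
Qed.

Lemma tcov0M a x y x' y' : tcov0 a (x ** x') (y ** y') = tcov0 a x y |* (x' \ox y' : HK).
Proof.
have rl := @rm_lin k HK A (x' \ox y').
rewrite (lin_tsumE _ _ rl) /tcov0 (covM cP) tsum_map; lin.
apply: eq_tsum => z a0; rewrite (covM dP) tsum_map ?(lin_tsumE _ _ rl); lin.
by apply: eq_tsum => w a1; rewrite (@rm_pure k HK A) /= ntens_mul_tpure.
Qed.

Lemma tcovl0M a x y x' y' : tcovl0 (x ** x') (y ** y') a = (x \ox y : HK) *| tcovl0 x' y' a.
Proof.
have rl := @lm_lin k HK A (x \ox y).
rewrite (lin_tsumE _ _ rl) /tcovl0 (covlM cP) tsum_map; lin.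
apply: eq_tsum => z a0; rewrite (covlM dP) tsum_map ?(lin_tsumE _ _ rl); lin.
by apply: eq_tsum => w a1; rewrite (@lm_pure k HK A) /= ntens_mul_tpure.
Qed.

Lemma tcov0_link a x y x' y' :
  (x' \ox y' : HK) *| tcov0 a x y = tcovl0 x' y' a |* (x \ox y : HK).
Proof.
have ll := @lm_lin k HK A (x' \ox y'); have rl := @rm_lin k HK A (x \ox y).
rewrite (lin_tsumE _ _ ll) (lin_tsumE _ _ rl).
pose F (z : H) (a0 : A) : tensor (tensor H K) A :=
  \tsum_(w, a1 <- y' *| d a0 y) ((z \ox w) \ox a1).
have lm2 : linear (fun t : tensor K A => y' *| t) by exact: lm_lin.
have Fb : bilin F by rewrite /F; lin.
transitivity (tlift F (x' *| c a x)).
  rewrite tsum_map; lin; apply: eq_tsum => z a0.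
  rewrite (lin_tsumE _ _ ll) /F tsum_map; lin; apply: eq_tsum => w a1.
  by rewrite (@lm_pure k HK A) /= ntens_mul_tpure.
rewrite (cov_link cP) tsum_map; lin; apply: eq_tsum => z a0.
rewrite (lin_tsumE _ _ rl) /F (cov_link dP) tsum_map; lin; apply: eq_tsum => w a1.
by rewrite (@rm_pure k HK A) /= ntens_mul_tpure.
Qed.

Lemma tcov_covered : covered tcov tcovl.
Proof.
have b1 := tcov_bilin; have b2 := tcovl_bilin.
have nb := @ntens_bil k H K; have rb := @rm_bilin HK A; have lb := @lm_bilin HK A.
split=> // a; apply: eq_bilin => [||x y x' y'].
- by split=> s; [exact (lin_comp (bilin_r a b1) (bilin_r _ nb))
    | exact (lin_comp (bilin_r a b1) (bilin_l _ nb))].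
- by split=> s; [exact (bilin_r _ rb) | exact (lin_comp (bilin_l _ rb) (bilin_r a b1))].
- by rewrite /= ntens_mul_tpure !tcov_pure tcov0M.
- by split=> s; [exact (lin_comp (bilin_l a b2) (bilin_r _ nb))
    | exact (lin_comp (bilin_l a b2) (bilin_l _ nb))].
- by split=> s; [exact (lin_comp (bilin_r _ lb) (bilin_l a b2)) | exact (bilin_l _ lb)].
- by rewrite /= ntens_mul_tpure !tcovl_pure tcovl0M.
- by split=> s; [exact (bilin_l _ lb) | exact (lin_comp (bilin_r _ lb) (bilin_r a b1))].
- by split=> s; [exact (lin_comp (bilin_l _ rb) (bilin_l a b2)) | exact (bilin_r _ rb)].
by rewrite tcov_pure tcovl_pure tcov0_link.
Qed.

Lemma tcov_nat (g : A -> A) : linear g ->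
  (forall a x, c (g a) x = tmap id g (c a x)) ->
  (forall a x, d (g a) x = tmap id g (d a x)) ->
  forall a h, tcov (g a) h = tmap id g (tcov a h).
Proof.
move=> gl gc gd a h; rewrite /tcov tmap_tsum; lin; apply: eq_tsum => x y.
rewrite /tcov0 gc tsum_map; lin; rewrite tmap_tsum; lin.
apply: eq_tsum => z a0; rewrite gd tsum_map; lin; rewrite tmap_tsum; lin.
by apply: eq_tsum => w a1; rewrite tmap_tpure; lin.
Qed.

Lemma tcov_mul (m : A -> A -> A) : bilin m ->
  (forall a b x, c (m a b) x
     = \tsum_(y, b0 <- c b x) \tsum_(z, a0 <- c a y) (z \ox m a0 b0)) ->
  (forall a b x, d (m a b) x
     = \tsum_(y, b0 <- d b x) \tsum_(z, a0 <- d a y) (z \ox m a0 b0)) ->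
  forall a b h, tcov (m a b) h
    = \tsum_(h1, b0 <- tcov b h) \tsum_(h2, a0 <- tcov a h1) (h2 \ox m a0 b0).
Proof.
move=> mb cm dm a b h; have b1 := tcov_bilin.
have Fb : bilin (fun (h1 : tensor H K) b0 => \tsum_(h2, a0 <- tcov a h1) (h2 \ox m a0 b0)).
  by lin.
rewrite /tcov (lin_tsumE _ _ (tlift_linear Fb)); apply: eq_tsum => x y.
rewrite {1}/tcov0 cm (lin_tsumE _ _ (tlift_linear Fb)) tsum_bind; last first.
  by lin.
apply: eq_tsum => z b0; rewrite tsum_bind; last by lin.
transitivity (\tsum_(z', a0 <- c a z) \tsum_(w, b1 <- d b0 y) \tsum_(w', a1 <- d a0 w)
   ((z' \ox w') \ox m a1 b1)).
  apply: eq_tsum => z' a0; rewrite tsum_pure ?dm; last by lin.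
  rewrite tsum_bind; last by lin.
  apply: eq_tsum => w b2; rewrite tsum_bind; last by lin.
  by apply: eq_tsum => w' a1; rewrite tsum_pure; lin.
rewrite (lin_tsumE _ _ (tlift_linear Fb)) tsum_swap; apply: eq_tsum => w b2.
rewrite tsum_pure // tcov_pure /tcov0 tsum_bind; last by lin.
apply: eq_tsum => z' a0; rewrite tsum_bind; last by lin.
by apply: eq_tsum => w' a1; rewrite tsum_pure; lin.
Qed.

Lemma cocommute_sum (X : lmodType k) (F : H -> K -> A -> X) a x y :
  cocommute c d -> trilin F ->
  \tsum_(u, b <- c a x) \tsum_(v, b' <- d b y) F u v b'
    = \tsum_(v, b <- d a y) \tsum_(u, b' <- c b x) F u v b'.
Proof.
move=> cd Ft.
pose Psi (t : tensor H (tensor K A)) := \tsum_(u, r <- t) \tsum_(v, b <- r) F u v b.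
have Psil : linear Psi by rewrite /Psi; lin.
have := congr1 Psi (cd a x y); rewrite !(lin_tsumE _ _ Psil) => h.
transitivity (\tsum_(u, b <- c a x) Psi (u \ox d b y)).
  by apply: eq_tsum => u b; rewrite /Psi tsum_pure; lin.
rewrite h; apply: eq_tsum => v b; rewrite (lin_tsumE _ _ Psil).
by apply: eq_tsum => u b'; rewrite /Psi !tsum_pure; lin.
Qed.

Lemma tcov_coassoc (T : H -> H -> tensor H H) (T' : K -> K -> tensor K K) :
  cocommute c d -> bilin T -> bilin T' -> coassocr T c -> coassocr T' d ->
  @coassocr k HK A (tens2 T T') tcov.
Proof.
move=> cd Tb T'b cT dT a h h'.
have tb := tcov_bilin; have t2b := tens2_bilin Tb T'b.
have Fb : bilin (fun u v : tensor H K => \tsum_(z, b <- tcov a u) (z \ox tcov b v)).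
  by lin.
have F'b (w : tensor H K) :
    bilin (fun (z : tensor H K) (b : A) => \tsum_(u, v <- tens2 T T' z w) (u \ox (v \ox b))).
  by lin.
move: h h'; apply: eq_bilin => [||x y x' y'].
- by split=> h; [exact (lin_comp (tlift_linear Fb) (bilin_r _ t2b))
    | exact (lin_comp (tlift_linear Fb) (bilin_l _ t2b))].
- by split=> h; [lin | exact (lin_comp (tlift_linear (F'b h)) (bilin_r a tb))].
rewrite tens2_pure // tmid_tsum (lin_tsumE _ _ (tlift_linear Fb)).
pose E u u' v v' a4 : tensor (tensor H K) (tensor (tensor H K) A) :=
  (u \ox v) \ox ((u' \ox v') \ox a4).
transitivity (\tsum_(p, q <- T x x') \tsum_(u, a1 <- c a p) \tsum_(u', a2 <- c a1 q)
   \tsum_(r, s <- T' y y') \tsum_(v, a3 <- d a2 r) \tsum_(v', a4 <- d a3 s) E u u' v v' a4).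
  apply: eq_tsum => p q; rewrite (lin_tsumE _ _ (tlift_linear Fb)).
  under [RHS]eq_tsum => u a1 do rewrite tsum_swap.
  rewrite [RHS]tsum_swap; apply: eq_tsum => r s.
  rewrite tsum_pure // tcov_pure /tcov0 tsum_bind; last by lin.
  apply: eq_tsum => u a1; rewrite tsum_bind; last by lin.
  rewrite (cocommute_sum (F := fun u' v a3 => \tsum_(v', a4 <- d a3 s) E u u' v v' a4) a1 q r cd);
    last by rewrite /E; lin.
  apply: eq_tsum => v a2; rewrite tsum_pure; last by lin.
  rewrite tcov_pure /tcov0 (lin_tsumE (F := tpure (u \ox v))); last by lin.
  apply: eq_tsum => u' a3; rewrite (lin_tsumE (F := tpure (u \ox v))); last by lin.
  by apply: eq_tsum => v' a4.
transitivity (\tsum_(z, a1 <- c a x) \tsum_(u, u' <- T z x')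
   \tsum_(w, a2 <- d a1 y) \tsum_(v, v' <- T' w y') E u u' v v' a2); last first.
  rewrite tcov_pure /tcov0 [RHS]tsum_bind //; apply: eq_tsum => z a1.
  rewrite [RHS]tsum_bind // tsum_swap; apply: eq_tsum => w a2.
  rewrite tsum_pure // tens2_pure // tmid_tsum tsum_bind; last by lin.
  apply: eq_tsum => u u'; rewrite tsum_bind; last by lin.
  by apply: eq_tsum => v v'; rewrite tsum_pure; lin.
pose F u u' a2 := \tsum_(r, s <- T' y y') \tsum_(v, a3 <- d a2 r)
   \tsum_(v', a4 <- d a3 s) E u u' v v' a4.
have Ft : trilin F by rewrite /F /E; lin.
pose Phi (t : tensor H (tensor H A)) := \tsum_(u, r <- t) \tsum_(u', a2 <- r) F u u' a2.
have Phil : linear Phi by rewrite /Phi; lin.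
have FE u u' a2 : F u u' a2
    = \tsum_(w, a3 <- d a2 y) \tsum_(v, v' <- T' w y') E u u' v v' a3.
  pose Psi (t : tensor K (tensor K A)) := \tsum_(v, r <- t) \tsum_(v', a4 <- r) E u u' v v' a4.
  have Psil : linear Psi by rewrite /Psi /E; lin.
  have := congr1 Psi (dT a2 y y'); rewrite !(lin_tsumE _ _ Psil) => hd.
  transitivity (\tsum_(r, s <- T' y y') Psi (\tsum_(v, a3 <- d a2 r) (v \ox d a3 s))).
    apply: eq_tsum => r s; rewrite (lin_tsumE _ _ Psil); apply: eq_tsum => v a3.
    by rewrite /Psi tsum_pure // /E; lin.
  rewrite hd; apply: eq_tsum => w a3; rewrite (lin_tsumE _ _ Psil).
  by apply: eq_tsum => v v'; rewrite /Psi !tsum_pure // /E; lin.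
have := congr1 Phi (cT a x x'); rewrite !(lin_tsumE _ _ Phil) => hc.
transitivity (\tsum_(p, q <- T x x') Phi (\tsum_(u, a1 <- c a p) (u \ox c a1 q))).
  apply: eq_tsum => p q; rewrite (lin_tsumE _ _ Phil); apply: eq_tsum => u a1.
  by rewrite /Phi tsum_pure; lin.
rewrite hc; apply: eq_tsum => z a1; rewrite (lin_tsumE _ _ Phil).
by apply: eq_tsum => u u'; rewrite /Phi !tsum_pure ?FE; lin.
Qed.
End TensorCoaction.

(** * The two sides of a four-sided Long module algebra *)

Section FourSides.
Variables (k : fieldType) (Q : nalg k) (D : Q -> multiplier (ntens Q Q)).
Hypothesis Q_hopf : regular_mult_hopf D.
Variables S Sinv : Q -> Q.
Hypothesis SP : antipode D (fun x => memb (S x)).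
Hypotheses (SK : cancel S Sinv) (SinvK : cancel Sinv S).
Variables (A : nalg k) (lact : Q -> A -> A) (ract : A -> Q -> A).
Variables (G : A -> multiplier (ntens Q A)) (U : A -> multiplier (ntens A Q)).
Hypothesis AP : four_sides_long D lact ract G U.

Let HD : mult_hopf D := Q_hopf.1.
Let HDc := Q_hopf.2.
Let lmP := bimodule_left (fsl_bimodule AP).
Let rmP := bimodule_right (fsl_bimodule AP).
Let GP := bicomodule_left (fsl_bicomodule AP).
Let UP := bicomodule_right (fsl_bicomodule AP).

Let b1 : bilin (cm1 D) := cm1_bilin HD.
Let b2 : bilin (cm2 D) := cm2_bilin HD.
Let b3 : bilin (cm3 D) := cm3_bilin HD HDc.
Let b4 : bilin (cm4 D) := cm4_bilin HD HDc.
Let Sl := antipode_lin SP.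
Let Sil := antipode_inv_lin SP SK SinvK.
Let SM := antipode_mul SP.

Notation lcov := (lcov G).
Notation lcovl := (lcovl G).
Notation fcov := (fcov U).
Notation fcovl := (fcovl U).

(** The right-hand data over the opposite of Q.  The right coaction becomes a left
    one for the opposite comultiplication, of which [op1] and [op4] are two
    coverings, and the two coverings of the coaction are exchanged.  [lcovi] and [opcovi]
    are the inverse coactions. *)
Definition opact (x : nopp Q) (a : A) : A := ract a x.
Definition opcov (a : A) (x : nopp Q) : tensor (nopp Q) A := fcovl x a.
Definition opcovl (x : nopp Q) (a : A) : tensor (nopp Q) A := fcov a x.
Definition lcovi : A -> Q -> tensor Q A := cov_inv S Sinv lcovl.
Definition opcovi : A -> nopp Q -> tensor (nopp Q) A :=
  @cov_inv k (nopp Q) S Sinv A opcovl.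
Definition op1 (x y : nopp Q) : tensor (nopp Q) (nopp Q) := tswap (cm2 D y x).
Definition op4 (x y : nopp Q) : tensor (nopp Q) (nopp Q) := tswap (cm3 D y x).

Lemma opcovE a x : opcov a x = tswap (rcovl U x a). Proof. by []. Qed.
Lemma lcoviE a x : lcovi a x = tmap Sinv id (lcovl (S x) a). Proof. by []. Qed.
Lemma opcoviE a (x : Q) : opcovi a x = tmap Sinv id (tswap (rcov U a (S x)) : tensor Q A).
Proof. by []. Qed.

Lemma lact_module : module lact.
Proof. by split; [exact: lact_bilin lmP | exact: lactM lmP | exact: lact_unital lmP]. Qed.

Lemma opact_module : module opact.
Proof.
split.
- by case: (ract_bilin rmP) => h1 h2; split=> [x|a]; [exact: h2 | exact: h1].
- by move=> x y a; exact: (ractM rmP).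
exact: (ract_unital rmP).
Qed.

Lemma lcovP : covered lcov lcovl. Proof. exact: lcov_covered GP. Qed.
Lemma fcovP : covered fcov fcovl. Proof. exact: fcov_covered UP. Qed.
Lemma opcovP : covered opcov opcovl. Proof. exact: (covered_op fcovP). Qed.

Lemma trivial_algebra (a : A) : (forall x : Q, x = 0) -> a = 0.
Proof.
move=> Q0; have [s ->] := act_unital lact_module a.
apply: big1 => p _; rewrite (Q0 p.1).
exact: (linP0 (bilin_l p.2 (act_bilin lact_module))).
Qed.

Section CounitOnA.
Variable eps : Q -> k.
Hypothesis epsP : counit D eps.

Lemma lcov_counit a :
  (forall x, \tsum_(y, b <- lcov a x) (eps y *: b) = eps x *: a)
  /\ (forall x, \tsum_(y, b <- lcovl x a) (eps y *: b) = eps x *: a).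
Proof.
have [e1|Q0] := counit_one HD epsP; last first.
  by split=> x; rewrite [LHS]trivial_algebra ?[RHS]trivial_algebra.
apply: (@coact_counit k Q A lcov lcovl (cm1 D) eps lcovP) => //.
- exact: counit_linear epsP.
- exact: counitM epsP.
- exact: counit_c1.
- exact: lcov_inj GP.
exact: lcov_coassoc.
Qed.

End CounitOnA.

Lemma op1_bilin : bilin op1.
Proof. by case: b2 => h1 h2; split=> x; apply: lin_comp; try exact: tswap_linear. Qed.

Lemma op4_bilin : bilin op4.
Proof. by case: b3 => h1 h2; split=> x; apply: lin_comp; try exact: tswap_linear. Qed.

Lemma op1_surj : tsurj op1.
Proof.
move=> t; have [s sE] := cm2_surj HD (@tswap k Q Q t); exists (tswap s).
rewrite -[t](@tswapK k Q Q) sE (lin_tsumE _ _ (@tswap_linear k Q Q)).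
by rewrite tsum_swapE //; exact: op1_bilin.
Qed.

Lemma op4_surj : tsurj (fun x y => op4 y x).
Proof.
move=> t; have [s sE] := cm3_surj HDc (@tswap k Q Q t); exists s.
by rewrite -[t](@tswapK k Q Q) sE (lin_tsumE _ _ (@tswap_linear k Q Q)).
Qed.

Lemma opcov_coassocl : coassocl op4 opcovl.
Proof. exact: (fcov_coassoc HD HDc UP). Qed.

Lemma opcov_coassocr : coassocr op1 opcov.
Proof.
apply: (coassoc_lr opcovP op1_bilin op4_bilin op4_surj _ opcov_coassocl) => x y z w.
have sl := @tswap_linear k Q Q.
transitivity (@tswap k Q Q ((y : Q) *| cm3 D ((x : Q) ** (z : Q)) w)); last first.
  by rewrite tswap_map //; lin.
rewrite -(cm_23' HD HDc) (lin_tsumE _ _ sl) /op4 tsum_swapE; last first.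
  by lin.
rewrite tsum_swap /op1; symmetry.
under eq_tsum => p q do rewrite (lin_tsumE _ _ sl).
rewrite [RHS]tsum_swapE; last by lin.
apply: eq_tsum => p q.
by apply: eq_tsum => u v; rewrite /tswap tsum_pure; lin.
Qed.

Section HalfCounit.
Variable eps : Q -> k.
Hypothesis epsP : counit D eps.
Hypothesis S1 : forall x y, \tsum_(u, v <- cm1 D x y) (S u ** v) = eps x *: y.
Hypothesis S2 : forall x y, \tsum_(u, v <- cm2 D x y) (u ** S v) = eps y *: x.

Lemma opcov_counit a :
  (forall x, \tsum_(y, b <- opcov a x) (eps y *: b) = eps x *: a)
  /\ (forall x, \tsum_(y, b <- opcovl x a) (eps y *: b) = eps x *: a).
Proof.
have [e1|Q0] := counit_one HD epsP; last first.
  by split=> x; rewrite [LHS]trivial_algebra ?[RHS]trivial_algebra.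
apply: (@coact_counit k (nopp Q) A opcov opcovl op1 eps opcovP) => //.
- exact: (counit_linear epsP).
- by move=> x y; rewrite (counitM epsP) mulrC.
- move=> x y; rewrite /op1 tsum_swapE; first exact: (counit_c2 HD epsP).
  have el : linear (eps : Q -> k^o) := counit_linear epsP.
  by lin.
- exact: rcovl_inj UP.
exact: opcov_coassocr.
Qed.

Lemma lcov_invK a e : \tsum_(x, b <- lcovi a e) lcov b x = e \ox a.
Proof.
apply: (@cov_invK k Q S Sinv A lcov lcovl lcovP Sl Sil SM SK SinvK (cm4 D) eps) => //.
- exact: (tsurj_flip b4 (cm4_surj HDc)).
- exact: (coassoc_rl lcovP b1 (cm1_surj HD) (cm_41 HD HDc) (lcov_coassoc GP HD)).
- by move=> b x; have [_ ->] := lcov_counit epsP b.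
by move=> x y; exact: (antipode_c4 HD HDc SP SK SinvK S2).
Qed.

Lemma lcov_Kinv a e : \tsum_(x, b <- lcov a e) lcovi b x = e \ox a.
Proof.
apply: (@covK_inv k Q S Sinv A lcov lcovl lcovP Sl Sil SM SK SinvK (cm1 D) eps) => //.
- exact: cm1_surj.
- exact: lcov_coassoc.
by move=> b x; have [-> _] := lcov_counit epsP b.
Qed.

Lemma opcov_invK a e : \tsum_(x, b <- opcovi a e) opcov b x = e \ox a.
Proof.
have SM' (x y : nopp Q) : S (x ** y) = (S y : nopp Q) ** (S x : nopp Q) by exact: SM.
apply: (@cov_invK k (nopp Q) S Sinv A opcov opcovl opcovP Sl Sil SM' SK SinvK op4 eps) => //.
- exact: op4_surj.
- exact: opcov_coassocl.
- by move=> b x; have [_ ->] := opcov_counit b.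
move=> x y; rewrite /op4 tsum_swapE; first exact: (antipode_c3 HD HDc SP SK SinvK S1).
by lin.
Qed.

Lemma opcov_Kinv a e : \tsum_(x, b <- opcov a e) opcovi b x = e \ox a.
Proof.
have SM' (x y : nopp Q) : S (x ** y) = (S y : nopp Q) ** (S x : nopp Q) by exact: SM.
apply: (@covK_inv k (nopp Q) S Sinv A opcov opcovl opcovP Sl Sil SM' SK SinvK op1 eps) => //.
- exact: op1_surj.
- exact: opcov_coassocr.
- by move=> b x; have [-> _] := opcov_counit b.
move=> x y; rewrite /op1 tsum_swapE; first exact: S2.
by lin.
Qed.
End HalfCounit.

Lemma left_half : long_half (@nmul k A) lact lcov lcovi.
Proof.
have [eps [epsP S1 S2]] := antipode_counit HD SP.
have long y a x : lcov (lact y a) x = tmap id (lact y) (lcov a x).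
  by apply: memb_tinj; rewrite (memb_lcov GP) (fsl_ll AP).
split.
- exact: lact_module.
- exact: nmul_bilin.
- by exists lcovl; exact: lcovP.
- by exists (covl_inv S Sinv lcov); apply: covered_inv; first exact: lcovP.
- exact: (lcov_invK epsP S2).
- exact: (lcov_Kinv epsP S1).
- exact: lcov_mul GP.
- exists (cm1 D); split=> //; [exact: cm1_surj | exact: lcov_coassoc |].
  by move=> x y b b'; rewrite (lact_mul lmP) (T1_pure HD).
- exact: long.
by move=> y a x; apply: (cov_inv_nat lcovP lcovP) => //; have := lact_bilin lmP; lin.
Qed.

Lemma opcov_ract y a x : opcov (opact y a) x = tmap id (opact y) (opcov a x).
Proof.
have rl : linear (ract^~ y) by exact: (bilin_l y (ract_bilin rmP)).
apply: (covl_nat fcovP fcovP) => // b z.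
rewrite !fcovE -tswap_map //; congr tswap.
by apply: memb_tinj; rewrite (memb_rcov UP) (fsl_rr AP).
Qed.

Lemma opcov_lact y a x : opcov (lact y a) x = tmap id (lact y) (opcov a x).
Proof.
have rl : linear (lact y) by exact: (bilin_r y (lact_bilin lmP)).
apply: (covl_nat fcovP fcovP) => // b z.
rewrite !fcovE -tswap_map //; congr tswap.
by apply: memb_tinj; rewrite (memb_rcov UP) (fsl_lr AP).
Qed.

Lemma right_half : long_half (fun a b : A => b ** a) opact opcov opcovi.
Proof.
have [eps [epsP S1 S2]] := antipode_counit HD SP.
have SM' (x y : nopp Q) : S (x ** y) = (S y : nopp Q) ** (S x : nopp Q) by exact: SM.
split.
- exact: opact_module.
- by lin.
- by exists opcovl; exact: opcovP.
- exists (covl_inv S Sinv opcov); apply: (@covered_inv k (nopp Q)) => //.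
  exact: opcovP.
- exact: (opcov_invK epsP S1).
- exact: (opcov_Kinv epsP S2).
- by move=> a b x; exact: (fcovl_mul UP).
- exists op1; split.
  + exact: op1_bilin.
  + exact: op1_surj.
  + exact: opcov_coassocr.
  move=> x y b b'; rewrite /opact (ract_mul rmP) (T2_pure HD) /op1 tsum_swapE //.
  by have rb := ract_bilin rmP; lin.
- exact: opcov_ract.
move=> y a x; apply: (@cov_inv_nat k (nopp Q) A A opcov opcovl opcov opcovl opcovP opcovP) => //.
- exact: (bilin_l y (ract_bilin rmP)).
exact: opcov_ract.
Qed.

Lemma four_sides_pair : long_pair lact lcov opact opcov.
Proof.
split.
- by move=> x y a; exact: (bimodule_compat (fsl_bimodule AP)).
- have h1 : cocommute lcov fcov := cocommute_lr GP UP (fsl_bicomodule AP).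
  have h2 := cocommute_sym h1.
  have h3 := cocommute_l fcovP lcovP h2.
  exact: (cocommute_sym h3).
- by move=> y a x; apply: memb_tinj; rewrite (memb_lcov GP) (fsl_rl AP).
by move=> x a y; exact: opcov_lact.
Qed.
Let lb := lact_bilin lmP.
Let rb := ract_bilin rmP.
Let nb := nmul_bilin A.
Let left := left_half.
Let right := right_half.
Let pair := four_sides_pair.
Let lP := lcovP.
Let oP := opcovP.

Notation Qo := (nopp Q).
Notation H := (ntens Q (nopp Q)).
Notation Do := (nopp_comult D).
Notation DH := (ntens_comult D (nopp_comult D)).
Notation act := (bimod_act lact ract).
Notation coact := (bicomod_coact Sinv G U).

(** * The Long module algebra over Q (x) Q^op *)

Definition opcovil (x : Qo) (a : A) : tensor Qo A := @covl_inv k Qo S Sinv A opcov x a.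

Lemma opcoviP : covered opcovi opcovil.
Proof.
have SM' (x y : Qo) : S (x ** y) = (S y : Qo) ** (S x : Qo) by exact: SM.
exact: (@covered_inv k Qo S Sinv A opcov opcovl oP Sl Sil SM' SK SinvK).
Qed.

Lemma nopp_hopf : mult_hopf Do. Proof. exact: mult_hopf_nopp. Qed.

Lemma nopp_cm1 (x y : Q) : cm1 Do x y = cm4 D y x.
Proof. exact: (@elemE k (ntens Qo Qo) _ _ (memb_op1 Q_hopf x y)). Qed.

Lemma QQop_hopf : mult_hopf DH.
Proof. exact: mult_hopf_ntens HD nopp_hopf. Qed.

Lemma QQop_cm1 h h' : cm1 DH h h' = tens2 (cm1 D) (cm1 Do) h h'.
Proof. exact: (@elemE k (ntens H H) _ _ (memb_tens1 HD nopp_hopf h h')). Qed.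

(** [coassoc_inv] gives this for the covering of the same comultiplication on the
    other leg. *)
Lemma opcovi_coassoc : coassocr (cm1 Do) opcovi.
Proof.
have ob := cov_bilin opcoviP.
have nq := nmul_bilin Q.
have [eps [epsP S1 S2]] := antipode_counit HD SP.
have co : coassocr (fun x y : Qo => cm2 D y x : tensor Qo Qo) opcovi.
  have := coassoc_inv opcoviP (opcov_invK epsP S1)
    (opcov_Kinv epsP S2) op1_bilin opcov_coassocr.
  by congr coassocr; apply/funext => x; apply/funext => y; rewrite /op1 tswapK.
move=> a x y; rewrite nopp_cm1.
(* the cover y of the second leg is traded for a cover z of the first one *)
apply: (lunital_cancel (lunital_tmap1 _ (lunital_nmul Q))) => z.
pose M (t : tensor Qo (tensor Qo A)) : tensor Qo (tensor Qo A) :=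
  tmap id (fun s : tensor Qo A => s |* (y : Qo)) t.
have Ml : linear M by apply: tmap_linear => //; exact: (@rm_lin k Qo A y).
pose F (u v : Qo) : tensor Qo (tensor Qo A) := \tsum_(w, b <- opcovi a u) (w \ox opcovi b v).
have Fb : bilin F by rewrite /F; lin.
transitivity (tlift F ((z : Q) *| cm4 D y x)).
  rewrite tsum_map ?tmap_tsum; lin; apply: eq_tsum => u v.
  rewrite /F -[z ** u]/((u : Qo) ** (z : Qo)) (covM opcoviP) tsum_map ?tmap_tsum; lin.
  by apply: eq_tsum => w b; rewrite tmap_tpure; lin.
rewrite -(cm_24 HD HDc) tsum_map; lin.
transitivity (M (\tsum_(u, v <- cm2 D z x) F u v)).
  rewrite (lin_tsumE _ _ Ml); apply: eq_tsum => u v; rewrite /F (lin_tsumE _ _ Ml).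
  apply: eq_tsum => w b; rewrite -[@nmul k Q y v]/((v : Qo) ** (y : Qo)) (covM opcoviP).
  by rewrite /M tmap_tpure //; exact: (@rm_lin k Qo A y).
rewrite (co a x z) (lin_tsumE _ _ Ml) tmap_tsum; lin; apply: eq_tsum => w b.
transitivity (\tsum_(u, v <- z *| cm4 D y w) (u \ox (v \ox b))).
  rewrite -(cm_24 HD HDc) tsum_map ?(lin_tsumE _ _ Ml); lin; apply: eq_tsum => u v.
  by rewrite /M tmap_tpure ?rm_pure //; exact: (@rm_lin k Qo A y).
rewrite nopp_cm1 tsum_map ?tmap_tsum; lin; apply: eq_tsum => u v.
by rewrite tmap_tpure; lin.
Qed.

Lemma lcov_opcovi_commute : cocommute lcov opcovi.
Proof.
have h1 : cocommute lcov fcov := cocommute_lr GP UP (fsl_bicomodule AP).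
have h2 := cocommute_sym h1.
have h3 : @cocommute k Qo Q A opcovi lcov :=
  @cocommute_inv k Qo Q A opcovl lcov lcovl lP S Sinv Sil h2.
exact: (cocommute_sym h3).
Qed.

Lemma opcovi_mul a b (x : Qo) : opcovi (a ** b) x
  = \tsum_(y, b0 <- opcovi b x) \tsum_(z, a0 <- opcovi a y) (z \ox (a0 ** b0)).
Proof.
have ob := cov_bilin opcoviP.
have fl : linear (fun t => tmap Sinv id (tswap t : tensor Q A) : tensor Q A).
  exact: (lin_comp (tmap_linear Sil (@lin_idfun k A)) (@tswap_linear k A Q)).
have Fb : bilin (fun (y : Qo) b0 => \tsum_(z, a0 <- opcovi a y) (z \ox (a0 ** b0))).
  by lin.
rewrite !opcoviE (rcov_mul UP) (lin_tsumE _ _ fl) tsum_map // tsum_swapE; last by lin.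
apply: eq_tsum => b0 y; rewrite (lin_tsumE _ _ fl) opcoviE SinvK.
rewrite tsum_map //; last by lin.
rewrite tsum_swapE; last by lin.
apply: eq_tsum => a0 z.
by rewrite /tswap tsum_pure ?tmap_tpure //; lin.
Qed.

Lemma opcovi_lact y a x : opcovi (lact y a) x = tmap id (lact y) (opcovi a x).
Proof.
apply: (@cov_inv_nat k Qo A A opcov opcovl opcov opcovl oP oP) => //.
  exact: (bilin_r y lb).
exact: opcov_lact.
Qed.

Lemma opcovi_ract y a x : opcovi (ract a y) x = tmap id (ract^~ y) (opcovi a x).
Proof. exact: (half_longi right). Qed.

Definition hcov : A -> H -> tensor H A := tcov lcov opcovi.
Definition hcovl : H -> A -> tensor H A := tcovl lcovl opcovil.

Lemma hcovP : covered hcov hcovl.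
Proof. exact: (tcov_covered lP opcoviP). Qed.

Lemma hcov_pure a x (y : Qo) : hcov a (x \ox y)
  = \tsum_(z, a0 <- lcov a x) \tsum_(w, a1 <- opcovi a0 y) ((z \ox w) \ox a1).
Proof. exact: (tcov_pure lP opcoviP). Qed.

Lemma hcov_mul a b h : hcov (a ** b) h
  = \tsum_(h1, b0 <- hcov b h) \tsum_(h2, a0 <- hcov a h1) (h2 \ox (a0 ** b0)).
Proof.
apply: (tcov_mul lP opcoviP (nmul_bilin A)); first exact: (lcov_mul GP).
exact: opcovi_mul.
Qed.

Lemma hcov_coassoc : coassocr (cm1 DH) hcov.
Proof.
move=> a h h'.
have := @tcov_coassoc k Q Qo A lcov lcovl opcovi opcovil lP opcoviP (cm1 D) (cm1 Do)
  lcov_opcovi_commute (cm1_bilin HD) (cm1_bilin nopp_hopf)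
  (lcov_coassoc GP HD) opcovi_coassoc a h h'.
rewrite -QQop_cm1 => ->; apply: eq_tsum => z b.
by rewrite QQop_cm1.
Qed.

(** The second coaction is undone by its inverse and the counit. *)
Lemma hcov_inj a : (forall h, hcov a h = 0) -> a = 0.
Proof.
move=> h0.
have [eps [epsP S1 S2]] := antipode_counit HD SP.
have el : linear (eps : Q -> k^o) := counit_linear epsP.
have [[e e1]|Q0] := counit_one HD epsP; last exact: (trivial_algebra a Q0).
apply: (lcov_inj GP) => x.
pose Phi (t : tensor (tensor Q Qo) A) : tensor Q A :=
  \tsum_(s, b <- t) \tsum_(z, w <- s) \tsum_(y, b0 <- opcov b w) (eps y *: (z \ox b0)).
have Phil : linear Phi by rewrite /Phi; lin.
have := congr1 Phi (h0 (x \ox (e : Qo))); rewrite (linP0 Phil) hcov_pure (lin_tsumE _ _ Phil).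
move=> <-.
rewrite -[lcov a x in LHS]tsum_eta; apply: eq_tsum => z a0.
rewrite (lin_tsumE _ _ Phil).
transitivity (\tsum_(y, b0 <- \tsum_(w, b <- opcovi a0 e) opcov b w) (eps y *: (z \ox b0))).
  rewrite (half_invK right) tsum_pure ?e1 ?scale1r //.
  by lin.
rewrite tsum_bind; last by lin.
apply: eq_tsum => w b; rewrite /Phi tsum_pure; last by lin.
by rewrite tsum_pure; lin.
Qed.

(** The rearrangement of the legs of the bicoaction by which the coaction of
    Q (x) Q^op is defined is an isomorphism of algebras, since S^-1 reverses
    products. *)
Notation theta := (tlift (fun x r => tlift (fun a0 y => (x \ox Sinv y) \ox a0) r)
       : ntens Q (ntens A Q) -> ntens (ntens Q Qo) A).

Lemma theta_lin : linear (theta : tensor Q (tensor A Q) -> tensor (tensor Q Q) A).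
Proof. by lin. Qed.

Lemma theta_pure x a y : theta (x \ox (a \ox y)) = (x \ox Sinv y) \ox a.
Proof. by rewrite !tsum_pure; lin. Qed.

Lemma theta_bij : bijective theta.
Proof.
pose eta (t : tensor (tensor Q Q) A) : tensor Q (tensor A Q) :=
  \tsum_(s, a <- t) \tsum_(x, y <- s) (x \ox (a \ox S y)).
have el : linear eta by rewrite /eta; lin.
exists eta.
  apply: eq_lin3'.
  - exact: (lin_comp el theta_lin).
  - by lin.
  by move=> x a y; rewrite theta_pure /eta !tsum_pure ?SinvK; lin.
apply: eq_lin3.
- exact: (lin_comp theta_lin el).
- by lin.
by move=> x y a; rewrite /eta tsum_pure; lin; rewrite tsum_pure ?theta_pure ?SK; lin.
Qed.
Lemma theta_mul : {morph theta : s t / s ** t}.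
Proof.
have m1 := @ntens_bil k Q (ntens A Q); have m2 := @ntens_bil k H A.
move=> s t; move: s; apply: eq_lin3' => [||x a y].
- exact (lin_comp theta_lin (bilin_l t m1)).
- exact (lin_comp (bilin_l (theta t) m2) theta_lin).
move: t; apply: eq_lin3'.
- exact (lin_comp theta_lin (bilin_r _ m1)).
- exact (lin_comp (bilin_r _ m2) theta_lin).
move=> x' a' y'; rewrite !theta_pure.
rewrite [in LHS]/= !ntens_mul_tpure [in LHS]/= ntens_mul_tpure theta_pure.
by rewrite /= ntens_mul_tpure /= ntens_mul_tpure (SinvM SM SK SinvK).
Qed.

Lemma bicoactP a : bicoact_spec G U a (bicoact G U a).
Proof.
have [X XE] := bicomodule_compat (fsl_bicomodule AP) a.
by rewrite /bicoact; case: xgetP => // /(_ X).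
Qed.

Lemma mulL_bicoact a x (s : tensor A Q) :
  mulL (bicoact G U a) (x \ox s) = \tsum_(z, a0 <- lcov a x) (z \ox mulL (U a0) s).
Proof.
have [E _] := bicoactP a x.
have [e he] := nalg_local_units [:: x]; have [_ xe] := he x (mem_head _ _).
pose es : ntens Q (ntens A Q) := (e \ox s : tensor Q (tensor A Q)).
have h : mulL (bicoact G U a) (mulL (mtens (memb x) mone) es) = _
  := congr1 (fun m => mulL m es) E.
rewrite /es mtens_pure /= xe in h; rewrite h {h}.
rewrite (lin_tsumE _ _ (@mulL_lin k (ntens Q (ntens A Q)) _)) -/(lcov a x).
have ul : linear U by case: (rcoact_hom UP).
have tb := tpure_bilin Q (tensor A Q).
have Fb : bilin (fun (z : Q) (a0 : A) => z \ox (mulL (U a0) s : tensor A Q)).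
  split=> [z|b]; last exact (bilin_l _ tb).
  exact (lin_comp (bilin_r z tb) (lin_comp (@mulL_lin k (ntens A Q) s) ul)).
rewrite -{2}xe (covM lP) tsum_map //; last first.
  exact: (bilin_l e (nmul_bilin Q)).
by apply: eq_tsum => z a0; rewrite mtens_pure.
Qed.

Lemma mulL_coact a h b : mulL (coact a) (h \ox b) = tmap id (fun a0 => a0 ** b) (hcov a h).
Proof.
have hb := cov_bilin hcovP.
have tb := tpure_bilin H A.
have ml := @mulL_tlin k H A (coact a).
have rl := tmap_linear (@lin_idfun k H) (bilin_l b nb).
move: h; apply: tlift_unique.
- exact (lin_comp ml (bilin_l b tb)).
- exact (lin_comp rl (bilin_r a hb)).
move=> x y.
have -> : (x \ox y) \ox b = theta (x \ox (b \ox S y)) by rewrite theta_pure SK.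
rewrite /bicomod_coact (@mpushE k _ _ theta theta_lin theta_mul theta_bij).
rewrite mulL_bicoact (lin_tsumE _ _ theta_lin) hcov_pure (lin_tsumE _ _ rl).
apply: eq_tsum => z a0; rewrite (mulL_rcoact UP) (lin_tsumE _ _ rl) opcoviE.
have tzb : bilin (fun w a1 => tmap (@id H) (fun a2 : A => a2 ** b) ((z \ox w) \ox a1)).
  by lin.
rewrite (tsum_map _ tzb) // tsum_swapE; last by lin.
rewrite tmapE (lin_tsumE (F := tpure z)); last by lin.
rewrite (lin_tsumE _ _ theta_lin); apply: eq_tsum => a1 w.
by rewrite theta_pure tmap_tpure //; exact: (bilin_l b nb).
Qed.

Lemma coact_comodule : left_comodule_algebra DH coact.
Proof.
apply: (left_comodule_intro QQop_hopf hcovP mulL_coact hcov_mul hcov_inj hcov_coassoc).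
Qed.

Lemma coact_covE a h : lcoact_cov coact a h = hcov a h.
Proof. exact: (lcoact_cov_intro hcovP mulL_coact). Qed.

Lemma act0_bilin a : bilin (fun x y => ract (lact x a) y).
Proof. by lin. Qed.

Lemma act_pure x y a : act (x \ox y) a = ract (lact x a) y.
Proof. exact: (tsum_pure _ _ (act0_bilin a)). Qed.

Lemma act_bil : bilin act.
Proof.
split=> [h|a]; last exact: (tlift_linear (act0_bilin a)).
by apply: lin_tsum => x y; lin.
Qed.

(** The right module algebra axiom with the covering that occurs in the opposite of
    Q *)
Lemma ract_mul4 (p q : A) y y' :
  ract (p ** ract q y') y = \tsum_(u, v <- cm4 D y' y) (ract p u ** ract q v).
Proof.
have [g [pg _]] := lunital2 p p (module_lunital (opact_module)).
rewrite -{1}pg (ract_mul rmP) (T2_pure HD).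
transitivity (\tsum_(u, v <- tmap id (nmul y') (cm2 D g y)) (ract p u ** ract q v)).
  rewrite tsum_map; lin.
  by apply: eq_tsum => u v; rewrite (ractM rmP).
rewrite (cm_24 HD HDc) tsum_map; lin.
by apply: eq_tsum => u v; rewrite (ractM rmP) -[ract p g]/(opact g p) pg.
Qed.

Lemma act_module_algebra : left_module_algebra DH act.
Proof.
have comp := bimodule_compat (fsl_bimodule AP).
have ab := act_bil; have hb := @ntens_bil k Q Qo.
split.
- exact: ab.
- move=> s t a.
  move: s t; apply: eq_bilin => [||x y x' y'].
  + by split=> s; [exact (lin_comp (bilin_l a ab) (bilin_r _ hb))
      | exact (lin_comp (bilin_l a ab) (bilin_l _ hb))].
  + by split=> s; [exact (lin_comp (bilin_r _ ab) (bilin_l a ab)) | exact (bilin_l _ ab)].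
  rewrite /= ntens_mul_tpure !act_pure /= /nopp_mul.
  by rewrite (lactM lmP) (ractM rmP) comp.
- move=> a.
  have [e [ea _]] := lunital2 a a (module_lunital (lact_module)).
  have [f [fa _]] := lunital2 a a (module_lunital (opact_module)).
  exists [:: (e \ox f, a)]; rewrite big_seq1 /= act_pure ea.
  exact/esym/fa.
move=> h h' a b; rewrite (T1_pure QQop_hopf) QQop_cm1.
have t2b := tens2_bilin (cm1_bilin HD) (cm1_bilin nopp_hopf).
have Fb : bilin (fun u v => act u a ** act v b) by lin.
move: h h'; apply: eq_bilin => [||x y x' y'].
- by split=> h; [exact (lin_comp (bilin_r _ ab) (lin_comp (bilin_r a nb) (bilin_l b ab)))
    | exact (bilin_l _ ab)].
- by split=> h; [exact (lin_comp (tlift_linear Fb) (bilin_r _ t2b))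
    | exact (lin_comp (tlift_linear Fb) (bilin_l _ t2b))].
rewrite (tens2_pure _ _ _ _ (cm1_bilin HD) (cm1_bilin nopp_hopf)) !act_pure nopp_cm1.
rewrite tmid_tsum (lin_tsumE _ _ (tlift_linear Fb)) [ract (lact x' b) y']comp (lact_mul lmP)
  (T1_pure HD).
rewrite (lin_tsumE _ _ (bilin_l y rb)); apply: eq_tsum => u v.
rewrite -comp ract_mul4 (lin_tsumE _ _ (tlift_linear Fb)); apply: eq_tsum => u' v'.
by rewrite (tsum_pure _ _ Fb) !act_pure.
Qed.

Lemma hcov_act h a h' : hcov (act h a) h' = tmap id (act h) (hcov a h').
Proof.
have hb := cov_bilin hcovP; have ab := act_bil.
move: h; apply: tlift_unique.
- exact (lin_comp (bilin_l h' hb) (bilin_l a ab)).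
- by rewrite /tmap; lin.
move=> x y.
have rl : linear (ract^~ y) by exact: (bilin_l y rb).
have ll : linear (lact x) by exact: (bilin_r x lb).
rewrite act_pure.
transitivity (tmap id (ract^~ y) (tmap id (lact x) (hcov a h'))); last first.
  by rewrite tmap_comp //; apply: eq_tmap => // b; rewrite act_pure.
rewrite /hcov -(tcov_nat opcoviP ll).
- apply: (tcov_nat opcoviP rl); last exact: opcovi_ract.
  by move=> b z; exact: (pair_HK four_sides_pair).
- exact: (half_long left).
exact: opcovi_lact.
Qed.

Lemma long_QQop : long_module_algebra DH act coact.
Proof.
split.
- exact: QQop_hopf.
- exact: act_module_algebra.
- exact: coact_comodule.
move=> h h' a; rewrite coact_covE -hcov_act.
exact/esym/(memb_intro hcovP mulL_coact).
Qed.

Notation rcov := (rcov U).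
Notation rcovl := (rcovl U).
Notation L := (coact_on lact lcov).
Notation Li := (coact_on lact lcovi).
Notation R := (coact_on opact opcov).
Notation Ri := (coact_on opact opcovi).

Let LM := lact_module.
Let RM := opact_module.
Let oiP := opcoviP.
Let liP : covered lcovi (covl_inv S Sinv lcov).
Proof. by apply: covered_inv => //; exact: lcovP. Qed.

(** * The products in terms of operators *)

Lemma bicoact_right a x y :
  elem (bicoact G U a *m* mtens (memb x) (mtens mone (memb y)))
    = \tsum_(z, a0 <- lcov a x) (z \ox rcov a0 y).
Proof.
apply: (@elemE k (ntens Q (ntens A Q))).
have [E _] := bicoactP a x.
have -> : mtens (memb x) (mtens mone (memb y))
    = mtens (memb x) mone *m* mtens mone (mtens (@mone k A) (memb y)).
  by rewrite mtens_mul mmulm1 mmul1m.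
rewrite mmulA E (lin_tsumE (F := fun m => m *m* _)); last first.
  exact: (bilin_l _ (@mmul_bilin k (ntens Q (ntens A Q)))).
rewrite (memb_tsum (A := Q) (B := ntens A Q)); apply: eq_tsum => z b.
by rewrite mtens_mul mmulm1 -(memb_rcov UP) mtens_memb.
Qed.

(** The bicoaction is described by its products with covers on the right.  After a
    further multiplication by 1 (x) 1 (x) z on the right that description applies,
    and z is removed again by the link between the coverings of U. *)
Lemma bicoact_left a x y :
  elem (mtens (memb x) (mtens mone (memb y)) *m* bicoact G U a)
    = \tsum_(a0, w <- rcovl y a) \tsum_(z, a1 <- lcovl x a0) (z \ox (a1 \ox w)).
Proof.
apply: (@elemE k (ntens Q (ntens A Q))).
have mb3 := @mmul_bilin k (ntens Q (ntens A Q)).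
set M := _ *m* bicoact G U a; set t := tlift _ _.
pose one3 z : multiplier (ntens Q (ntens A Q)) := mtens mone (mtens mone (memb z)).
suff cut z : memb (t : ntens Q (ntens A Q)) *m* one3 z = M *m* one3 z.
  apply: multiplier_extL => s.
  apply: (@eq_lin3' k Q A Q (tensor Q (tensor A Q))
    (mulL (memb (t : ntens Q (ntens A Q)))) (mulL M)).
  - exact (@mulL_tlin k Q (ntens A Q) _).
  - exact (@mulL_tlin k Q (ntens A Q) M).
  move=> u v w; have [e he] := nalg_local_units [:: w]; have [ew _] := he w (mem_head _ _).
  have {1 2}-> : u \ox (v \ox w) = mulL (one3 e) (u \ox (v \ox w)).
    by rewrite !mtens_pure /= ew.
  exact (congr1 (fun m : multiplier (ntens Q (ntens A Q)) =>
    mulL m (u \ox (v \ox w) : tensor Q (tensor A Q))) (cut e)).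
pose Phi b w : tensor Q (tensor A Q) := \tsum_(z1, a1 <- lcovl x b) (z1 \ox (a1 \ox w)).
have Phib : bilin Phi by rewrite /Phi; lin.
have [_ E] := bicoactP a z.
have -> : M *m* one3 z = memb (\tsum_(b, w <- rcov a z) Phi b (y ** w) : ntens Q (ntens A Q)).
  rewrite /M -mmulA E -mpush_assoc_mtens -mpush_assoc_mul.
  rewrite (lin_tsumE _ _ (bilin_r _ (@mmul_bilin k (ntens (ntens Q A) Q)))).
  rewrite (lin_tsumE _ _ (@mpush_assoc_lin k Q A Q)) (memb_tsum (A := Q) (B := ntens A Q)).
  apply: eq_tsum => b w.
  rewrite mtens_mul -(memb_lcovl GP) -memb_mul mtens_memb mpush_assoc_memb.
  rewrite -[lcovl x b in LHS]tsum_eta (lin_tsumE (F := fun s => s \ox (y ** w))); lin.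
  rewrite (lin_tsumE _ _ (@tassoc_lin k Q A Q)); congr memb.
  by apply: eq_tsum => z1 a1; rewrite tassoc_pure.
have link : tmap id (nmul y) (rcov a z) = tmap id (fun w => w ** z) (rcovl y a).
  by apply: memb_tinj; rewrite memb_lm2 memb_rm2 (memb_rcov UP) (memb_rcovl UP) mmulA.
transitivity (memb (\tsum_(b, w <- rcovl y a) Phi b (w ** z) : ntens Q (ntens A Q))).
  rewrite /t !(memb_tsum (A := Q) (B := ntens A Q)).
  rewrite (lin_tsumE (F := fun m => m *m* one3 z)); last exact: (bilin_l _ mb3).
  apply: eq_tsum => b w; rewrite !(memb_tsum (A := Q) (B := ntens A Q)).
  rewrite (lin_tsumE (F := fun m => m *m* one3 z)); last exact: (bilin_l _ mb3).
  apply: eq_tsum => z1 a1.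
  by rewrite -!mtens_memb /one3 !mtens_mul !mmulm1 -memb_mul.
congr memb; rewrite -(tsum_map (g := id) (h := fun w => w ** z)); lin.
by rewrite -link tsum_map; lin.
Qed.

Section Sums.
Variables (X : lmodType k).

Lemma bicoact_right_tsum (F : Q -> A -> Q -> X) a e f : trilin F ->
  tlift (fun x r => tlift (fun a0 y => F x a0 (Sinv y)) r)
    (elem (bicoact G U a *m* mtens (memb e) (mtens mone (memb (S f)))))
  = \tsum_(x, a0 <- lcov a e) \tsum_(w, a1 <- opcovi a0 f) F x a1 w.
Proof.
move=> Ft.
rewrite bicoact_right tsum_bind; last by lin.
apply: eq_tsum => x a0; rewrite tsum_pure; last by lin.
rewrite opcoviE tsum_map //; last by lin.
by rewrite tsum_swapE; lin.
Qed.

Lemma bicoact_left_tsum (F : Q -> A -> Q -> X) a e f : trilin F ->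
  tlift (fun x r => tlift (fun a0 y => F (Sinv x) a0 y) r)
    (elem (mtens (memb (S e)) (mtens mone (memb f)) *m* bicoact G U a))
  = \tsum_(w, a0 <- opcov a f) \tsum_(x, a1 <- lcovi a0 e) F x a1 w.
Proof.
move=> Ft.
have Fb : bilin (fun x r => tlift (fun a0 y => F (Sinv x) a0 y) r).
  split=> [x|r]; first by lin.
  by apply: lin_tsum => a0 y; exact: (lin_comp (trilin_1 a0 y Ft) Sil).
rewrite bicoact_left tsum_bind //.
rewrite opcovE tsum_swapE; last by lin.
apply: eq_tsum => a0 y; rewrite lcoviE tsum_map //; last by lin.
rewrite tsum_bind //; apply: eq_tsum => x a1.
by rewrite tsum_pure // tsum_pure; lin.
Qed.

Variable F : A -> A -> X.
Hypothesis Fb : bilin F.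

Lemma L_Ri_covered a b e f :
  \tsum_(a0, b1 <- L a (lact e (opact f b))) \tsum_(a1, b2 <- Ri a0 b1) F a1 b2
  = \tsum_(x, a0 <- lcov a e) \tsum_(w, a1 <- opcovi a0 f) F a1 (ract (lact x b) w).
Proof.
have Rib := half_Lib right.
rewrite (coact_onE LM lP) tsum_bind; last by lin.
apply: eq_tsum => x a0; rewrite tsum_pure; last by lin.
rewrite -(pair_act pair) (coact_onE RM oiP) tsum_bind //.
by apply: eq_tsum => w a1; rewrite tsum_pure.
Qed.

Lemma R_Li_covered a b e f :
  \tsum_(a0, b1 <- R a (lact e (opact f b))) \tsum_(a1, b2 <- Li a0 b1) F a1 b2
  = \tsum_(w, a0 <- opcov a f) \tsum_(x, a1 <- lcovi a0 e) F a1 (ract (lact x b) w).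
Proof.
have Lib := half_Lib left.
rewrite -(pair_act pair) (coact_onE RM oP) tsum_bind; last by lin.
apply: eq_tsum => w a0; rewrite tsum_pure; last by lin.
rewrite (pair_act pair) (coact_onE LM liP) tsum_bind //.
apply: eq_tsum => x a1; rewrite tsum_pure //.
by rewrite -(pair_act pair).
Qed.
End Sums.

(** The cover e of b and the cover f of a pass the other coaction by the mixed Long
    conditions. *)
Lemma circledastE a b :
  circledast lact ract G U a b = circ (@nmul k A) lact lcov opact opcov a b.
Proof.
have Rb := half_Lb right.
rewrite /circledast; set f := Defs.cover _ a; set e := Defs.cover _ b.
have eb : lact e b = b := lunital_cover b (module_lunital LM).
have fa : opact f a = a := lunital_cover a (module_lunital RM).
rewrite /circ -[in RHS]eb -[in RHS]fa (coact_onE LM lP) (pair_HK pair) tsum_map; lin.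
rewrite tsum_bind; last by lin.
apply: eq_tsum => x a0; rewrite tsum_pure; last by lin.
rewrite (coact_onE RM oP) (pair_KH pair) tsum_map; lin.
rewrite tsum_bind; last by lin.
rewrite tsum_swapE; last by lin.
by apply: eq_tsum => b0 y; rewrite tsum_pure; lin.
Qed.

Lemma alphaE a : alpha ract U a = contract opact opcov a.
Proof. by rewrite /contract tsum_swapE //; have := act_bilin RM; lin. Qed.

Lemma alpha_invE a : alpha_inv S Sinv ract U a = contract opact opcovi a.
Proof.
rewrite /contract opcoviE tsum_map //; last by have := act_bilin RM; lin.
by rewrite tsum_swapE //; lin.
Qed.

Lemma bulletE a b :
  bullet S Sinv lact ract G U a b = twisted (@nmul k A) lact lcov opact opcovi a b.
Proof.
rewrite /bullet; set f := Defs.cover (fun x b => ract b x) b; set e := Defs.cover _ b.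
have eb : lact e b = b := lunital_cover b (module_lunital LM).
have fb : opact f b = b := lunital_cover b (module_lunital RM).
rewrite /twisted -[in RHS]eb -[in RHS]fb L_Ri_covered //.
by rewrite (bicoact_right_tsum (F := fun x a0 w => a0 ** ract (lact x b) w)); lin.
Qed.

Lemma left_twisted_bullet a b :
  left_twisted_product (bimod_act lact ract) (bicomod_coact Sinv G U) a b
    = bullet S Sinv lact ract G U a b.
Proof.
rewrite bulletE.
have [e [eb _]] := lunital2 b b (module_lunital LM).
have [f [fb _]] := lunital2 b b (module_lunital RM).
have actb : bimod_act lact ract (e \ox f) b = b by rewrite act_pure eb.
rewrite -{1}actb (left_twisted_productE act_module_algebra
  coact_comodule).
rewrite coact_covE hcov_pure.
rewrite /twisted -[in RHS]eb -[in RHS]fb L_Ri_covered //.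
have ab := act_bil.
rewrite tsum_bind; last by lin.
apply: eq_tsum => x a0; rewrite tsum_bind; last by lin.
by apply: eq_tsum => w a1; rewrite tsum_pure ?act_pure; lin.
Qed.

Let dqP := ldiam_quad left right.
Let rqP := rdiam_quad left right.
Let slP := lstar_quad left right.
Let srP := rstar_quad left right.
Let ll x : linear (lact x) := bilin_r x lb.
Let rl x : linear (opact x) := bilin_l x rb.

Lemma diamond_lE s t :
  diamond_l lact ract G U s t = lift4 (ldiam (@nmul k A) lact lcov opact opcov) s t.
Proof.
rewrite /diamond_l; set e := Defs.cover _ t; set f := Defs.cover _ s.
have et : tmap (lact e) id t = t := lunital_cover t (lunital_tmap1 A (module_lunital LM)).
have fs : tmap (opact f) id s = s := lunital_cover s (lunital_tmap1 A (module_lunital RM)).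
rewrite -[in RHS]et -[in RHS]fs (lift4_tmap dqP) //.
apply: eq_tsum => a b; apply: eq_tsum => a' b'.
rewrite /ldiam (coact_onE LM lP) (coact_onE RM oP) tsum_bind; last by lin.
apply: eq_tsum => x b0; rewrite tsum_pure; last by lin.
rewrite tsum_bind ?tsum_swapE; lin.
by apply: eq_tsum => b'0 y; rewrite tsum_pure; lin.
Qed.

Lemma diamond_rE s t :
  diamond_r lact ract G U s t = lift4 (rdiam (@nmul k A) lact lcov opact opcov) s t.
Proof.
rewrite /diamond_r; set e := Defs.cover _ t; set f := Defs.cover _ s.
have et : tmap id (lact e) t = t := lunital_cover t (lunital_tmap2 A (module_lunital LM)).
have fs : tmap id (opact f) s = s := lunital_cover s (lunital_tmap2 A (module_lunital RM)).
rewrite -[in RHS]et -[in RHS]fs (lift4_tmap rqP) //.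
apply: eq_tsum => b' a'; apply: eq_tsum => b a.
rewrite /rdiam (coact_onE LM lP) (coact_onE RM oP) tsum_bind; last by lin.
apply: eq_tsum => x b'0; rewrite tsum_pure; last by lin.
rewrite tsum_bind ?tsum_swapE; lin.
by apply: eq_tsum => b0 y; rewrite tsum_pure; lin.
Qed.

Lemma star_lE s t :
  star_l S Sinv lact ract G U s t = lift4 (lstar (@nmul k A) lact lcov opact opcovi) s t.
Proof.
rewrite /star_l; set e := Defs.cover _ t; set f := Defs.cover _ t.
have et : tmap (lact e) id t = t := lunital_cover t (lunital_tmap1 A (module_lunital LM)).
have ft : tmap (opact f) id t = t := lunital_cover t (lunital_tmap1 A (module_lunital RM)).
rewrite -[in RHS]et -[in RHS]ft tmap_comp // -[in RHS](tmap_id s) (lift4_tmap slP) //;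
  last exact: (lin_comp (ll e) (rl f)).
apply: eq_tsum => a b; apply: eq_tsum => a' b'.
rewrite /lstar (L_Ri_covered (F := fun b1 a'2 => (a ** a'2) \ox (b1 ** b'))); last by lin.
by rewrite (bicoact_right_tsum
  (F := fun x b0 w => (a ** ract (lact x a') w) \ox (b0 ** b'))); lin.
Qed.

Lemma star_rE s t :
  star_r S Sinv lact ract G U s t = lift4 (rstar (@nmul k A) lact lcovi opact opcov) s t.
Proof.
rewrite /star_r; set e := Defs.cover _ s; set f := Defs.cover _ s.
have es : tmap id (lact e) s = s := lunital_cover s (lunital_tmap2 A (module_lunital LM)).
have fs : tmap id (opact f) s = s := lunital_cover s (lunital_tmap2 A (module_lunital RM)).
rewrite -[in RHS]es -[in RHS]fs tmap_comp // -[in RHS](tmap_id t) (lift4_tmap srP) //;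
  last exact: (lin_comp (ll e) (rl f)).
apply: eq_tsum => b' a'; apply: eq_tsum => b a.
rewrite /rstar (R_Li_covered (F := fun b1 a'2 => (b' ** b1) \ox (a'2 ** a))); last by lin.
by rewrite (bicoact_left_tsum
  (F := fun x b0 w => (b' ** b0) \ox (ract (lact x a') w ** a))); lin.
Qed.
End FourSides.

Theorem theorem4p6 (k : fieldType) (Q : nalg k)
    (Delta : Q -> multiplier (ntens Q Q))
    (Q_hopf : regular_mult_hopf Delta)
    (S Sinv : Q -> Q)
    (S_antipode : antipode Delta (fun x => memb (S x)))
    (SK : cancel S Sinv) (SinvK : cancel Sinv S)
    (A : nalg k) (lact : Q -> A -> A) (ract : A -> Q -> A)
    (Gamma : A -> multiplier (ntens Q A))
    (Upsilon : A -> multiplier (ntens A Q))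
    (A_long : four_sides_long Delta lact ract Gamma Upsilon) :
  let act := bimod_act lact ract in
  let coact := bicomod_coact Sinv Gamma Upsilon in
  let bullet_prod := left_twisted_product act coact in
  let circ_prod := circledast lact ract Gamma Upsilon in
  [/\ long_module_algebra (ntens_comult Delta (nopp_comult Delta)) act coact,
      forall a b, bullet_prod a b = bullet S Sinv lact ract Gamma Upsilon a b,
      alg_iso bullet_prod circ_prod
        (alpha ract Upsilon) (alpha_inv S Sinv ract Upsilon),
      alg_isomorphic (diamond_r lact ract Gamma Upsilon)
        (star_r S Sinv lact ract Gamma Upsilon)
    & alg_isomorphic (diamond_l lact ract Gamma Upsilon)
        (star_l S Sinv lact ract Gamma Upsilon)].
Proof.
move=> act coact bullet_prod circ_prod.
have left := left_half Q_hopf S_antipode SK SinvK A_long.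
have right := right_half Q_hopf S_antipode SK SinvK A_long.
have pair := four_sides_pair A_long.
have bulletQ a b := left_twisted_bullet Q_hopf S_antipode SK SinvK A_long a b.
have ext2 (V : Type) (f g : V -> V -> V) : (forall a b, f a b = g a b) -> f = g.
  by move=> fg; apply/funext => a; apply/funext => b; exact: fg.
split.
- exact: (long_QQop Q_hopf S_antipode SK SinvK A_long).
- exact: bulletQ.
- have -> : bullet_prod = twisted (@nmul k A) lact (lcov Gamma) (opact ract)
  (opcovi S Sinv Upsilon).
    by apply: ext2 => a b; rewrite [LHS]bulletQ (bulletE Q_hopf S_antipode SK SinvK A_long).
  have -> : circ_prod = circ (@nmul k A) lact (lcov Gamma) (opact ract) (opcov Upsilon).
    by apply: ext2 => a b; exact: (circledastE Q_hopf S_antipode SK SinvK A_long).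
  have -> : alpha ract Upsilon = contract (opact ract) (opcov Upsilon).
    by apply/funext => a; exact: (alphaE A_long).
  have -> : alpha_inv S Sinv ract Upsilon = contract (opact ract) (opcovi S Sinv Upsilon).
    by apply/funext => a; exact: (alpha_invE S_antipode SK SinvK A_long).
  exact: circ_twisted_iso (@nmulA k A) left right pair.
- rewrite (ext2 _ _ _ (diamond_rE Q_hopf S_antipode SK SinvK A_long)).
  rewrite (ext2 _ _ _ (star_rE Q_hopf S_antipode SK SinvK A_long)).
  exact: rdiam_rstar_iso (@nmulA k A) left right pair.
rewrite (ext2 _ _ _ (diamond_lE Q_hopf S_antipode SK SinvK A_long)).
rewrite (ext2 _ _ _ (star_lE Q_hopf S_antipode SK SinvK A_long)).
exact: ldiam_lstar_iso (@nmulA k A) left right pair.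
Qed.
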